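(* Let $\alpha\in[0,1)$ and $C_0>0$. There exists $\varepsilon_0>0$ such that the following holds for every $\varepsilon\in(0,\varepsilon_0]$ and every kernel $K$ satisfying the standing kernel assumptions (described in the context) with parameters $\alpha,\varepsilon,C_0$: if $f_1$ and $f_2$ are two self-similar profiles for $K$ with the same mass, i.e. $\int_0^\infty x f_1(x)\,dx=\int_0^\infty x f_2(x)\,dx=M$ for some $M>0$, then $f_1=f_2$.
   Context: Standing kernel assumptions: $K:(0,\infty)^2\to[0,\infty)$ is symmetric, homogeneous of degree zero ($K(\lambda x,\lambda y)=K(x,y)$ for all $x,y,\lambda>0$), differentiable, and with $W(x,y):=K(x,y)-2$ it satisfies for all $x,y>0$: $W(x,y)\ge-\varepsilon$; $W(x,y)\le \varepsilon\big((x/y)^{\alpha}+(y/x)^{\alpha}\big)$; and $|\partial_x K(x,y)|\le \frac{C_0\varepsilon}{x}\big((x/y)^{\alpha}+(y/x)^{\alpha}\big)$. A self-similar profile (with finite mass) for $K$ is a function $f\in L^1_{loc}(0,\infty)$, $f\ge0$, with $\int_0^\infty x f(x)\,dx<\infty$, satisfying for almost every $x>0$ $$x^2 f(x)=\int_0^x dy\int_{x-y}^\infty dz\, K(y,z)\, y\, f(y) f(z).$$ (Such $f$ gives the self-similar solution $\phi(\xi,t)=t^{-2}f(\xi/t)$ of Smoluchowski's coagulation equation.) *)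

(* Defs.v *)
From HB Require Import structures.
From mathcomp Require Import all_boot all_order all_algebra.
From mathcomp Require Import all_classical all_reals all_analysis.
Set Implicit Arguments. Unset Strict Implicit. Unset Printing Implicit Defensive.
Import Order.TTheory GRing.Theory Num.Theory.
Import numFieldNormedType.Exports.
Local Open Scope classical_set_scope.
Local Open Scope ring_scope.

Section Defs.
Variable R : realType.

Local Notation mu := (@lebesgue_measure R).

(* Standing kernel assumptions with parameters alpha, eps, C0.
   K is only relevant on (0,oo)^2; W(x,y) = K(x,y) - 2. *)
Definition kernel_assumptions (alpha eps C0 : R) (K : R -> R -> R) : Prop :=
  (forall x y : R, 0 < x -> 0 < y -> 0 <= K x y) /\
      (forall x y : R, 0 < x -> 0 < y -> K x y = K y x) /\
      (forall x y l : R, 0 < x -> 0 < y -> 0 < l -> K (l * x) (l * y) = K x y) /\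
      (forall x y : R, 0 < x -> 0 < y ->
          (differentiable (fun p : R * R => K p.1 p.2) (x, y))) /\
      (forall x y : R, 0 < x -> 0 < y -> - eps <= K x y - 2) /\
      (forall x y : R, 0 < x -> 0 < y ->
          K x y - 2 <= eps * ((x / y) `^ alpha + (y / x) `^ alpha)) /\
      (forall x y : R, 0 < x -> 0 < y ->
          `| derive1 (fun t : R => K t y) x | <= C0 * eps / x * ((x / y) `^ alpha + (y / x) `^ alpha)).

Definition L1loc_pos (f : R -> R) : Prop :=
  measurable_fun (`]0, +oo[ : set R) f /\
  (forall a b, 0 < a -> a <= b -> mu.-integrable (`[a, b] : set R) (fun x => (f x)%:E)).

Definition mass (f : R -> R) : \bar R :=
  (\int[mu]_(x in (`]0%R, +oo[ : set R)) (x * f x)%:E)%E.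

Definition self_similar_profile (K : R -> R -> R) (f : R -> R) : Prop :=
  [/\ L1loc_pos f,
      (forall x, 0 < x -> 0 <= f x),
      (mass f < +oo)%E &
      {ae mu, forall x, 0 < x ->
        ((x ^+ 2 * f x)%:E =
         \int[mu]_(y in (`]0%R, x[ : set R)) \int[mu]_(z in (`](x - y)%R, +oo[ : set R))
             (K y z * y * f y * f z)%:E)%E}].

End Defs.

(* Main.v *)
(* After rescaling to unit mass, let h = f1 - f2 and W = K - 2. Tested against psi,
   the equation becomes
     2 int x^2 f psi = iint K f(y) f(z) [y (Psi(y+z) - Psi(y)) + z (Psi(y+z) - Psi(z))]
   with Psi' = psi. Powers psi bound all nonnegative moments; exponential psi give a
   Riccati equation u' = - u^2 + O(eps) for u(q) = (1/q) int (1 - e^(-qx)) f(x) dx,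
   so f is close to the profile e^(-x) of K = 2 in the sense of Laplace transforms.
   This bounds a moment of order -b with b < 1 and shows that u for f1 and for f2
   differ by O(eps) times a norm of h.

   With weights a = (1 - al) / 2 and b = a + al, the difference of the two equations
   is tested against (a regularisation of) psi = - (sgn(h) (x^(-1-a) + x))'. The loss
   terms carry the sign of h and dominate, which gives
     Y := int (x^(-a) + x^2) |h| <= C int x^2 e^(-x) |h| =: C Z.
   Finally psi = sgn(h) e^(-x) computes Z: the W part is O(eps Y), and for K = 2 the
   primitive of psi is a Lipschitz function of e^(-x), hence uniformly close to a
   polynomial in e^(-x), whose contribution is a combination of Laplace transforms
   of f1 and f2, again O(eps Y). So Z <= t Y for every t once eps is small, and
   Y = 0. *)
Require Import Defs.
From HB Require Import structures.
From mathcomp Require Import all_boot all_order all_algebra.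
From mathcomp Require Import all_classical all_reals all_analysis.
From mathcomp Require Import measurable_realfun ring lra.
Import Order.TTheory GRing.Theory Num.Theory.
Import numFieldNormedType.Exports.
Set Implicit Arguments. Unset Strict Implicit. Unset Printing Implicit Defensive.
Local Open Scope classical_set_scope.
Local Open Scope ring_scope.

(** * Integration *)

(** The perturbation W is unbounded: in a bilinear term it shifts exponents by al, down in one
    variable and up in the other. If that loss fell on h, the estimate of Y would not close. Hence
    two weights: h is measured with the powers -a and 2, the profiles with -b = -a - al and a large
    B, and what the weight of h cannot absorb is charged to the profiles, whose moments are bounded
    beforehand. The delicate factor is z^(-al) on h for small z: there either the good loss term
    z^(-a) wins, or z is bounded below by a power of y. The condition b < 1 serves twice, for the
    negative moment and for coercivity: both compare 1 + b with (2 - eps) times a number of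
    particles, which is close to 2. In the last step the K = 2 part is known to be O(eps Y) only for
    exponential tests. The number of exponentials and their coefficients must therefore be bounded
    independently of the profiles before eps is chosen. *)

Section RealIntegral.
Context d {T : measurableType d} {R : realType}.
Variable m : {measure set T -> \bar R}.
Implicit Types f g h : T -> R.

(** Functions on (0, oo) are extended by zero and integrated over the whole line, so that no domain
    has to be carried along. *)
Definition integ f := m.-integrable setT (EFin \o f).

Lemma integ_meas f : integ f -> measurable_fun setT f.
Proof. by move=> /integrableP[/measurable_EFinP]. Qed.

Lemma integ_le f g : measurable_fun setT f -> (forall x, `|f x| <= g x) ->
  integ g -> integ f.
Proof.
move=> mf fg; apply: le_integrable => //; first exact/measurable_EFinP.
by move=> x _ /=; rewrite lee_fin (le_trans (fg x))// ler_norm.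
Qed.

Lemma integD f g : integ f -> integ g -> integ (fun x => f x + g x).
Proof. by move=> hf hg; apply: (integrableD measurableT hf hg). Qed.

Lemma integZ c f : integ f -> integ (fun x => c * f x).
Proof. by move=> hf; apply: (integrableZl measurableT c hf). Qed.

Lemma integ_abs f : integ f -> integ (fun x => `|f x|).
Proof. by move=> hf; apply: (integrable_norm hf). Qed.

Lemma integ0 : integ (fun=> 0).
Proof. exact: integrable0. Qed.

Lemma eq_integ f g : f =1 g -> integ f -> integ g.
Proof. by move=> /funext ->. Qed.

Lemma IrD f g : integ f -> integ g ->
  \int[m]_x (f x + g x) = \int[m]_x f x + \int[m]_x g x.
Proof. exact: RintegralD. Qed.

Lemma IrZ c f : integ f -> \int[m]_x (c * f x) = c * \int[m]_x f x.
Proof. exact: RintegralZl. Qed.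

Lemma Ir_le f g : integ f -> integ g -> (forall x, f x <= g x) ->
  \int[m]_x f x <= \int[m]_x g x.
Proof. by move=> hf hg fg; apply: le_Rintegral. Qed.

Lemma eq_Ir f g : f =1 g -> \int[m]_x f x = \int[m]_x g x.
Proof. by move=> fg; apply: eq_Rintegral => x _. Qed.

Lemma Ir_EFin f : integ f -> (\int[m]_x (f x)%:E)%E = (\int[m]_x f x)%:E.
Proof. by move=> hf; rewrite fineK//; apply: integrable_fin_num. Qed.

Lemma integ_ge0P f c : measurable_fun setT f -> (forall x, 0 <= f x) ->
  (\int[m]_x (f x)%:E <= c%:E)%E -> integ f /\ \int[m]_x f x <= c.
Proof.
move=> mf f0 hc; have hf : integ f.
  apply/integrableP; split; first exact/measurable_EFinP.
  under eq_integral do rewrite /= ger0_norm ?f0//.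
  by apply: le_lt_trans hc _; rewrite ltry.
by split => //; rewrite -lee_fin -Ir_EFin.
Qed.

(** Meant for regularised weights: a bound uniform in the regularisation gives integrability and the
    same bound for the singular weight. *)
Lemma fatou_Ir (u : nat -> T -> R) f c :
  (forall n, integ (u n)) -> (forall n x, 0 <= u n x) ->
  (forall n, \int[m]_x u n x <= c) -> measurable_fun setT f ->
  (forall x, u ^~ x @ \oo --> f x) -> integ f /\ \int[m]_x f x <= c.
Proof.
move=> iu u0 uc mf uf.
have f0 x : 0 <= f x.
  rewrite -(cvg_lim _ (uf x))//; apply: limr_ge; last by near=> n; exact: u0.
  by apply/cvg_ex; exists (f x).
apply: integ_ge0P => //.
have ue x : EFin \o u ^~ x @ \oo --> (f x)%:E by apply: cvg_EFin; [exact: nearW|exact: uf].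
have -> : (\int[m]_x (f x)%:E = \int[m]_x limn_einf (fun n => (u n x)%:E))%E.
  apply: eq_integral => x _; by have [] := cvg_limn_einf_sup (ue x).
apply: (le_trans (fatou m measurableT _ _)).
- by move=> n; apply/measurable_EFinP; exact: integ_meas.
- by move=> n x _; rewrite lee_fin.
- rewrite limn_einf_lim; apply: lime_le.
    exact: is_cvg_einfs.
  near=> n; apply: (@le_trans _ _ (\int[m]_x (u n x)%:E)%E).
    by apply: ereal_inf_lbound; exists n => /=.
  by rewrite Ir_EFin// lee_fin.
Unshelve. all: by end_near. Qed.

Lemma dct_Ir (u : nat -> T -> R) f g :
  (forall n, measurable_fun setT (u n)) -> measurable_fun setT f ->
  (forall n x, `|u n x| <= g x) -> integ g ->
  {ae m, forall x, u ^~ x @ \oo --> f x} ->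
  integ f /\ (fun n => \int[m]_x u n x) @ \oo --> \int[m]_x f x.
Proof.
move=> mu_ mf ug ig uf.
have [] := @dominated_convergence _ T R m setT measurableT
  (fun n => EFin \o u n) (EFin \o f) (EFin \o g).
- by move=> n; apply/measurable_EFinP.
- exact/measurable_EFinP.
- by apply: filterS uf => x ux _; apply: cvg_EFin; [exact: nearW|exact: ux].
- by [].
- by apply: aeW => x n _ /=; rewrite lee_fin.
move=> iF _ h; split => //; apply: fine_cvg.
by rewrite /Rintegral fineK//; apply: integrable_fin_num.
Qed.

End RealIntegral.

(** * Product integrals and dilations of Lebesgue measure *)

Section ProductIntegral.
Context {R : realType}.
Local Notation mu := (@lebesgue_measure R).
Local Notation mu2 := (mu \x mu)%E.
Local Notation RR := (measurableTypeR R * measurableTypeR R)%type.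

Lemma measurable_comp_fst (f : R -> R) : measurable_fun setT f ->
  measurable_fun (setT : set RR) (fun p => f p.1).
Proof.
move=> mf; apply: (@measurableT_comp _ _ _ _ (measurableTypeR R) _ f) => //.
Qed.

Lemma measurable_comp_snd (f : R -> R) : measurable_fun setT f ->
  measurable_fun (setT : set RR) (fun p => f p.2).
Proof.
move=> mf; apply: (@measurableT_comp _ _ _ _ (measurableTypeR R) _ f) => //.
Qed.

Lemma measurable_comp2 (f : R -> R) (g : RR -> R) : measurable_fun setT f ->
  measurable_fun (setT : set RR) g -> measurable_fun (setT : set RR) (fun p => f (g p)).
Proof. by move=> mf mg; exact: (measurableT_comp mf mg). Qed.

Lemma measurable_fst_id : measurable_fun (setT : set RR) (fun p => p.1 : R).
Proof. exact: (measurable_comp_fst (@measurable_id _ _ setT)). Qed.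

Lemma measurable_snd_id : measurable_fun (setT : set RR) (fun p => p.2 : R).
Proof. exact: (measurable_comp_snd (@measurable_id _ _ setT)). Qed.

Lemma integ_prod (f g : R -> R) : integ mu f -> integ mu g ->
  integ mu2 (fun p => f p.1 * g p.2) /\
  \int[mu2]_p (f p.1 * g p.2) = (\int[mu]_x f x) * (\int[mu]_x g x).
Proof.
move=> hf hg.
have mfg : measurable_fun setT (fun p : RR => f p.1 * g p.2).
  apply: measurable_funM.
  - exact: (measurable_comp_fst (integ_meas hf)).
  - exact: (measurable_comp_snd (integ_meas hg)).
have i2 : integ mu2 (fun p => f p.1 * g p.2).
  apply/integrable12ltyP; first exact/measurable_EFinP.
  have gn : (\int[mu]_y `|(g y)%:E| = (\int[mu]_y `|g y|)%:E)%E.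
    by rewrite -Ir_EFin//; exact: integ_abs.
  have -> : (\int[mu]_x \int[mu]_y `|(EFin \o (fun p => (f p.1 * g p.2)%R)) (x, y)|
      = \int[mu]_x (`|f x| * \int[mu]_y `|g y|)%:E)%E.
    apply: eq_integral => x _; rewrite EFinM -gn -ge0_integralZl_EFin//.
    - by apply: eq_integral => y _ /=; rewrite normrM EFinM.
    - apply/measurable_EFinP; apply: measurableT_comp => //.
      exact: integ_meas hg.
  rewrite -[X in (X < _)%E]fineK ?ltry//.
  apply: (integrable_fin_num measurableT).
  have := integZ (\int[mu]_y `|g y|) (integ_abs hf).
  by apply: eq_integ => x; rewrite mulrC.
split => //; apply: EFin_inj; rewrite -Ir_EFin//.
rewrite -(integral12_prod_meas1 i2) /fubini_F /=.
have -> : (\int[mu]_x \int[mu]_y (f x * g y)%:E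
    = \int[mu]_x (f x * \int[mu]_y g y)%:E)%E.
  apply: eq_integral => x _; rewrite -IrZ// -Ir_EFin//; exact: integZ.
rewrite Ir_EFin; last first.
  by apply: eq_integ (integZ (\int[mu]_y g y) hf) => x; rewrite mulrC.
by congr EFin; rewrite [RHS]mulrC -IrZ//; apply: eq_Ir => x; rewrite mulrC.
Qed.

Lemma integ_swap (k : RR -> R) : integ mu2 k ->
  integ mu2 (fun p => k (p.2, p.1)) /\
  \int[mu2]_p k (p.2, p.1) = \int[mu2]_p k p.
Proof.
move=> hk; have mk := integ_meas hk.
have mk' : measurable_fun setT (fun p : RR => k (p.2, p.1)).
  by apply: (measurableT_comp mk); apply: measurable_fun_pair.
have ik' : integ mu2 (fun p => k (p.2, p.1)).
  apply/integrable12ltyP; first exact/measurable_EFinP.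
  by move/integrable21ltyP : hk => /=; apply; exact/measurable_EFinP.
split => //; apply: EFin_inj; rewrite -!Ir_EFin//.
by rewrite -(integral12_prod_meas1 ik') -(integral21_prod_meas1 hk).
Qed.

(** Lebesgue measure is c times its pushforward under x -> c x, since both give an interval ]a, b]
    its length; uniqueness of the measure does the rest. *)
Lemma ge0_integral_scale (c : R) (f : R -> \bar R) : 0 < c ->
  measurable_fun setT f -> (forall x, (0 <= f x)%E) ->
  (\int[mu]_x f (c * x)%R = (c^-1)%:E * \int[mu]_x f x)%E.
Proof.
move=> c0 mf f0.
have mphi : measurable_fun setT (fun x : R => c * x) by exact: mulrl_measurable.
pose phi : measurableTypeR R -> measurableTypeR R := fun x => c * x.
have mph : measurable_fun setT phi by exact: mphi.
pose nu : {measure set (measurableTypeR R) -> \bar R} :=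
  measure_function_pushforward__canonical__measure_function_Measure mu mph.
have nuE A : measurable A -> mu A = mscale (NngNum (ltW c0)) (nu) A.
  move=> mA; apply: lebesgue_measure_unique => // _ [[a b] _ <-] /=.
  rewrite /nu /mscale/= /pushforward.
  have -> : phi @^-1` `]a, b] = `](a / c), (b / c)]%classic.
    by apply/seteqP; split => x /=; rewrite /phi !in_itv/= ltr_pdivrMr// ler_pdivlMr// ![x * c]mulrC.
  rewrite !lebesgue_measure_itv/= !lte_fin ltr_pM2r ?invr_gt0//.
  case: ifPn => // _; last by rewrite mule0.
  by rewrite -!EFinB -EFinM -mulrBl mulrC divfK// gt_eqF.
have -> : (\int[mu]_x f x = \int[mscale (NngNum (ltW c0)) (nu)]_x f x)%E.
  by apply: eq_measure_integral => A mA _; exact: nuE.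
rewrite ge0_integral_mscale// ge0_integral_pushforward//.
by rewrite muleA -EFinM mulVf ?gt_eqF// mul1e.
Qed.

End ProductIntegral.

(* An interface to the integral; the two instances used below are opaque, which
   keeps unification from unfolding the Lebesgue integral. *)
Record integration (R : realType) (T : Type) := Integration {
  msr : (T -> R) -> Prop;
  itg : (T -> R) -> Prop;
  Itg : (T -> R) -> R;
  aev : (T -> Prop) -> Prop;
  msr_cst : forall c, msr (fun=> c);
  msrD : forall f g, msr f -> msr g -> msr (fun x => f x + g x);
  msrM : forall f g, msr f -> msr g -> msr (fun x => f x * g x);
  msr_comp : forall (phi : R -> R) f, measurable_fun setT phi -> msr f ->
    msr (fun x => phi (f x));
  msr_if : forall f g u v, msr f -> msr g -> msr u -> msr v ->
    msr (fun x => if f x < g x then u x else v x);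
  itg_msr : forall f, itg f -> msr f;
  itg_le : forall f g, msr f -> (forall x, `|f x| <= g x) -> itg g -> itg f;
  itgD : forall f g, itg f -> itg g -> itg (fun x => f x + g x);
  itgZ : forall c f, itg f -> itg (fun x => c * f x);
  ItgD : forall f g, itg f -> itg g ->
    Itg (fun x => f x + g x) = Itg f + Itg g;
  ItgZ : forall c f, itg f -> Itg (fun x => c * f x) = c * Itg f;
  Itg_le : forall f g, itg f -> itg g -> (forall x, f x <= g x) ->
    Itg f <= Itg g;
  itg0 : itg (fun=> 0);
  itg_abs : forall f, itg f -> itg (fun x => `|f x|);
  itg_fatou : forall (u : nat -> T -> R) f c, (forall n, itg (u n)) ->
    (forall n x, 0 <= u n x) -> (forall n, Itg (u n) <= c) -> msr f ->
    (forall x, u ^~ x @ \oo --> f x) -> itg f /\ Itg f <= c;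
  Itg_dct : forall (u : nat -> T -> R) f g, (forall n, msr (u n)) -> msr f ->
    (forall n x, `|u n x| <= g x) -> itg g ->
    aev (fun x => u ^~ x @ \oo --> f x) ->
    itg f /\ (fun n => Itg (u n)) @ \oo --> Itg f;
  aevW : forall P : T -> Prop, (forall x, P x) -> aev P;
  aevS : forall P Q : T -> Prop, (forall x, P x -> Q x) -> aev P -> aev Q }.

Section IntegrationOfMeasure.
Context d {T : measurableType d} {R : realType}.
Variable m : {measure set T -> \bar R}.

Definition integration_of_measure : integration R T.
Proof.
refine (@Integration R T (fun f => measurable_fun setT f) (fun f => integ m f)
  (fun f => \int[m]_x f x) (fun P => {ae m, forall x, P x})
  _ _ _ _ _ _ _ _ _ _ _ _ _ _ _ _ _ _).
- by move=> c; exact: measurable_cst.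
- by move=> f g; exact: measurable_funD.
- by move=> f g; exact: measurable_funM.
- by move=> phi f mphi mf; exact: (measurableT_comp mphi mf).
- by move=> f g u v mf mg mu_ mv; apply: measurable_fun_ifT => //; exact: measurable_fun_ltr.
- exact: integ_meas.
- exact: integ_le.
- exact: integD.
- exact: integZ.
- exact: IrD.
- exact: IrZ.
- exact: Ir_le.
- exact: integ0.
- exact: integ_abs.
- exact: fatou_Ir.
- exact: dct_Ir.
- by move=> P hP; apply: aeW.
- by move=> P Q PQ; apply: (@filterS _ _ (ae_filter_ringOfSetsType m)).
Defined.

End IntegrationOfMeasure.

Definition leb1_def (R : realType) : integration R R :=
  integration_of_measure (@lebesgue_measure R).
Definition leb2_def (R : realType) : integration R (R * R) :=
  integration_of_measure (@lebesgue_measure R \x @lebesgue_measure R)%E.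
Definition leb1 {R : realType} : integration R R := locked (leb1_def R).
Definition leb2 {R : realType} : integration R (R * R) := locked (leb2_def R).

Section Integration.
Context {R : realType} {T : Type} (I : integration R T).
Implicit Types f g h : T -> R.

Lemma msrN f : msr I f -> msr I (fun x => - f x).
Proof.
move=> mf; have := msrM (msr_cst I (-1)) mf; congr msr.
by apply/funext => x; rewrite mulN1r.
Qed.

Lemma msrB f g : msr I f -> msr I g -> msr I (fun x => f x - g x).
Proof. by move=> mf mg; apply: msrD => //; exact: msrN. Qed.

Lemma msrX f n : msr I f -> msr I (fun x => f x ^+ n).
Proof. by move=> mf; apply: (msr_comp (phi := fun t => t ^+ n)) => //; exact: measurable_funX. Qed.

Lemma msr_norm f : msr I f -> msr I (fun x => `|f x|).
Proof. by move=> mf; apply: (msr_comp (phi := fun t => `|t|)). Qed.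

Lemma msr_expR f : msr I f -> msr I (fun x => expR (f x)).
Proof. by move=> mf; apply: msr_comp. Qed.

Lemma msr_powR f p : msr I f -> msr I (fun x => f x `^ p).
Proof. by move=> mf; apply: (msr_comp (phi := fun t => t `^ p)). Qed.

Lemma itg_eq f g : itg I f -> (forall x, f x = g x) -> itg I g.
Proof. by move=> hf /funext <-. Qed.

Lemma msr_eq f g : msr I f -> (forall x, f x = g x) -> msr I g.
Proof. by move=> hf /funext <-. Qed.

Lemma Itg_eq f g : (forall x, f x = g x) -> Itg I f = Itg I g.
Proof. by move=> /funext ->. Qed.

Lemma itgN f : itg I f -> itg I (fun x => - f x).
Proof. by move=> hf; apply: itg_eq (itgZ (-1) hf) _ => x; rewrite mulN1r. Qed.

Lemma itgB f g : itg I f -> itg I g -> itg I (fun x => f x - g x).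
Proof. by move=> hf hg; exact: itgD hf (itgN hg). Qed.

Lemma ItgN f : itg I f -> Itg I (fun x => - f x) = - Itg I f.
Proof.
move=> hf; rewrite -mulN1r -ItgZ//; apply: Itg_eq => x; by rewrite mulN1r.
Qed.

Lemma ItgB f g : itg I f -> itg I g ->
  Itg I (fun x => f x - g x) = Itg I f - Itg I g.
Proof. by move=> hf hg; rewrite (ItgD hf (itgN hg)) ItgN. Qed.

Lemma ItgD_eq f g h : itg I f -> itg I g -> (forall x, f x + g x = h x) ->
  itg I h /\ Itg I h = Itg I f + Itg I g.
Proof. by move=> hf hg /funext <-; split; [exact: itgD|exact: ItgD]. Qed.

Lemma ItgB_eq f g h : itg I f -> itg I g -> (forall x, f x - g x = h x) ->
  itg I h /\ Itg I h = Itg I f - Itg I g.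
Proof. by move=> hf hg /funext <-; split; [exact: itgB|exact: ItgB]. Qed.

Lemma ItgZ_eq c f h : itg I f -> (forall x, c * f x = h x) ->
  itg I h /\ Itg I h = c * Itg I f.
Proof. by move=> hf /funext <-; split; [exact: itgZ|exact: ItgZ]. Qed.

Lemma Itg0 : Itg I (fun=> 0) = 0.
Proof. transitivity (Itg I (fun=> 0 * 0)); first by apply: Itg_eq => x; rewrite mul0r.
by rewrite (ItgZ 0 (itg0 I)) mul0r. Qed.

Lemma Itg_ge0 f : itg I f -> (forall x, 0 <= f x) -> 0 <= Itg I f.
Proof. by move=> hf f0; rewrite -Itg0; apply: Itg_le => //; exact: itg0. Qed.

Lemma Itg_abs_le f g : itg I f -> itg I g -> (forall x, `|f x| <= g x) ->
  `|Itg I f| <= Itg I g.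
Proof.
move=> hf hg fg; rewrite ler_norml -ItgN//; apply/andP; split.
  by apply: Itg_le => // [|x]; [exact: itgN|have := fg x; rewrite ler_norml => /andP[]].
by apply: Itg_le => // x; have := fg x; rewrite ler_norml => /andP[].
Qed.

Lemma itg_sum (J : Type) (s : seq J) (F : J -> T -> R) :
  (forall i, itg I (F i)) -> itg I (fun x => \sum_(i <- s) F i x).
Proof.
move=> hF; elim: s => [|i s ih].
  by apply: itg_eq (itg0 I) _ => x; rewrite big_nil.
by apply: itg_eq (itgD (hF i) ih) _ => x; rewrite big_cons.
Qed.

Lemma Itg_sum (J : Type) (s : seq J) (F : J -> T -> R) :
  (forall i, itg I (F i)) ->
  Itg I (fun x => \sum_(i <- s) F i x) = \sum_(i <- s) Itg I (F i).
Proof.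
move=> hF; elim: s => [|i s ih].
  by rewrite big_nil -[RHS]Itg0; apply: Itg_eq => x; rewrite big_nil.
rewrite big_cons -ih -(ItgD (hF i) (itg_sum s hF)).
by apply: Itg_eq => x; rewrite big_cons.
Qed.

End Integration.

Section Lebesgue.
Context {R : realType}.
Local Notation mu := (@lebesgue_measure R).
Local Notation mu2 := (mu \x mu)%E.
Local Notation RR := (measurableTypeR R * measurableTypeR R)%type.

Lemma leb1_msrE (f : R -> R) : msr leb1 f <-> measurable_fun setT f.
Proof. by rewrite /leb1 -lock. Qed.

Lemma leb1_itgE (f : R -> R) : itg leb1 f <-> integ mu f.
Proof. by rewrite /leb1 -lock. Qed.

Lemma leb1_ItgE (f : R -> R) : Itg leb1 f = \int[mu]_x f x.
Proof. by rewrite /leb1 -lock. Qed.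

Lemma leb1_aeE (P : R -> Prop) : aev leb1 P <-> {ae mu, forall x, P x}.
Proof. by rewrite /leb1 -lock. Qed.

Lemma leb2_msrE (k : R * R -> R) : msr leb2 k <-> measurable_fun (setT : set RR) k.
Proof. by rewrite /leb2 -lock. Qed.

Lemma leb2_itgE (k : R * R -> R) : itg leb2 k <-> integ mu2 k.
Proof. by rewrite /leb2 -lock. Qed.

Lemma leb2_ItgE (k : R * R -> R) : Itg leb2 k = \int[mu2]_p k p.
Proof. by rewrite /leb2 -lock. Qed.

Lemma msr_id : msr leb1 (fun x : R => x).
Proof. by apply/leb1_msrE; exact: measurable_id. Qed.

Lemma msr_fst (f : R -> R) : msr leb1 f -> msr leb2 (fun p => f p.1).
Proof. by move=> /leb1_msrE mf; apply/leb2_msrE; exact: measurable_comp_fst. Qed.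

Lemma msr_snd (f : R -> R) : msr leb1 f -> msr leb2 (fun p => f p.2).
Proof. by move=> /leb1_msrE mf; apply/leb2_msrE; exact: measurable_comp_snd. Qed.

Lemma msr_p1 : msr leb2 (fun p : R * R => p.1).
Proof. exact: (msr_fst msr_id). Qed.

Lemma msr_p2 : msr leb2 (fun p : R * R => p.2).
Proof. exact: (msr_snd msr_id). Qed.

Lemma msr_swap (k : R * R -> R) : msr leb2 k -> msr leb2 (fun p => k (p.2, p.1)).
Proof.
move=> /leb2_msrE mk; apply/leb2_msrE.
by apply: (measurableT_comp mk); apply: measurable_fun_pair.
Qed.

Lemma Itg_prod (f g : R -> R) : itg leb1 f -> itg leb1 g ->
  itg leb2 (fun p => f p.1 * g p.2) /\
  Itg leb2 (fun p => f p.1 * g p.2) = Itg leb1 f * Itg leb1 g.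
Proof.
move=> /leb1_itgE hf /leb1_itgE hg; have [h1 h2] := integ_prod hf hg.
by split; [apply/leb2_itgE|rewrite leb2_ItgE !leb1_ItgE].
Qed.

Lemma Itg_swap (k : R * R -> R) : itg leb2 k ->
  itg leb2 (fun p => k (p.2, p.1)) /\ Itg leb2 (fun p => k (p.2, p.1)) = Itg leb2 k.
Proof.
move=> /leb2_itgE hk; have [h1 h2] := integ_swap hk.
by split; [apply/leb2_itgE|rewrite !leb2_ItgE].
Qed.

Lemma itg_bilin (k : R * R -> R) (C : R) (F G : R -> R) : msr leb2 k ->
  (forall p, `|k p| <= C * (F p.1 * G p.2)) -> itg leb1 F -> itg leb1 G ->
  itg leb2 k.
Proof.
move=> mk kFG hF hG; have [iFG _] := Itg_prod hF hG.
exact: (itg_le mk kFG (itgZ C iFG)).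
Qed.

(** The exceptional null set A becomes the strip over A, of measure oo * 0 = 0. *)
Lemma aev_snd (P : R -> Prop) : aev leb1 P -> aev leb2 (fun p => P p.2).
Proof.
move=> /leb1_aeE [A [mA A0 hA]]; rewrite /leb2 -lock /=.
exists (setT `*` A); split.
- exact: measurableX.
- have -> : mu2 (setT `*` A) = (mu setT * mu A)%E by exact: product_measure1E.
  by rewrite A0 mule0.
- by move=> p /= hp; split => //; apply: hA.
Qed.

End Lebesgue.

Ltac msr_tac := repeat (first
  [ assumption | exact: msr_id | exact: msr_p1 | exact: msr_p2 | exact: msr_cst
  | apply: msrM | apply: msrB | apply: msrD | apply: msrN | apply: msrX
  | apply: msr_norm | apply: msr_expR | apply: msr_powR ]).

(** * Profiles of unit mass and their weak form *)

Section Normalisation.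
Context {R : realType}.
Local Notation mu := (@lebesgue_measure R).
Local Notation mu2 := (mu \x mu)%E.
Local Notation RR := (measurableTypeR R * measurableTypeR R)%type.

Local Notation pos := (`]0, +oo[%classic : set R).

Definition Lk (al y z : R) := (y / z) `^ al + (z / y) `^ al.

(** Measurability is asked on the whole plane so that it combines with the extension of profiles by
    zero; the bounds concern the open quadrant only. *)
Record kernel (al eps : R) (K : R -> R -> R) : Prop := Kernel {
  k_meas : measurable_fun (setT : set RR) (fun p => K p.1 p.2);
  k_sym : forall y z, 0 < y -> 0 < z -> K y z = K z y;
  k_ge : forall y z, 0 < y -> 0 < z -> 2 - eps <= K y z;
  k_le : forall y z, 0 < y -> 0 < z -> K y z <= 2 + eps * Lk al y z }.

(* [pr_weak] is the profile equation integrated against [psi]; by Tonelli the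
   region 0 < y < x < y + z is seen from (y, z), and nothing has to be finite. *)
Record profile (K : R -> R -> R) (f : R -> R) : Prop := Profile {
  pr_meas : measurable_fun setT f;
  pr_ge0 : forall x, 0 <= f x;
  pr_supp : forall x, x <= 0 -> f x = 0;
  pr_mass_integ : integ mu (fun x => x * f x);
  pr_mass : \int[mu]_x (x * f x) = 1;
  pr_weak : forall psi : R -> R, measurable_fun setT psi ->
    (forall x, 0 <= psi x) ->
    (\int[mu]_x (x ^+ 2 * f x * psi x)%:E =
     \int[mu2]_p ((K p.1 p.2 * p.1 * f p.1 * f p.2)%:E *
                  \int[mu]_(x in `]p.1, (p.1 + p.2)%R]) (psi x)%:E))%E }.

(** Homogeneity of degree zero gives K(y, z) = K(1, z / y), so a kernel is a function of one
    variable. This makes joint measurability and scale invariance immediate. *)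
Definition pos_kernel (k : R -> R) (y z : R) :=
  if (0 < y) && (0 < z) then k (z / y) else 0.

Lemma measurable_pos_kernel (k : R -> R) :
  measurable_fun pos k ->
  measurable_fun (setT : set RR) (fun p => pos_kernel k p.1 p.2).
Proof.
move=> mk.
have mk0 : measurable_fun setT (k \_ pos).
  by apply/(measurable_restrictT k (measurable_itv `]0, +oo[)); exact: mk.
(* The quotient is rewritten with the real power of exponent -1, a measurable function on the whole
   line that agrees with the inverse for positive arguments. *)
have -> : (fun p : RR => pos_kernel k p.1 p.2) =
  (fun p => if (0 < p.1) && (0 < p.2) then (k \_ pos) (p.2 * p.1 `^ (-1)) else 0).
  apply/funext => p; rewrite /pos_kernel; case: ifP => // /andP[p1 p2].
  by rewrite powR_inv1 ?ltW// patchE mem_set//= in_itv/= andbT divr_gt0.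
apply: measurable_fun_ifT => //.
- apply: measurable_and; apply: measurable_fun_ltr => //.
- apply: measurable_comp2 => //; apply: measurable_funM.
    exact: measurable_snd_id.
  exact: (measurable_comp_fst (measurable_powR (-1))).
Qed.

Lemma pos_kernel_scale (k : R -> R) (c y z : R) : 0 < c ->
  pos_kernel k (c * y) (c * z) = pos_kernel k y z.
Proof.
move=> c0; rewrite /pos_kernel !pmulr_rgt0//.
case: ifP => // /andP[y0 z0]; congr k; rewrite invfM mulrACA mulfV ?gt_eqF//.
by rewrite mul1r.
Qed.

Lemma ge0_integral_band (psi : R -> R) (a b : R) : measurable_fun setT psi ->
  (\int[mu]_x (if (a < x) && (x < b) then psi x else 0)%:E =
   \int[mu]_(x in `]a, b]) (psi x)%:E)%E.
Proof.
move=> mpsi.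
rewrite [RHS](_ : _ = \int[mu]_(x in `]a, b[) (psi x)%:E)%E; last first.
  rewrite integral_itv_bndoo//; apply/measurable_EFinP.
  exact: measurable_funS mpsi.
rewrite [RHS]integral_mkcond; apply: eq_integral => x _.
rewrite patchE; case: ifPn => [xab|xab].
  by rewrite mem_set//= in_itv/=.
by rewrite memNset//=; rewrite in_itv/=; exact/negP.
Qed.

Lemma sigma_finite_mu2 : sigma_finite (setT : set RR) mu2.
Proof.
have /sigma_finiteP[F [TF ndF Foo]] := sigma_finiteT mu.
exists (fun n => F n `*` F n).
  rewrite -setXTT TF predeqE => -[x y]; split.
    move=> [/= [n _ Fnx] [k _ Gky]]; exists (maxn n k) => //; split.
    - by move: x Fnx; exact/subsetPset/ndF/leq_maxl.
    - by move: y Gky; exact/subsetPset/ndF/leq_maxr.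
  by move=> [n _ []/= ? ?]; split; exists n.
move=> k; have [? ?] := Foo k.
split; first exact: measurableX.
by rewrite product_measure1E// lte_mul_pinfty// ge0_fin_numE.
Qed.

(** The product measure bundled with its sigma-finiteness, as Tonelli requires for the triple
    integral over x and the pair (y, z). *)
Definition sf_mu2 : {sigma_finite_measure set RR -> \bar R} :=
  HB.pack mu2 (Measure_isSigmaFinite.Build _ _ _ mu2 sigma_finite_mu2).

Lemma tonelli_triple (T : measurableTypeR R * RR -> R) :
  measurable_fun (setT : set (measurableTypeR R * RR)) T -> (forall t, 0 <= T t) ->
  measurable_fun (setT : set (measurableTypeR R))
    (fun x => \int[mu2]_p (T (x, p))%:E)%E /\
  (\int[mu]_x \int[mu2]_p (T (x, p))%:E = \int[mu2]_p \int[mu]_x (T (x, p))%:E)%E.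
Proof.
move=> mT T0.
have mTE : measurable_fun (setT : set (measurableTypeR R * RR)) (fun t => (T t)%:E).
  exact/measurable_EFinP.
have T0E t : (0 <= (T t)%:E)%E by rewrite lee_fin.
have H := (@measurable_fun_fubini_tonelli_F _ _ (measurableTypeR R) RR R sf_mu2
    (fun t => (T t)%:E) mTE T0E).
have H2 := (@fubini_tonelli _ _ (measurableTypeR R) RR R mu sf_mu2
    (fun t => (T t)%:E) mTE T0E).
by split.
Qed.

Lemma weak_form (k f : R -> R) (psi : R -> R) :
  measurable_fun pos k ->
  (forall x, 0 < x -> 0 <= k x) ->
  measurable_fun pos f -> (forall x, 0 < x -> 0 <= f x) ->
  {ae mu, forall x, 0 < x -> ((x ^+ 2 * f x)%:E =
     \int[mu]_(y in `]0%R, x[) \int[mu]_(z in `](x - y)%R, +oo[)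
         (pos_kernel k y z * y * f y * f z)%:E)%E} ->
  measurable_fun setT psi -> (forall x, 0 <= psi x) ->
  let g := f \_ pos in
  (\int[mu]_x (x ^+ 2 * g x * psi x)%:E =
     \int[mu2]_p ((pos_kernel k p.1 p.2 * p.1 * g p.1 * g p.2)%:E *
                  \int[mu]_(x in `]p.1, (p.1 + p.2)%R]) (psi x)%:E))%E.
Proof.
move=> mk k0 mf f0 fE mpsi psi0 g.
have mg : measurable_fun setT g by apply/(measurable_restrictT f (measurable_itv `]0, +oo[)); exact: mf.
have g0 x : 0 <= g x.
  by rewrite /g patchE; case: ifPn => //; rewrite inE/= in_itv/= andbT => /f0.
have gp x : 0 < x -> g x = f x.
  by move=> x0; rewrite /g patchE mem_set//= in_itv/= andbT.
have gn x : x <= 0 -> g x = 0.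
  by move=> x0; rewrite /g patchE memNset//= in_itv/= andbT; apply/negP; rewrite -leNgt.
pose B (p : RR) := pos_kernel k p.1 p.2 * p.1 * g p.1 * g p.2.
have B0 p : 0 <= B p.
  rewrite /B; have [p1|p1] := leP p.1 0; first by rewrite (gn _ p1) mulr0 mul0r.
  rewrite !mulr_ge0 ?(ltW p1)// /pos_kernel; case: ifP => // /andP[? ?].
  by apply: k0; rewrite divr_gt0.
have mB : measurable_fun (setT : set RR) B.
  repeat apply: measurable_funM.
  - exact: measurable_pos_kernel.
  - exact: measurable_fst_id.
  - exact: measurable_comp_fst.
  - exact: measurable_comp_snd.
(* The integrand on triples (x, (y, z)). Integrating first over (y, z) gives psi(x) times the
   right-hand side of the profile equation; integrating first over x gives the band integral of
   psi. *)
pose T (t : measurableTypeR R * RR) : R :=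
  B t.2 * (if (t.2.1 < t.1) && (t.1 < t.2.1 + t.2.2) then psi t.1 else 0).
have T0 t : 0 <= T t by rewrite mulr_ge0//; case: ifP.
have m1 : measurable_fun (setT : set (measurableTypeR R * RR)) (fun t => t.1 : R).
  exact: (@measurableT_comp _ _ _ _ _ _ (fun x : measurableTypeR R => x : R)).
have m21 : measurable_fun (setT : set (measurableTypeR R * RR)) (fun t => t.2.1 : R).
  exact: (measurableT_comp measurable_fst_id measurable_snd).
have m22 : measurable_fun (setT : set (measurableTypeR R * RR)) (fun t => t.2.2 : R).
  exact: (measurableT_comp measurable_snd_id measurable_snd).
have mT : measurable_fun (setT : set (measurableTypeR R * RR)) T.
  apply: measurable_funM.
    exact: (measurableT_comp mB measurable_snd).
  apply: measurable_fun_ifT => //.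
  - apply: measurable_and; apply: measurable_fun_ltr => //.
    exact: measurable_funD.
  - exact: (measurableT_comp mpsi).
have [mF swapT] := tonelli_triple mT T0.
transitivity (\int[mu]_x \int[mu2]_p (T (x, p))%:E)%E.
  apply: ge0_ae_eq_integral => //.
  - apply/measurable_EFinP; repeat apply: measurable_funM => //.
  - by move=> x _; rewrite lee_fin mulr_ge0// mulr_ge0// sqr_ge0.
  - by move=> x _; apply: integral_ge0 => p _; rewrite lee_fin.
  apply: (@filterS _ _ (ae_filter_ringOfSetsType mu) _ _ _ fE) => x fx _.
  have [x0|x0] := leP x 0.
    rewrite gn// mulr0 mul0r; apply/esym; apply: integral0_eq => p _.
    rewrite /T /=; case: ifP; rewrite ?mulr0// => /andP[px _].
    by rewrite /B gn ?mulr0 ?mul0r//; apply: ltW; exact: lt_le_trans px x0.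
  pose U (p : RR) : R := B p * (if (p.1 < x) && (x < p.1 + p.2) then 1 else 0).
  have U0 p : 0 <= U p by rewrite mulr_ge0//; case: ifP.
  have mU : measurable_fun (setT : set RR) U.
    apply: measurable_funM => //; apply: measurable_fun_ifT => //.
    apply: measurable_and; apply: measurable_fun_ltr => //.
    by apply: measurable_funD; [exact: measurable_fst_id|exact: measurable_snd_id].
  have -> : (\int[mu2]_p (T (x, p))%:E = \int[mu2]_p ((psi x)%:E * (U p)%:E))%E.
    apply: eq_integral => p _; rewrite /T /U -EFinM/=; case: ifP => _.
      by rewrite mulr1 mulrC.
    by rewrite !mulr0.
  rewrite ge0_integralZl_EFin//; last 2 first.
  - by move=> p _; rewrite lee_fin.
  - exact/measurable_EFinP.
  rewrite gp// EFinM fx// muleC; congr (_ * _)%E.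
  rewrite (fubini_tonelli1 (fun p => (U p)%:E)); last 2 first.
  - exact/measurable_EFinP.
  - by move=> p; rewrite lee_fin.
  rewrite integral_mkcond; apply: eq_integral => y _; rewrite patchE.
  case: ifPn => [|ny].
    rewrite inE/= in_itv/= => /andP[y0 yx].
    rewrite /fubini_F [LHS]integral_mkcond; apply: eq_integral => z _; rewrite patchE.
    rewrite /U /= yx /=; case: ifPn => [|nz].
      rewrite inE/= in_itv/= andbT => xyz.
      rewrite -ltrBlDl xyz mulr1 /B /= !gp//.
      by apply: lt_trans xyz; rewrite subr_gt0.
    rewrite -ltrBlDl; case: ifP => // xyz; last by rewrite mulr0.
    by move: nz; rewrite notin_setE/= in_itv/= andbT xyz.
  apply/esym; transitivity (0%E : \bar R) => //.
  apply: integral0_eq => z _; rewrite /U /=.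
  case: ifP => [/andP[yx _]|]; last by rewrite mulr0.
  rewrite /B /= gn ?mulr0 ?mul0r// leNgt; apply/negP => y0.
  by move: ny; rewrite notin_setE/= in_itv/= y0 yx.
rewrite swapT.
apply: eq_integral => p _; rewrite -ge0_integral_band// -ge0_integralZl//.
- apply/measurable_EFinP; apply: measurable_fun_ifT => //.
  by apply: measurable_and; apply: measurable_fun_ltr.
- by move=> x _; rewrite lee_fin; case: ifP.
- exact: B0.
Qed.


(** Differentiability of K makes s -> K(1, s) continuous on (0, oo), which is where measurability
    comes from. *)
Lemma kernel_of_assumptions (al eps C0 : R) (K : R -> R -> R) :
  kernel_assumptions al eps C0 K -> let k := K 1 in
  [/\ forall y z, 0 < y -> 0 < z -> K y z = k (z / y),
      measurable_fun pos k, forall x, 0 < x -> 0 <= k x &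
      kernel al eps (pos_kernel k)].
Proof.
move=> [K0 [Ksym [Khom [Kdiff [Kge [Kle _]]]]]] k.
have KE y z : 0 < y -> 0 < z -> K y z = k (z / y).
  move=> y0 z0; rewrite /k -(Khom 1 (z / y) y)// ?divr_gt0// mulr1.
  by rewrite mulrC divfK// gt_eqF.
have mk : measurable_fun pos k.
  apply: open_continuous_measurable_fun; first exact: interval_open.
  move=> x; rewrite inE/= in_itv/= andbT => x0.
  have /differentiable_continuous dc := Kdiff 1 x ltr01 x0.
  have h : (fun s : R => ((1 : R), s)) s @[s --> x] --> ((1 : R), x).
    exact: (cvg_pair (cvg_cst _) cvg_id).
  exact: (@cvg_comp _ _ _ (fun s : R => ((1 : R), s)) (fun p : R * R => K p.1 p.2) _ _ _ h dc).
have pE y z : 0 < y -> 0 < z -> pos_kernel k y z = K y z.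
  by move=> y0 z0; rewrite /pos_kernel y0 z0/= -KE.
split => //; first by move=> x x0; exact: K0.
split.
- exact: measurable_pos_kernel.
- by move=> y z y0 z0; rewrite !pE// Ksym.
- by move=> y z y0 z0; rewrite pE//; have := Kge _ _ y0 z0; lra.
- by move=> y z y0 z0; rewrite pE//; have := Kle _ _ y0 z0; rewrite /Lk; lra.
Qed.

Lemma ge0_integral_scale_band (psi : R -> R) (c a b : R) : 0 < c ->
  measurable_fun setT psi -> (forall x, 0 <= psi x) ->
  (\int[mu]_(x in `](c * a)%R, (c * b)%R]) (psi (c^-1 * x)%R)%:E =
   c%:E * \int[mu]_(x in `]a, b]) (psi x)%:E)%E.
Proof.
move=> c0 mpsi psi0; have ci0 : 0 < c^-1 by rewrite invr_gt0.
rewrite -[in RHS]ge0_integral_band// -ge0_integral_band; last first.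
  apply: (measurableT_comp mpsi); exact: mulrl_measurable.
rewrite -[in RHS](invrK c) -(ge0_integral_scale ci0); last 2 first.
- apply/measurable_EFinP; apply: measurable_fun_ifT => //.
  by apply: measurable_and; apply: measurable_fun_ltr.
- by move=> x; rewrite lee_fin; case: ifP.
by apply: eq_integral => x _; rewrite ltr_pdivlMl// ltr_pdivrMl.
Qed.

Lemma ge0_integral_scale2 (c : R) (f : RR -> \bar R) : 0 < c ->
  measurable_fun (setT : set RR) f -> (forall p, (0 <= f p)%E) ->
  (\int[mu2]_p f (c * p.1, c * p.2)%R = (c^-1 * c^-1)%:E * \int[mu2]_p f p)%E.
Proof.
move=> c0 mf f0.
have ci0 : (0 <= c^-1)%R by rewrite invr_ge0 ltW.
have mfc : measurable_fun (setT : set RR) (fun p : RR => f (c * p.1, c * p.2)%R).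
  apply: (measurableT_comp mf); apply: measurable_fun_pair.
  - exact: (measurable_comp_fst (mulrl_measurable c)).
  - exact: (measurable_comp_snd (mulrl_measurable c)).
have mF := measurable_fun_fubini_tonelli_F (m2 := mu) f mf f0.
rewrite (fubini_tonelli1 _ mfc)// (fubini_tonelli1 _ mf)// EFinM -muleA.
rewrite -ge0_integralZl//; last by move=> x _; apply: integral_ge0.
have -> : (\int[mu]_x ((c^-1)%:E * fubini_F mu f x) =
  \int[mu]_x \int[mu]_y f (x, c * y)%R)%E.
  apply: eq_integral => x _; rewrite -(ge0_integral_scale c0)//.
  exact: (measurableT_comp mf (pair1_measurable x)).
rewrite -(ge0_integral_scale c0) //.
- pose g := fun p : RR => f (p.1, c * p.2)%R.
  have mg : measurable_fun (setT : set RR) g.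
    apply: (measurableT_comp mf); apply: measurable_fun_pair; first exact: measurable_fst.
    exact: (measurable_comp_snd (mulrl_measurable c)).
  exact: (measurable_fun_fubini_tonelli_F (m2 := mu) g mg (fun p => f0 _)).
- by move=> x; apply: integral_ge0.
Qed.

Lemma measurable_band_integral (psi : R -> R) :
  measurable_fun setT psi -> (forall x, 0 <= psi x) ->
  measurable_fun (setT : set RR)
    (fun p => \int[mu]_(x in `]p.1, (p.1 + p.2)%R]) (psi x)%:E)%E.
Proof.
move=> mpsi psi0.
pose T (t : RR * measurableTypeR R) : R :=
  if (t.1.1 < t.2) && (t.2 < t.1.1 + t.1.2) then psi t.2 else 0.
have m1 : measurable_fun (setT : set (RR * measurableTypeR R)) (fun t => t.2 : R).
  exact: (@measurableT_comp _ _ _ _ _ _ (fun x : measurableTypeR R => x : R)).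
have m21 : measurable_fun (setT : set (RR * measurableTypeR R)) (fun t => t.1.1 : R).
  exact: (measurableT_comp measurable_fst_id measurable_fst).
have m22 : measurable_fun (setT : set (RR * measurableTypeR R)) (fun t => t.1.2 : R).
  exact: (measurableT_comp measurable_snd_id measurable_fst).
have mT : measurable_fun (setT : set (RR * measurableTypeR R)) (fun t => (T t)%:E).
  apply/measurable_EFinP; apply: measurable_fun_ifT => //.
  - apply: measurable_and; apply: measurable_fun_ltr => //.
    exact: measurable_funD.
  - exact: (measurableT_comp mpsi).
have T0 t : (0 <= (T t)%:E)%E by rewrite lee_fin /T; case: ifP.
have := @measurable_fun_fubini_tonelli_F _ _ RR (measurableTypeR R) R mu _ mT T0.
congr (measurable_fun setT _); apply/funext => p.
by rewrite /fubini_F /T -ge0_integral_band.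
Qed.

(** Because K is homogeneous of degree zero, the profile equation is invariant under f(x) -> M f(M
    x), and this dilation divides the mass by M. *)
Lemma normalised_profile (k f : R -> R) (M : R) :
  measurable_fun pos k -> (forall x, 0 < x -> 0 <= k x) -> 0 < M ->
  measurable_fun pos f -> (forall x, 0 < x -> 0 <= f x) ->
  (\int[mu]_(x in pos) (x * f x)%:E = M%:E)%E ->
  {ae mu, forall x, 0 < x -> ((x ^+ 2 * f x)%:E =
     \int[mu]_(y in `]0%R, x[) \int[mu]_(z in `](x - y)%R, +oo[)
         (pos_kernel k y z * y * f y * f z)%:E)%E} ->
  profile (pos_kernel k) (fun x : R => M * (f \_ pos) (M * x)).
Proof.
move=> mk k0 M0 mf f0 fM fE.
have wf := weak_form mk k0 mf f0 fE.
set g := f \_ pos in wf *.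
have mg : measurable_fun setT g by apply/(measurable_restrictT f (measurable_itv `]0, +oo[)); exact: mf.
have g0 x : 0 <= g x.
  by rewrite /g patchE; case: ifPn => //; rewrite inE/= in_itv/= andbT => /f0.
have gn x : x <= 0 -> g x = 0.
  by move=> x0; rewrite /g patchE memNset//= in_itv/= andbT; apply/negP; rewrite -leNgt.
have xg0 x : 0 <= x * g x.
  have [x0|x0] := leP x 0; first by rewrite gn// mulr0.
  by rewrite mulr_ge0// ltW.
have mxg : measurable_fun setT (fun x : R => x * g x) by apply: measurable_funM.
have mgM : measurable_fun setT (fun x : R => M * g (M * x)).
  apply: measurable_funM => //; apply: (measurableT_comp mg); exact: mulrl_measurable.
have massE : (\int[mu]_x (x * (M * g (M * x)))%:E = 1%:E)%E.
  under eq_integral => x _ do rewrite mulrCA mulrA.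
  rewrite (ge0_integral_scale (f := fun x : R => (x * g x)%:E) M0)//; last exact/measurable_EFinP.
  have -> : (\int[mu]_x (x * g x)%:E = M%:E)%E.
    rewrite -fM [RHS]integral_mkcond; apply: eq_integral => x _.
    rewrite /g !patchE; case: ifP => // _; by rewrite mulr0.
  by rewrite -EFinM mulVf// gt_eqF.
have i1 : integ mu (fun x : R => x * (M * g (M * x))).
  apply: (proj1 (integ_ge0P (c := 1) _ _ _)).
  - by apply: measurable_funM.
  - move=> x; rewrite mulrCA; have := xg0 (M * x).
    by rewrite -mulrA pmulr_rge0// => h; rewrite pmulr_rge0.
  - by rewrite massE.
split => //.
- by move=> x; rewrite mulr_ge0// ltW.
- by move=> x x0; rewrite gn ?mulr0// pmulr_rle0.
- by apply: EFin_inj; rewrite -Ir_EFin.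
move=> psi mpsi psi0.
have Mi0 : 0 < M^-1 by rewrite invr_gt0.
(* The weak form of the original profile is applied to the test dilated the other way; both sides
   then carry the same factor M^(-2). *)
pose psi' x := psi (M^-1 * x).
have mpsi' : measurable_fun setT psi'.
  apply: (measurableT_comp mpsi); exact: mulrl_measurable.
have /= := wf psi' mpsi' (fun x => psi0 _).
set L := (\int[mu]_x _)%E; set Rt := (\int[mu2]_p _)%E => LR.
transitivity ((M^-1 * M^-1)%:E * L)%E.
  rewrite EFinM -muleA /L -(ge0_integral_scale M0); last 2 first.
  - apply/measurable_EFinP; apply: measurable_funM => //.
    by apply: measurable_funM => //; exact: measurable_funX.
  - by move=> x; rewrite lee_fin; apply: mulr_ge0; [apply: mulr_ge0; [exact: sqr_ge0|exact: g0]|exact: psi0].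
  rewrite -ge0_integralZl_EFin//; last 3 first.
  - by move=> x _; rewrite lee_fin; apply: mulr_ge0; [apply: mulr_ge0; [exact: sqr_ge0|exact: g0]|exact: psi0].
  - apply/measurable_EFinP; apply: measurable_funM => //; last first.
      apply: (measurableT_comp mpsi'); exact: mulrl_measurable.
    apply: measurable_funM => //.
      by apply: measurable_funX; exact: mulrl_measurable.
    apply: (measurableT_comp mg); exact: mulrl_measurable.
  - by rewrite ltW.
  apply: eq_integral => x _; rewrite -EFinM; congr EFin.
  rewrite /psi' mulKf ?gt_eqF//; set G := g _; set P := psi x.
  by field; rewrite gt_eqF.
pose F (p : RR) := ((pos_kernel k p.1 p.2 * p.1 * g p.1 * g p.2)%:E *
  \int[mu]_(x in `]p.1, (p.1 + p.2)%R]) (psi' x)%:E)%E.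
have mF : measurable_fun (setT : set RR) F.
  apply: emeasurable_funM; last exact: (measurable_band_integral mpsi' (fun x => psi0 _)).
  apply/measurable_EFinP; repeat apply: measurable_funM.
  + exact: measurable_pos_kernel.
  + exact: measurable_fst_id.
  + exact: (measurable_comp_fst mg).
  + exact: (measurable_comp_snd mg).
have F0 p : (0 <= F p)%E.
  apply: mule_ge0; last first.
    by apply: integral_ge0 => x _; rewrite lee_fin; exact: psi0.
  rewrite lee_fin; apply: mulr_ge0; last exact: g0.
  rewrite -mulrA; apply: mulr_ge0; last exact: xg0.
  by rewrite /pos_kernel; case: ifP => // /andP[? ?]; apply: k0; rewrite divr_gt0.
rewrite LR; have -> : Rt = (\int[mu2]_p F p)%E by [].
rewrite -(ge0_integral_scale2 M0 mF F0).
apply: eq_integral => p _; rewrite /F /= (pos_kernel_scale _ _ _ M0) -mulrDr.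
rewrite (ge0_integral_scale_band _ _ M0 mpsi psi0).
by rewrite muleA -EFinM; congr (_%:E * _)%E; ring.
Qed.

End Normalisation.

(** * The weak form against real-valued tests and its symmetrisation *)

Section WeakForm.
Context {R : realType}.
Local Notation mu := (@lebesgue_measure R).
Local Notation mu2 := (mu \x mu)%E.
Local Notation RR := (measurableTypeR R * measurableTypeR R)%type.

(** The increment Psi(y + z) - Psi(y) of a primitive of psi, written as an integral so that psi need
    only be measurable; the sign tests require this. *)
Definition incr (psi : R -> R) (y z : R) : R :=
  \int[mu]_(x in `]y, (y + z)%R]) psi x.

(** Intervals stay away from 0 because most tests are singular there. *)
Definition locint (psi : R -> R) : Prop :=
  forall a b, 0 < a -> mu.-integrable `]a, b] (EFin \o psi).

Lemma measurable_incr_ge0 (psi : R -> R) : measurable_fun setT psi ->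
  (forall x, 0 <= psi x) ->
  measurable_fun (setT : set RR) (fun p => incr psi p.1 p.2).
Proof.
move=> mpsi psi0; have := measurable_band_integral mpsi psi0.
by move=> h; exact: (measurableT_comp (@fine_measurable R _ measurableT) h).
Qed.

Lemma incr_ge0 (psi : R -> R) y z : (forall x, 0 <= psi x) -> 0 <= incr psi y z.
Proof. by move=> psi0; apply: Rintegral_ge0 => x _. Qed.

Lemma kernel_ge0 (al eps : R) (K : R -> R -> R) y z : kernel al eps K ->
  eps <= 1 -> 0 < y -> 0 < z -> 0 <= K y z.
Proof. by move=> hK e1 y0 z0; have := k_ge hK y0 z0; lra. Qed.

Variables (al eps : R) (K : R -> R -> R).
Hypotheses (hK : kernel al eps K) (e1 : eps <= 1).

Lemma weak_ereal (f psi : R -> R) : profile K f ->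
  measurable_fun setT psi -> (forall x, 0 <= psi x) -> locint psi ->
  [/\ (\int[mu]_x (x ^+ 2 * f x * psi x)%:E =
      \int[mu2]_p (K p.1 p.2 * f p.1 * f p.2 * (p.1 * incr psi p.1 p.2))%:E)%E,
   measurable_fun (setT : set RR)
      (fun p => K p.1 p.2 * f p.1 * f p.2 * (p.1 * incr psi p.1 p.2)) &
   forall p : RR, 0 <= K p.1 p.2 * f p.1 * f p.2 * (p.1 * incr psi p.1 p.2)].
Proof.
move=> hf mpsi psi0 lpsi; split.
- rewrite (pr_weak hf)//; apply: eq_integral => p _.
  have [p1|p1] := leP p.1 0; first by rewrite (pr_supp hf p1) !(mulr0, mul0r) mul0e.
  rewrite /incr /Rintegral -[in LHS](@fineK _ (\int[mu]_(x in _) _)%E); last first.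
    by apply: integrable_fin_num => //; exact: lpsi.
  by rewrite -EFinM; congr EFin; ring.
- apply: measurable_funM; last first.
    by apply: measurable_funM; [exact: measurable_fst_id|exact: measurable_incr_ge0].
  apply: measurable_funM; last exact: (measurable_comp_snd (pr_meas hf)).
  apply: measurable_funM; first exact: k_meas hK.
  exact: (measurable_comp_fst (pr_meas hf)).
- move=> p; have [p1|p1] := leP p.1 0; first by rewrite (pr_supp hf p1) !(mulr0, mul0r).
  have [p2|p2] := leP p.2 0; first by rewrite (pr_supp hf p2) !(mulr0, mul0r).
  apply: mulr_ge0; last by rewrite mulr_ge0 ?incr_ge0// ltW.
  apply: mulr_ge0; last exact: pr_ge0 hf _.
  by apply: mulr_ge0; [exact: kernel_ge0 hK e1 p1 p2|exact: pr_ge0 hf _].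
Qed.

Lemma msr_flux (f g : R -> R) (k : R * R -> R) :
  msr leb1 f -> msr leb1 g -> msr leb2 k ->
  msr leb2 (fun p => K p.1 p.2 * f p.1 * g p.2 * k p).
Proof.
move=> mf mg mk; apply: msrM => //; apply: msrM; last exact: msr_snd.
by apply: msrM; [apply/leb2_msrE; exact: k_meas hK|exact: msr_fst].
Qed.

Definition flux (f g : R -> R) (p : R * R) : R := K p.1 p.2 * f p.1 * g p.2.

Lemma profile_msr (f : R -> R) : profile K f -> msr leb1 f.
Proof. by move=> hf; apply/leb1_msrE; exact: pr_meas hf. Qed.

(** Tonelli gives equality in [0, oo], so finiteness passes in both directions. The direction from
    the double integral to the moment is what creates new moments in [moment_step]. *)
Lemma weak_ge0 (f psi : R -> R) : profile K f ->
  msr leb1 psi -> (forall x, 0 <= psi x) -> locint psi ->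
  (itg leb1 (fun x => x ^+ 2 * f x * psi x) <->
   itg leb2 (fun p => flux f f p * (p.1 * incr psi p.1 p.2))) /\
  (itg leb1 (fun x => x ^+ 2 * f x * psi x) ->
  Itg leb1 (fun x => x ^+ 2 * f x * psi x) =
  Itg leb2 (fun p => flux f f p * (p.1 * incr psi p.1 p.2))).
Proof.
move=> hf /leb1_msrE mpsi psi0 lpsi.
have [hE mE h0] := weak_ereal hf mpsi psi0 lpsi.
have mL : measurable_fun setT (fun x : R => x ^+ 2 * f x * psi x).
  apply: measurable_funM => //; apply: measurable_funM; last exact: pr_meas hf.
  exact: measurable_funX.
have L0 (x : R) : 0 <= x ^+ 2 * f x * psi x.
  by apply: mulr_ge0; [apply: mulr_ge0; [exact: sqr_ge0|exact: pr_ge0 hf _]|exact: psi0].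
split; last first.
  move=> i1; have i2 : itg leb2 (fun p => flux f f p * (p.1 * incr psi p.1 p.2)).
    move/leb1_itgE : (i1) => i1'; apply/leb2_itgE.
    by apply: (proj1 (integ_ge0P mE h0 (c := \int[mu]_x (x ^+ 2 * f x * psi x)) _)); rewrite -hE Ir_EFin.
  move/leb1_itgE : i1 => i1; move/leb2_itgE : i2 => i2.
  by rewrite leb1_ItgE leb2_ItgE /Rintegral hE.
split.
  move/leb1_itgE => i1; apply/leb2_itgE.
  by apply: (proj1 (integ_ge0P mE h0 (c := \int[mu]_x (x ^+ 2 * f x * psi x)) _)); rewrite -hE Ir_EFin.
move/leb2_itgE => i2; apply/leb1_itgE.
have h : (\int[mu]_x (x ^+ 2 * f x * psi x)%:E <= (\int[mu2]_p
    (K p.1 p.2 * f p.1 * f p.2 * (p.1 * incr psi p.1 p.2)))%:E)%E.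
  by rewrite hE Ir_EFin.
by have [] := @integ_ge0P _ _ R mu _ _ mL L0 h.
Qed.

Lemma flux0 (f g : R -> R) p : (forall x, x <= 0 -> f x = 0) ->
  (forall x, x <= 0 -> g x = 0) -> (p.1 <= 0) || (p.2 <= 0) -> flux f g p = 0.
Proof.
by move=> f0 g0 /orP[h|h]; rewrite /flux ?(f0 _ h) ?(g0 _ h) !(mulr0, mul0r).
Qed.

Lemma flux_ge0 (f g : R -> R) p : (forall x, x <= 0 -> f x = 0) ->
  (forall x, x <= 0 -> g x = 0) -> (forall x, 0 <= f x) -> (forall x, 0 <= g x) ->
  0 <= flux f g p.
Proof.
move=> f0 g0 f1 g1; have [p1|p1] := leP p.1 0; first by rewrite (flux0 f0 g0)// p1.
have [p2|p2] := leP p.2 0; first by rewrite (flux0 f0 g0)// p2 orbT.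
by rewrite /flux !mulr_ge0// (kernel_ge0 hK e1 p1 p2).
Qed.

Lemma incrB (u v : R -> R) y z : 0 < y -> locint u -> locint v ->
  incr (fun x => u x - v x) y z = incr u y z - incr v y z.
Proof. by move=> y0 lu lv; apply: RintegralB => //; [exact: lu|exact: lv]. Qed.

Let pos_part (psi : R -> R) (x : R) : R := Num.max (psi x) 0.
Let neg_part (psi : R -> R) (x : R) : R := Num.max (- psi x) 0.

Lemma locint_le (u psi : R -> R) : measurable_fun setT u ->
  (forall x, 0 < x -> `|u x| <= `|psi x|) -> locint psi -> locint u.
Proof.
move=> mu_ upsi lpsi a b a0; apply: le_integrable (lpsi a b a0) => //.
  by apply/measurable_EFinP; exact: measurable_funS mu_.
move=> x; rewrite /= in_itv/= => /andP[ax _]; rewrite lee_fin; apply: upsi.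
exact: lt_trans ax.
Qed.

(** The nonnegative case is applied to the positive and the negative part of psi, both dominated by
    |psi|. *)
Lemma weak_signed (f psi : R -> R) : profile K f ->
  msr leb1 psi -> locint psi -> itg leb1 (fun x => x ^+ 2 * f x * psi x) ->
  itg leb2 (fun p => flux f f p * (p.1 * incr psi p.1 p.2)) /\
  Itg leb1 (fun x => x ^+ 2 * f x * psi x) =
  Itg leb2 (fun p => flux f f p * (p.1 * incr psi p.1 p.2)).
Proof.
move=> hf mpsi lpsi ipsi.
have mx2f : msr leb1 (fun x : R => x ^+ 2 * f x).
  by have mf := profile_msr hf; msr_tac.
have mmax : measurable_fun setT (fun t : R => Num.max t 0) by apply: measurable_maxr.
have mp : msr leb1 (pos_part psi) by apply: (msr_comp mmax mpsi).
have mn : msr leb1 (neg_part psi) by apply: (msr_comp mmax (msrN mpsi)).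
have pE x : psi x = pos_part psi x - neg_part psi x.
  by rewrite /pos_part /neg_part; case: (leP (psi x) 0); case: (leP (- psi x) 0); lra.
have p0 x : 0 <= pos_part psi x by rewrite /pos_part le_max lexx orbT.
have n0 x : 0 <= neg_part psi x by rewrite /neg_part le_max lexx orbT.
have pa x : `|pos_part psi x| <= `|psi x|.
  by rewrite ger0_norm// /pos_part ge_max ler_norm normr_ge0.
have na x : `|neg_part psi x| <= `|psi x|.
  by rewrite ger0_norm// /neg_part ge_max -normrN ler_norm normr_ge0.
have lp : locint (pos_part psi) by apply: locint_le lpsi => //; exact/leb1_msrE.
have ln : locint (neg_part psi) by apply: locint_le lpsi => //; exact/leb1_msrE.
have ip : itg leb1 (fun x => x ^+ 2 * f x * pos_part psi x).
  apply: itg_le (itg_abs ipsi); first exact: msrM.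
  by move=> x; rewrite [leLHS]normrM [leRHS]normrM ler_wpM2l.
have i_n : itg leb1 (fun x => x ^+ 2 * f x * neg_part psi x).
  apply: itg_le (itg_abs ipsi); first exact: msrM.
  by move=> x; rewrite [leLHS]normrM [leRHS]normrM ler_wpM2l.
have [/(proj1) /(_ ip) i2p /(_ ip) Ep] := weak_ge0 hf mp p0 lp.
have [/(proj1) /(_ i_n) i2n /(_ i_n) En] := weak_ge0 hf mn n0 ln.
have eqp p : flux f f p * (p.1 * incr (pos_part psi) p.1 p.2) -
   flux f f p * (p.1 * incr (neg_part psi) p.1 p.2) =
   flux f f p * (p.1 * incr psi p.1 p.2).
  have [p1|p1] := leP p.1 0.
    by rewrite (flux0 (pr_supp hf) (pr_supp hf)) ?p1// !mul0r subrr.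
  rewrite -mulrBr -mulrBr -incrB//; congr (_ * (_ * _)).
  by congr incr; apply/funext => x; rewrite -pE.
have [iE EE] := ItgB_eq i2p i2n eqp; split => //.
rewrite EE -Ep -En; apply: (proj2 (ItgB_eq ip i_n _)) => x.
by rewrite -mulrBr -pE.
Qed.

(** Since K is symmetric, only the part of y (Psi(y + z) - Psi(y)) symmetric in (y, z) contributes;
    this is twice that part. *)
Definition sincr (psi : R -> R) (p : R * R) : R :=
  p.1 * incr psi p.1 p.2 + p.2 * incr psi p.2 p.1.

Lemma weak_sym (f psi : R -> R) : profile K f ->
  msr leb1 psi -> locint psi -> itg leb1 (fun x => x ^+ 2 * f x * psi x) ->
  itg leb2 (fun p => flux f f p * sincr psi p) /\
  2 * Itg leb1 (fun x => x ^+ 2 * f x * psi x) =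
  Itg leb2 (fun p => flux f f p * sincr psi p).
Proof.
move=> hf mpsi lpsi ipsi; have [i2 E] := weak_signed hf mpsi lpsi ipsi.
have [i2' E'] := Itg_swap i2.
have eqp p : flux f f p * (p.1 * incr psi p.1 p.2) +
   flux f f (p.2, p.1) * (p.2 * incr psi p.2 p.1) = flux f f p * sincr psi p.
  have f0 := flux0 (pr_supp hf) (pr_supp hf).
  have [p1|p1] := leP p.1 0; first by rewrite !f0 ?p1 ?orbT// !mul0r addr0.
  have [p2|p2] := leP p.2 0; first by rewrite !f0 ?p2 ?orbT// !mul0r addr0.
  by rewrite /flux /= (k_sym hK p2 p1) /sincr; ring.
have [iE EE] := ItgD_eq i2 i2' eqp; split => //.
by rewrite EE E' E mulr_natl mulr2n.
Qed.

Let half_double (u v s : R) : 2 * u - 2 * v = s + s -> u - v = s.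
Proof. by lra. Qed.

(** Polarisation: f1(y) f1(z) - f2(y) f2(z) = fb(y) h(z) + h(y) fb(z). By the symmetry of K and
    [sincr] the two summands have equal integrals, so one suffices, and h then lives in the variable
    z only. *)
Lemma weak_diff (f1 f2 psi : R -> R) : profile K f1 -> profile K f2 ->
  msr leb1 psi -> locint psi ->
  itg leb1 (fun x => x ^+ 2 * f1 x * psi x) ->
  itg leb1 (fun x => x ^+ 2 * f2 x * psi x) ->
  let fb x := (f1 x + f2 x) / 2 in let h x := f1 x - f2 x in
  itg leb2 (fun p => flux fb h p * sincr psi p) ->
  Itg leb1 (fun x => x ^+ 2 * h x * psi x) =
  Itg leb2 (fun p => flux fb h p * sincr psi p).
Proof.
move=> hf1 hf2 mpsi lpsi ip1 ip2 fb h i2.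
have [j1 E1] := weak_sym hf1 mpsi lpsi ip1.
have [j2 E2] := weak_sym hf2 mpsi lpsi ip2.
have [i2' E'] := Itg_swap i2.
have [_ E0] := ItgB_eq ip1 ip2 (fun=> erefl).
have -> : Itg leb1 (fun x => x ^+ 2 * h x * psi x) =
  Itg leb1 (fun x => x ^+ 2 * f1 x * psi x) - Itg leb1 (fun x => x ^+ 2 * f2 x * psi x).
  by rewrite -E0; apply: Itg_eq => x; rewrite /h; ring.
have [_ E3] := ItgD_eq i2 i2' (fun=> erefl).
have [_ E4] := ItgB_eq j1 j2 (fun=> erefl).
have E5 : Itg leb2 (fun p => flux f1 f1 p * sincr psi p - flux f2 f2 p * sincr psi p) =
  Itg leb2 (fun p => flux fb h p * sincr psi p +
    flux fb h (p.2, p.1) * sincr psi (p.2, p.1)).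
  apply: Itg_eq => p.
  have z1 := flux0 (pr_supp hf1) (pr_supp hf1).
  have z2 := flux0 (pr_supp hf2) (pr_supp hf2).
  have z3 q : (q.1 <= 0) || (q.2 <= 0) -> flux fb h q = 0.
    apply: flux0 => x x0; rewrite /fb /h ?(pr_supp hf1 x0) ?(pr_supp hf2 x0);
    by rewrite ?addr0 ?subrr ?mul0r.
  have [p1|p1] := leP p.1 0.
    by rewrite z1 ?p1// z2 ?p1// z3 ?p1// z3/= ?p1 ?orbT// !mul0r subrr addr0.
  have [p2|p2] := leP p.2 0.
    by rewrite z1 ?p2 ?orbT// z2 ?p2 ?orbT// z3 ?p2 ?orbT// z3/= ?p2// !mul0r subrr addr0.
  by rewrite /flux /= (k_sym hK p2 p1) /sincr /fb /h /=; field.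
by move: E5; rewrite E3 E4 E' -E1 -E2; exact: half_double.
Qed.

Lemma locint_continuous (psi : R -> R) : (forall x : R, 0 < x -> {for x, continuous psi}) ->
  locint psi.
Proof.
move=> cpsi a b a0; have [ab|ba] := leP a b; last first.
  rewrite set_itv_ge ?bnd_simp -?leNgt ?ltW//; exact: integrable_set0.
apply: (@integrableS _ _ _ mu `[a, b]) => //; first exact: subset_itv_oc_cc.
apply: continuous_compact_integrable; first exact: segment_compact.
apply: continuous_in_subspaceT => x; rewrite inE/= in_itv/= => /andP[ax _].
by apply: cpsi; exact: lt_le_trans ax.
Qed.

Lemma incr_primitive (psi Psi : R -> R) y z :
  (forall x : R, 0 < x -> {for x, continuous psi}) ->
  (forall x : R, 0 < x -> is_derive x 1 Psi (psi x)) -> 0 < y -> 0 < z ->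
  incr psi y z = Psi (y + z) - Psi y.
Proof.
move=> cpsi dPsi y0 z0; rewrite /incr /Rintegral.
have yz : y < y + z by rewrite ltrDl.
have cont x : 0 < x -> {for x, continuous Psi}.
  move=> x0; apply: differentiable_continuous; apply/derivable1_diffP.
  by have := dPsi x x0 => -[].
rewrite integral_itv_obnd_cbnd/=; last first.
  apply/measurable_EFinP.
  apply: (@measurable_funS _ _ _ _ (`]0, +oo[%classic : set R)) => //.
    by move=> x /=; rewrite !in_itv/= andbT => /andP[yx _]; exact: lt_trans yx.
  apply: open_continuous_measurable_fun; first exact: interval_open.
  by move=> x; rewrite inE/= in_itv/= andbT => x0; exact: cpsi.
rewrite (@continuous_FTC2 _ psi Psi)//.
- apply: continuous_in_subspaceT => x; rewrite inE/= in_itv/= => /andP[yx _].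
  by apply: cpsi; exact: lt_le_trans yx.
- split.
  + by move=> x; rewrite in_itv/= => /andP[yx _]; have := dPsi x (lt_trans y0 yx) => -[].
  + by apply: cvg_at_right_filter; apply: cont.
  + by apply: cvg_at_left_filter; apply: cont; exact: addr_gt0.
- move=> x; rewrite in_itv/= => /andP[yx _].
  by have := dPsi x (lt_trans y0 yx) => dP; rewrite derive1E; exact: derive_val.
Qed.

End WeakForm.

(** * Powers and moments *)

Section Powers.
Context {R : realType}.
Implicit Types x y z s t al : R.

Lemma powRDp x s t : 0 < x -> x `^ (s + t) = x `^ s * x `^ t.
Proof. by move=> x0; rewrite powRD//; apply/implyP => _; rewrite gt_eqF. Qed.

Lemma powR_div y z al : 0 < y -> 0 < z -> (y / z) `^ al = y `^ al * z `^ (- al).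
Proof.
move=> y0 z0; rewrite powRM ?invr_ge0 ?ltW//; congr (_ * _).
have zi : 0 < z^-1 by rewrite invr_gt0.
apply: (mulfI (x := z `^ al)); first by rewrite gt_eqF// powR_gt0.
by rewrite -powRM ?ltW// mulfV ?gt_eqF// powR1 -powRDp// subrr powRr0.
Qed.

Lemma LkE al y z : 0 < y -> 0 < z ->
  Lk al y z = y `^ al * z `^ (- al) + y `^ (- al) * z `^ al.
Proof. by move=> y0 z0; rewrite /Lk !powR_div// [z `^ al * _]mulrC. Qed.

Lemma LkC al y z : Lk al y z = Lk al z y.
Proof. by rewrite /Lk addrC. Qed.

(** This is t + 1/t >= 2; it allows the constant part of a kernel bound to be absorbed into [Lk]. *)
Lemma Lk_ge2 al y z : 0 < y -> 0 < z -> 2 <= Lk al y z.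
Proof.
move=> y0 z0; rewrite /Lk; set t := (y / z) `^ al.
have t0 : 0 < t by rewrite powR_gt0// divr_gt0.
have -> : (z / y) `^ al = t^-1.
  rewrite /t !powR_div// invfM -!powRN opprK mulrC; congr (_ * _).
rewrite -subr_ge0 -(pmulr_rge0 _ t0) mulrBr mulrDr mulfV ?gt_eqF//.
by have := sqr_ge0 (t - 1); rewrite expr2; lra.
Qed.

Lemma powR_le_add x s t u : 0 < x -> t <= s -> s <= u -> x `^ s <= x `^ t + x `^ u.
Proof.
move=> x0 ts su; have [x1|x1] := leP x 1.
  have : x `^ s <= x `^ t by apply: ger_powR => //; rewrite x0 x1.
  by have := powR_ge0 x u; lra.
have : x `^ s <= x `^ u by apply: ler_powR => //; exact: ltW.
by have := powR_ge0 x t; lra.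
Qed.

Lemma powR_mono x y s : 0 < x -> x <= y -> 0 <= s -> x `^ s <= y `^ s.
Proof.
move=> x0 xy s0; apply: ge0_ler_powR => //; rewrite nnegrE ltW//.
exact: lt_le_trans xy.
Qed.

Lemma powR_anti x y s : 0 < x -> x <= y -> s <= 0 -> y `^ s <= x `^ s.
Proof.
move=> x0 xy s0; rewrite -(opprK s) !(powRN _ (- s)) lef_pV2 ?posrE ?powR_gt0//.
  by apply: powR_mono => //; rewrite oppr_ge0.
exact: lt_le_trans xy.
Qed.

Lemma is_derive_powR_shift (a r x : R) : 0 <= r -> 0 < x ->
  is_derive x 1 (fun t => (t + r) `^ a) (a * (x + r) `^ (a - 1)).
Proof.
move=> r0 x0; have xr : 0 < x + r by rewrite ltr_pwDl.
have h1 : is_derive x (1 : R) (fun t : R => t + r) 1.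
  by apply: is_derive_eq; rewrite addr0.
have h2 : is_derive (x + r) 1 (fun t => t `^ a) (a * (x + r) `^ (a - 1)).
  exact: is_derive1_powR.
have h3 := @is_derive1_comp _ (fun t => t `^ a) (fun t : R => t + r) x _ _ h2 h1.
by apply: is_derive_eq; rewrite mulr1.
Qed.

Lemma continuous_powR_shift (a r x : R) : 0 <= r -> 0 < x ->
  {for x, continuous (fun t => (t + r) `^ a)}.
Proof.
move=> r0 x0; apply: differentiable_continuous; apply/derivable1_diffP.
by have [] := is_derive_powR_shift a r0 x0.
Qed.

End Powers.

Section Increments.
Context {R : realType}.
Local Notation mu := (@lebesgue_measure R).

Lemma locint_powR_shift (a r : R) : 0 <= r -> locint (fun x => (x + r) `^ a).
Proof. by move=> r0; apply: locint_continuous => x x0; exact: continuous_powR_shift. Qed.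

Lemma incr_powR_shift (a r y z : R) : 0 <= r -> a != 0 -> 0 < y -> 0 < z ->
  incr (fun x => (x + r) `^ (a - 1)) y z = ((y + z + r) `^ a - (y + r) `^ a) / a.
Proof.
move=> r0 a0 y0 z0.
have H1 (x : R) : 0 < x -> {for x, continuous (fun x => (x + r) `^ (a - 1))}.
  by move=> x0; exact: continuous_powR_shift.
have H2 (x : R) : 0 < x ->
    is_derive x 1 (fun x => a^-1 * (x + r) `^ a) ((x + r) `^ (a - 1)).
  move=> x0; have h := is_derive_powR_shift a r0 x0.
  by apply: is_derive_eq; rewrite /GRing.scale/= mulrA mulVf// mul1r.
by rewrite (incr_primitive H1 H2 y0 z0); field.
Qed.

Lemma incr_le_sup (psi : R -> R) (M y z : R) : 0 < y -> 0 < z -> locint psi ->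
  (forall x, y < x -> x <= y + z -> psi x <= M) -> incr psi y z <= M * z.
Proof.
move=> y0 z0 lpsi hM; rewrite /incr.
have mE : mu `]y, (y + z)%R] = z%:E.
  rewrite lebesgue_measure_itv/= lte_fin ltrDl z0 -EFinD; congr EFin.
  by rewrite addrAC subrr add0r.
have -> : M * z = \int[mu]_(x in `]y, (y + z)%R]) M.
  rewrite Rintegral_cst//= lebesgue_measure_itv/= lte_fin ltrDl z0 -EFinD/=.
  by congr (_ * _); rewrite addrAC subrr add0r.
apply: le_Rintegral => //; first exact: lpsi.
  have lc : locint (fun=> M) by apply: locint_continuous => x _; exact: cvg_cst.
  exact: lc.
by move=> x; rewrite /= in_itv/= => /andP[? ?]; exact: hM.
Qed.

End Increments.

(** * Number of particles and positive moments, bounded uniformly in the profile *)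

Section Moments.
Context {R : realType}.
Variables (al : R).
Hypotheses (al0 : 0 <= al) (al1 : al < 1).
Implicit Types (eps : R) (K : R -> R -> R) (f : R -> R).

Lemma profile_mass K f : profile K f ->
  itg leb1 (fun x => x * f x) /\ Itg leb1 (fun x => x * f x) = 1.
Proof.
move=> hf; split; first by apply/leb1_itgE; exact: pr_mass_integ hf.
by rewrite leb1_ItgE; exact: pr_mass hf.
Qed.

Lemma itg_mass_le K f (u : R -> R) (c : R) : profile K f -> msr leb1 u ->
  (forall x, 0 < x -> `|u x| <= c * x) -> itg leb1 (fun x => u x * f x).
Proof.
move=> hf mu_ hu; have [i1 _] := profile_mass hf.
apply: itg_le (itgZ c i1); first by apply: msrM => //; exact: profile_msr hf.
move=> x; have [x0|x0] := leP x 0; first by rewrite (pr_supp hf x0) !mulr0 normr0.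
by rewrite normrM mulrA (ger0_norm (pr_ge0 hf x)) ler_wpM2r ?(pr_ge0 hf)// hu.
Qed.

Lemma msr_powR_shift (a r : R) : msr leb1 (fun x : R => (x + r) `^ a).
Proof. by apply: msr_powR; apply: msrD; [exact: msr_id|exact: msr_cst]. Qed.

Lemma cvg_harmonic_shift (x : R) : 0 < x -> (fun n => x / (x + n.+1%:R^-1)) @ \oo --> (1 : R).
Proof.
move=> x0; rewrite -[X in _ --> X](@divff _ x) ?gt_eqF//.
apply: cvgM; first exact: cvg_cst.
apply: cvgV; first by rewrite gt_eqF.
rewrite -[X in _ --> X]addr0; apply: cvgD; first exact: cvg_cst.
exact: cvg_harmonic.
Qed.

(** Formally psi = x^(-2), with primitive -1/x: the symmetrised increment is then 1, so 2 N equals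
    the double integral of K f f and is at least (2 - eps) N^2, whence N <= 2. Shifting x by r makes
    every integral finite from the mass alone, and Fatou removes the shift. *)
Lemma profile_number eps K f : kernel al eps K -> eps <= 1 -> profile K f ->
  itg leb1 f /\ Itg leb1 f <= 2.
Proof.
move=> hK e1 hf; have mf := profile_msr hf.
pose th r x : R := x * (x + r) `^ (-1).
have thE r x : 0 < r -> 0 < x -> th r x = x / (x + r).
  by move=> r0 x0; rewrite /th powR_inv1//; apply: ltW; exact: addr_gt0.
have mth r : msr leb1 (th r) by apply: msrM; [exact: msr_id|exact: msr_powR_shift].
have ith r : 0 < r -> itg leb1 (fun x => th r x * f x).
  move=> r0; apply: (itg_mass_le (c := r^-1) hf) => // x x0.
  have xr : 0 < x + r by exact: addr_gt0.
  rewrite thE// ger0_norm; last by apply: divr_ge0; exact: ltW.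
  by rewrite mulrC ler_wpM2r ?(ltW x0)// lef_pV2 ?posrE// lerDr ltW.
have bound r : 0 < r -> Itg leb1 (fun x => th r x * f x) <= 2.
  move=> r0; set B := Itg _ _.
  pose psi x : R := (x + r) `^ (-1 - 1).
  have lpsi : locint psi by apply: locint_powR_shift; exact: ltW.
  have psiE x : 0 < x -> x ^+ 2 * psi x = th r x ^+ 2.
    move=> x0; rewrite /psi powRDp ?addr_gt0//; rewrite /th; ring.
  have thb x : 0 < x -> 0 <= th r x <= 1.
    move=> x0; have xr : 0 < x + r by exact: addr_gt0.
    rewrite thE// ler_pdivrMr// mul1r lerDl (ltW r0) andbT.
    by apply: divr_ge0; exact: ltW.
  have mpsi : msr leb1 psi by exact: msr_powR_shift.
  have i1 : itg leb1 (fun x => x ^+ 2 * f x * psi x).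
    have mm : msr leb1 (fun x : R => x ^+ 2 * f x * psi x).
      by apply: msrM => //; apply: msrM => //; apply: msrX; exact: msr_id.
    apply: itg_le mm _ (ith r r0) => x.
    have [x0|x0] := leP x 0; first by rewrite (pr_supp hf x0) !(mulr0, mul0r) normr0.
    rewrite mulrAC psiE// normrM (ger0_norm (pr_ge0 hf x)) ler_wpM2r ?(pr_ge0 hf)//.
    have := thb x x0 => /andP[t0 t1]; rewrite ger0_norm ?sqr_ge0// expr2.
    by rewrite ler_piMl.
  have [i2 E2] := weak_sym hK e1 hf mpsi lpsi i1.
  have AB : Itg leb1 (fun x => x ^+ 2 * f x * psi x) <= B.
    apply: Itg_le => // [|x]; first exact: ith.
    have [x0|x0] := leP x 0; first by rewrite (pr_supp hf x0) !(mulr0, mul0r).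
    rewrite mulrAC psiE// ler_wpM2r ?(pr_ge0 hf)//.
    by have := thb x x0 => /andP[t0 t1]; rewrite expr2 ler_piMl.
  have [i3 E3] := Itg_prod (ith r r0) (ith r r0).
  have [i4 E4] := ItgZ_eq (c := 2 - eps) i3 (fun=> erefl).
  have le2 : (2 - eps) * (B * B) <= Itg leb2 (fun p => flux K f f p * sincr psi p).
    rewrite /B -E3 -E4; apply: Itg_le => // p.
    have [p1|p1] := leP p.1 0.
      by rewrite (flux0 _ (pr_supp hf) (pr_supp hf)) ?p1// (pr_supp hf p1) !(mulr0, mul0r).
    have [p2|p2] := leP p.2 0.
      by rewrite (flux0 _ (pr_supp hf) (pr_supp hf)) ?p2 ?orbT// (pr_supp hf p2) !(mulr0, mul0r).
    rewrite /sincr !(incr_powR_shift (ltW r0))// ?oppr_eq0 ?oner_eq0//.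
    have [yr zr] : 0 <= p.1 + r /\ 0 <= p.2 + r by split; lra.
    have yzr : 0 <= p.1 + p.2 + r by lra.
    have zyr : 0 <= p.2 + p.1 + r by lra.
    rewrite !powR_inv1//.
    have fy := pr_ge0 hf p.1; have fz := pr_ge0 hf p.2.
    have kge := k_ge hK p1 p2.
    set y := p.1 in p1 fy kge *; set z := p.2 in p2 fz kge *.
    rewrite !thE// /flux -/y -/z.
    set S := y * _ + z * _.
    (* The shifted increment still dominates the product th(y) th(z): their difference is an
       explicit nonnegative fraction. *)
    have S0 : y / (y + r) * (z / (z + r)) <= S.
      rewrite /S [z + y]addrC -subr_ge0.
      have -> : y * (((y + z + r)^-1 - (y + r)^-1) / -1) +
        z * (((y + z + r)^-1 - (z + r)^-1) / -1) - y / (y + r) * (z / (z + r))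
        = (y * z * r) / ((y + r) * (z + r) * (y + z + r)).
        by field; rewrite !gt_eqF// ?addr_gt0// ?addr_gt0.
      by apply: divr_ge0; apply: ltW; rewrite !mulr_gt0// !addr_gt0.
    have T0 : 0 <= y / (y + r) * (z / (z + r)).
      by apply: ltW; rewrite mulr_gt0// divr_gt0// addr_gt0.
    have -> : (2 - eps) * (y / (y + r) * f y * (z / (z + r) * f z)) =
      (2 - eps) * (y / (y + r) * (z / (z + r))) * (f y * f z) by ring.
    have -> : K y z * f y * f z * S = K y z * S * (f y * f z) by ring.
    rewrite ler_wpM2r ?mulr_ge0//; apply: ler_pM => //; lra.
  have B0 : 0 <= B.
    apply: Itg_ge0; first exact: ith.
    move=> x; have [x0|x0] := leP x 0; first by rewrite (pr_supp hf x0) !(mulr0, mul0r).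
    by rewrite mulr_ge0 ?(pr_ge0 hf)//; have /andP[] := thb x x0.
  by move: le2; rewrite -E2; nra.
apply: (@itg_fatou _ _ leb1 (fun n x => th n.+1%:R^-1 x * f x)) => //.
- by move=> n; apply: ith; rewrite invr_gt0.
- move=> n x; have [x0|x0] := leP x 0; first by rewrite (pr_supp hf x0) mulr0.
  rewrite thE//; apply: mulr_ge0; last exact: pr_ge0 hf _.
  by apply: divr_ge0; [exact: ltW|apply: addr_ge0 => //; exact: ltW].
- by move=> n; apply: bound; rewrite invr_gt0.
- move=> x; have [x0|x0] := leP x 0.
    rewrite (pr_supp hf x0); under eq_fun do rewrite mulr0; exact: cvg_cst.
  rewrite -[X in _ --> X]mul1r; apply: cvgM; last exact: cvg_cst.
  under eq_fun do rewrite thE//; exact: cvg_harmonic_shift.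
Qed.

Lemma kernel_le2L eps K y z : kernel al eps K -> eps <= 1 -> 0 < y -> 0 < z ->
  K y z <= 2 * Lk al y z.
Proof.
move=> hK e1 y0 z0; have := k_le hK y0 z0; have := Lk_ge2 al y0 z0; nra.
Qed.

Lemma Lk_le y z : 0 < z -> z <= y -> Lk al y z <= 2 * (y `^ al * z `^ (- al)).
Proof.
move=> z0 zy; have y0 := lt_le_trans z0 zy; rewrite LkE//.
suff : y `^ (- al) * z `^ al <= y `^ al * z `^ (- al) by lra.
rewrite mulrC; apply: ler_pM; rewrite ?powR_ge0//; first exact: powR_mono.
by apply: powR_anti => //; rewrite oppr_le0.
Qed.

(** The first two terms bound x^(p-1) on [y, 2y] relative to y^(p-1), for p <= 1 and for p > 1; the
    last one handles z > y. Their sum serves all cases. *)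
Definition moment_cst (p : R) := 2 + 2 `^ (p - 1) + 2 `^ p / p.

Lemma incr_powR_le p y z : 0 < p -> 0 < y -> 0 < z ->
  y * incr (fun x => (x + 0) `^ (p - 1)) y z <=
  moment_cst p * (if z <= y then y `^ p * z else y * z `^ p).
Proof.
move=> p0 y0 z0; have c1 := powR_ge0 (2 : R) (p - 1).
have c2 : 0 <= 2 `^ p / p by rewrite divr_ge0 ?powR_ge0 ?ltW.
case: (leP z y) => [zy|yz].
  have h : incr (fun x => (x + 0) `^ (p - 1)) y z <= ((2 + 2 `^ (p - 1)) * y `^ (p - 1)) * z.
    apply: incr_le_sup => //; first exact: locint_powR_shift.
    move=> x yx xyz; rewrite addr0; have x0 := lt_trans y0 yx.
    have yp := powR_ge0 y (p - 1).
    have [p1|p1] := leP (p - 1) 0.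
      have : x `^ (p - 1) <= y `^ (p - 1) by apply: powR_anti => //; exact: ltW.
      nra.
    have : x `^ (p - 1) <= (2 * y) `^ (p - 1).
      by apply: powR_mono => //; [lra|exact: ltW].
    by rewrite powRM; [move=> h; rewrite mulrDl; lra|lra|exact: ltW].
  have -> : y `^ p * z = y * y `^ (p - 1) * z.
    by rewrite mulr_powRB1// ltW.
  have q0 : 0 <= y * y `^ (p - 1) * z by rewrite !mulr_ge0 ?powR_ge0 ?ltW.
  apply: (@le_trans _ _ (y * ((2 + 2 `^ (p - 1)) * y `^ (p - 1) * z))).
    by rewrite ler_wpM2l// ltW.
  rewrite /moment_cst.
  have -> : y * ((2 + 2 `^ (p - 1)) * y `^ (p - 1) * z) =
    (2 + 2 `^ (p - 1)) * (y * y `^ (p - 1) * z) by ring.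
  by rewrite ler_wpM2r// lerDl.
have pn : p != 0 by rewrite gt_eqF.
rewrite (incr_powR_shift (lexx 0) pn y0 z0) !addr0.
have h : (y + z) `^ p <= 2 `^ p * z `^ p.
  rewrite -powRM; [|lra|exact: ltW].
  by apply: powR_mono; [exact: addr_gt0|lra|exact: ltW].
have yp := powR_ge0 y p; have zp := powR_ge0 z p.
have -> : moment_cst p * (y * z `^ p) = y * (moment_cst p * z `^ p) by ring.
rewrite ler_pM2l// ler_pdivrMr// /moment_cst.
have -> : (2 + 2 `^ (p - 1) + 2 `^ p / p) * z `^ p * p =
   2 `^ p * z `^ p + (2 + 2 `^ (p - 1)) * z `^ p * p by field.
have : 0 <= (2 + 2 `^ (p - 1)) * z `^ p * p.
  by apply: mulr_ge0; [apply: mulr_ge0 => //; lra|exact: ltW].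
lra.
Qed.

Let quad_le (u v : R) : u <= 2 * v -> 2 * u <= 4 * v.
Proof. by lra. Qed.

(** The test psi = x^(p-1) produces the moment of order p + 1. On z <= y the increment is at most a
    constant times y^p z, and the singular power -al of [Lk] falls on the smaller variable; the case
    y < z is symmetric. The exponent p + al is thereby raised by 1 - al, without assuming that the
    new moment is finite. *)
Lemma moment_step eps K f p : 0 < p -> kernel al eps K -> eps <= 1 ->
  profile K f -> itg leb1 (fun x => x `^ (p + al) * f x) ->
  itg leb1 (fun x => x `^ (1 - al) * f x) ->
  itg leb1 (fun x => x `^ (p + 1) * f x) /\
  Itg leb1 (fun x => x `^ (p + 1) * f x) <= 8 * moment_cst p *
   (Itg leb1 (fun x => x `^ (p + al) * f x) * Itg leb1 (fun x => x `^ (1 - al) * f x)).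
Proof.
move=> p0 hK e1 hf iF iG.
set F := (fun x => x `^ (p + al) * f x) in iF *.
set G := (fun x => x `^ (1 - al) * f x) in iG *.
have c0 : 0 <= moment_cst p.
  by rewrite !addr_ge0 ?powR_ge0// divr_ge0 ?powR_ge0 ?ltW.
(* The shift by 0 lets the lemmas on shifted powers apply. *)
pose psi x : R := (x + 0) `^ (p - 1).
have mpsi : msr leb1 psi by exact: msr_powR_shift.
have psi0 x : 0 <= psi x by exact: powR_ge0.
have lpsi : locint psi by exact: locint_powR_shift.
have [iff2 E2] := weak_ge0 hK e1 hf mpsi psi0 lpsi.
have [iFG EFG] := Itg_prod iF iG; have [iGF EGF] := Itg_prod iG iF.
have [iS ES] := ItgD_eq iFG iGF (fun=> erefl).
have [iZ EZ] := ItgZ_eq (c := 4 * moment_cst p) iS (fun=> erefl).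
have f0 := pr_supp hf; have fge := pr_ge0 hf.
have k0 p' : 0 <= flux K f f p' * (p'.1 * incr psi p'.1 p'.2).
  have [p1|p1] := leP p'.1 0; first by rewrite (flux0 _ f0 f0) ?p1// mul0r.
  apply: mulr_ge0; first exact: (flux_ge0 hK e1).
  by apply: mulr_ge0; [exact: ltW|apply: incr_ge0].
have bnd q : flux K f f q * (q.1 * incr psi q.1 q.2) <=
    4 * moment_cst p * (F q.1 * G q.2 + G q.1 * F q.2).
  have FG0 : 0 <= F q.1 * G q.2 + G q.1 * F q.2.
    by rewrite addr_ge0// !mulr_ge0// powR_ge0.
  have [q1|q1] := leP q.1 0.
    by rewrite (flux0 _ f0 f0) ?q1// mul0r; rewrite !mulr_ge0.
  have [q2|q2] := leP q.2 0.
    by rewrite (flux0 _ f0 f0) ?q2 ?orbT// mul0r; rewrite !mulr_ge0.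
  have := incr_powR_le p0 q1 q2; rewrite -/psi /flux /F /G.
  have Kle := kernel_le2L hK e1 q1 q2; have Kge := kernel_ge0 hK e1 q1 q2.
  set y := q.1 in q1 Kle Kge *; set z := q.2 in q2 Kle Kge *.
  move=> inc.
  have inc0 : 0 <= y * incr psi y z by apply: mulr_ge0; [exact: ltW|apply: incr_ge0].
  set J := y * incr psi y z in inc inc0 *.
  suff KJ : K y z * J <= 4 * moment_cst p *
     (y `^ (p + al) * z `^ (1 - al) + y `^ (1 - al) * z `^ (p + al)).
    have -> : K y z * f y * f z * J = K y z * J * (f y * f z) by ring.
    have -> : 4 * moment_cst p * (y `^ (p + al) * f y * (z `^ (1 - al) * f z) +
      y `^ (1 - al) * f y * (z `^ (p + al) * f z)) = 4 * moment_cst p *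
     (y `^ (p + al) * z `^ (1 - al) + y `^ (1 - al) * z `^ (p + al)) * (f y * f z) by ring.
    by rewrite ler_wpM2r// mulr_ge0.
  have t1 : 0 <= y `^ (p + al) * z `^ (1 - al) by rewrite mulr_ge0 ?powR_ge0.
  have t2 : 0 <= y `^ (1 - al) * z `^ (p + al) by rewrite mulr_ge0 ?powR_ge0.
  have powsub x : 0 < x -> x `^ (1 - al) = x * x `^ (- al).
    by move=> x0; rewrite powRDp// powRr1// ltW.
  move: inc; case: (leP z y) => [zy|yz] inc.
    apply: (@le_trans _ _ ((4 * (y `^ al * z `^ (- al))) * (moment_cst p * (y `^ p * z)))).
      apply: ler_pM => //; apply: (le_trans Kle).
      exact/quad_le/Lk_le.
    have -> : 4 * (y `^ al * z `^ (- al)) * (moment_cst p * (y `^ p * z)) =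
       4 * moment_cst p * (y `^ (p + al) * z `^ (1 - al)).
      by rewrite powsub// powRDp//; ring.
    by rewrite ler_wpM2l ?mulr_ge0// lerDl.
  apply: (@le_trans _ _ ((4 * (z `^ al * y `^ (- al))) * (moment_cst p * (y * z `^ p)))).
    apply: ler_pM => //; apply: (le_trans Kle).
    by rewrite LkC; apply/quad_le/Lk_le => //; exact: ltW.
  have -> : 4 * (z `^ al * y `^ (- al)) * (moment_cst p * (y * z `^ p)) =
     4 * moment_cst p * (y `^ (1 - al) * z `^ (p + al)).
    by rewrite powsub// [z `^ (p + al)]powRDp//; ring.
  by rewrite ler_wpM2l ?mulr_ge0// lerDr.
have i2 : itg leb2 (fun q => flux K f f q * (q.1 * incr psi q.1 q.2)).
  apply: itg_le iZ; last by move=> q; rewrite ger0_norm.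
  apply: (msr_flux hK); try exact: profile_msr hf.
  apply: msrM; first exact: msr_p1.
  by apply/leb2_msrE; apply: measurable_incr_ge0 => //; exact/leb1_msrE.
have i1 := iff2.2 i2.
have E1 : Itg leb1 (fun x => x ^+ 2 * f x * psi x) = Itg leb1 (fun x => x `^ (p + 1) * f x) /\
    itg leb1 (fun x => x `^ (p + 1) * f x).
  have h x : x ^+ 2 * f x * psi x = x `^ (p + 1) * f x.
    have [x0|x0] := leP x 0; first by rewrite f0// !(mulr0, mul0r).
    rewrite /psi addr0 mulrAC; congr (_ * _).
    have -> : p + 1 = 2%:R + (p - 1) by lra.
    by rewrite (powRDp 2%:R (p - 1) x0) powR_mulrn// ltW.
  by split; [apply: Itg_eq|apply: itg_eq i1 _].
case: E1 => E1 i3; split => //.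
rewrite -E1 (E2 i1); apply: (le_trans (Itg_le i2 iZ bnd)).
rewrite EZ ES EFG EGF; lra.
Qed.

Lemma moment_interp eps K f s S : kernel al eps K -> eps <= 1 -> profile K f ->
  0 <= s -> s <= S -> itg leb1 (fun x => x `^ S * f x) ->
  itg leb1 (fun x => x `^ s * f x) /\
  Itg leb1 (fun x => x `^ s * f x) <= 2 + Itg leb1 (fun x => x `^ S * f x).
Proof.
move=> hK e1 hf s0 sS iS; have [i0 N2] := profile_number hK e1 hf.
have [iD ED] := ItgD_eq i0 iS (fun=> erefl).
have bnd x : x `^ s * f x <= f x + x `^ S * f x.
  have [x0|x0] := leP x 0; first by rewrite (pr_supp hf)// !mulr0 addr0.
  rewrite -[X in _ <= X + _]mul1r -mulrDl ler_wpM2r ?(pr_ge0 hf)//.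
  by rewrite -(powRr0 x); apply: powR_le_add.
have is_ : itg leb1 (fun x => x `^ s * f x).
  apply: itg_le iD; last first.
    by move=> x; rewrite ger0_norm// mulr_ge0 ?powR_ge0 ?(pr_ge0 hf).
  apply: msrM; last exact: profile_msr hf.
  by apply: msr_powR; exact: msr_id.
by split => //; apply: (le_trans (Itg_le is_ iD bnd)); rewrite ED lerD2r.
Qed.

(** Induction along the exponents 1 + k (1 - al), starting from the mass; the step gains 1 - al > 0,
    so every order is reached, and interpolation with order zero fills the gaps. *)
Lemma moments (s : R) : 0 <= s -> exists C, forall eps K f,
  kernel al eps K -> eps <= 1 -> profile K f ->
  itg leb1 (fun x => x `^ s * f x) /\ Itg leb1 (fun x => x `^ s * f x) <= C.
Proof.
move=> s0.
have step (k : nat) : exists C, forall eps K f,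
    kernel al eps K -> eps <= 1 -> profile K f ->
    itg leb1 (fun x => x `^ (1 + k%:R * (1 - al)) * f x) /\
    Itg leb1 (fun x => x `^ (1 + k%:R * (1 - al)) * f x) <= C.
  elim: k => [|k [C ih]].
    exists 1 => eps K f hK e1 hf; have [i1 E1] := profile_mass hf.
    have h x : x * f x = x `^ (1 + 0%:R * (1 - al)) * f x.
      have [x0|x0] := leP x 0; first by rewrite (pr_supp hf)// !mulr0.
      by rewrite mul0r addr0 powRr1// ltW.
    by split; [exact: itg_eq i1 h|rewrite -(Itg_eq _ h) E1].
  (* Chosen so that p + al is the exponent already reached and p + 1 the next one. *)
  pose p : R := 1 + k%:R * (1 - al) - al.
  have p0 : 0 < p.
    have : 0 <= k%:R * (1 - al) by rewrite mulr_ge0// subr_ge0 ltW.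
    by move=> u0; rewrite /p addrAC ltr_wpDr// subr_gt0.
  exists (8 * moment_cst p * (C * (2 + C))) => eps K f hK e1 hf.
  have [iS CS] := ih eps K f hK e1 hf.
  have [i1 C1] : itg leb1 (fun x => x `^ (1 - al) * f x) /\
      Itg leb1 (fun x => x `^ (1 - al) * f x) <= 2 + C.
    have [|||? h] := @moment_interp eps K f (1 - al) (1 + k%:R * (1 - al)) hK e1 hf.
    - by rewrite subr_ge0 ltW.
    - have : 0 <= k%:R * (1 - al) by rewrite mulr_ge0// subr_ge0 ltW.
      by move=> u0; rewrite lerD2l (le_trans _ u0)// oppr_le0.
    - by [].
    - by split => //; lra.
  have pal : p + al = 1 + k%:R * (1 - al) by rewrite /p; lra.
  have ppl : p + 1 = 1 + k.+1%:R * (1 - al) by rewrite /p -natr1; lra.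
  have := @moment_step eps K f p p0 hK e1 hf; rewrite pal ppl => /(_ iS i1) [h1 h2].
  split => //; apply: (le_trans h2).
  have pos u : 0 <= Itg leb1 (fun x => x `^ u * f x) \/ ~ itg leb1 (fun x => x `^ u * f x).
    have [h|h] := pselect (itg leb1 (fun x => x `^ u * f x)); last by right.
    by left; apply: Itg_ge0 => // x; rewrite mulr_ge0 ?powR_ge0 ?(pr_ge0 hf).
  have c0 : 0 <= moment_cst p.
    by rewrite !addr_ge0 ?powR_ge0// divr_ge0 ?powR_ge0 ?ltW.
  rewrite ler_wpM2l ?mulr_ge0//.
  case: (pos (1 + k%:R * (1 - al))) => // m0; case: (pos (1 - al)) => // m1.
  exact: ler_pM.
have [k hk] : exists k : nat, s <= 1 + k%:R * (1 - al).
  exists (Num.trunc (s / (1 - al))).+1.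
  have a0 : 0 < 1 - al by rewrite subr_gt0.
  have : s / (1 - al) < (Num.trunc (s / (1 - al))).+1%:R.
    by apply: truncnS_gt.
  rewrite ltr_pdivrMr//; lra.
have [C hC] := step k; exists (2 + C) => eps K f hK e1 hf.
have [iS CS] := hC eps K f hK e1 hf.
have [h1 h2] := moment_interp hK e1 hf s0 hk iS; split => //; lra.
Qed.

End Moments.

(** * Laplace transforms *)

Section Riccati.
Context {R : realType}.

(** From exp t >= 1 + t and (1 + t) (1 - t + t^2) = 1 + t^3 >= 1. *)
Lemma expRN_le (t : R) : 0 <= t -> expR (- t) <= 1 - t + t ^+ 2.
Proof.
move=> t0; rewrite expRN -[leRHS]invrK lef_pV2 ?posrE ?expR_gt0//; last first.
  by rewrite invr_gt0; have := sqr_ge0 (t - 1); nra.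
apply: (@le_trans _ _ (1 + t)); last exact: expR_ge1Dx.
have h : 0 < 1 - t + t ^+ 2 by have := sqr_ge0 (t - 1); nra.
rewrite -(mul1r (_^-1)) ler_pdivrMr//.
have -> : (1 + t) * (1 - t + t ^+ 2) = 1 + t ^+ 3 by ring.
by rewrite lerDl exprn_ge0.
Qed.

(* The smooth function [sqrt ((u1 - u2)^2 + de^2)] stands in for |u1 - u2|, whose
   slope is at most [rho] because u1 + u2 >= 0. *)
Lemma riccati_compare (u1 u2 r1 r2 : R -> R) (rho q0 C : R) : 0 < q0 ->
  (forall q, 0 < q -> q <= q0 -> is_derive q 1 u1 (- u1 q ^+ 2 - r1 q)) ->
  (forall q, 0 < q -> q <= q0 -> is_derive q 1 u2 (- u2 q ^+ 2 - r2 q)) ->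
  (forall q, 0 < q -> q <= q0 -> 0 <= u1 q) ->
  (forall q, 0 < q -> q <= q0 -> 0 <= u2 q) ->
  (forall q, 0 < q -> q <= q0 -> `|r1 q - r2 q| <= rho) ->
  (forall q, 0 < q -> q <= q0 -> `|u1 q - u2 q| <= C * q) ->
  `|u1 q0 - u2 q0| <= rho * q0.
Proof.
move=> q00 d1 d2 p1 p2 hr hC; pose d q : R := u1 q - u2 q.
have rho0 : 0 <= rho by apply: le_trans (hr q0 q00 (lexx _)); exact: normr_ge0.
have C0 : 0 <= C.
  have := le_trans (normr_ge0 _) (hC q0 q00 (lexx _)); by rewrite pmulr_lge0.
have dd q : 0 < q -> q <= q0 ->
    is_derive q 1 d (- (u1 q + u2 q) * d q - (r1 q - r2 q)).
  move=> q1 q2; have h1 := d1 q q1 q2; have h2 := d2 q q1 q2.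
  by apply: is_derive_eq; rewrite /d; ring.
apply/ler_addgt0Pr => e e0.
(* The comparison starts at s > 0, so small that the a priori bound makes the initial difference at
   most e / 2; smoothing costs the other half. *)
pose s := Num.min (q0 / 2) (e / (2 * (C + 1))).
have C1 : 0 < 2 * (C + 1) by lra.
have s0 : 0 < s by rewrite lt_min !divr_gt0.
have sq : s < q0 by rewrite /s gt_min; apply/orP; left; lra.
have Cs : C * s <= e / 2.
  have : s <= e / (2 * (C + 1)) by rewrite /s ge_min lexx orbT.
  rewrite ler_pdivlMr// => h; nra.
pose de := e / 2.
have de0 : 0 < de by rewrite /de; lra.
pose S q := Num.sqrt (d q ^+ 2 + de ^+ 2).
have Sp q : 0 < d q ^+ 2 + de ^+ 2 by rewrite ltr_wpDl ?sqr_ge0// exprn_gt0.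
have dS q : 0 < q -> q <= q0 -> is_derive q 1 S
   ((2 * Num.sqrt (d q ^+ 2 + de ^+ 2))^-1 *
    (2 * d q * (- (u1 q + u2 q) * d q - (r1 q - r2 q)))).
  move=> q1 q2; have h := dd q q1 q2; have hs := is_derive1_sqrt (Sp q).
  have h2 : is_derive q (1 : R) (fun q => d q ^+ 2 + de ^+ 2)
      (2 * d q * (- (u1 q + u2 q) * d q - (r1 q - r2 q))).
    by apply: is_derive_eq; rewrite /GRing.scale/=; ring.
  have h3 := @is_derive1_comp _ Num.sqrt (fun q => d q ^+ 2 + de ^+ 2) q _ _ hs h2.
  by apply: is_derive_eq.
have [xi] : exists2 xi, xi \in `]s, q0[ & S q0 - S s =
   ((2 * Num.sqrt (d xi ^+ 2 + de ^+ 2))^-1 *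
    (2 * d xi * (- (u1 xi + u2 xi) * d xi - (r1 xi - r2 xi)))) * (q0 - s).
  apply: (@MVT _ S (fun q => (2 * Num.sqrt (d q ^+ 2 + de ^+ 2))^-1 *
    (2 * d q * (- (u1 q + u2 q) * d q - (r1 q - r2 q))))) => //.
  - move=> x; rewrite in_itv/= => /andP[sx xq]; apply: dS; last exact: ltW.
    exact: lt_trans sx.
  - apply: continuous_in_subspaceT => x; rewrite inE/= in_itv/= => /andP[sx xq].
    apply: differentiable_continuous; apply/derivable1_diffP.
    by have [] := dS x (lt_le_trans s0 sx) xq.
rewrite in_itv/= => /andP[sxi xiq] E.
have xi0 : 0 < xi by exact: lt_trans sxi.
have le_absS q : `|d q| <= S q.
  by rewrite /S -sqrtr_sqr ler_wsqrtr// lerDl sqr_ge0.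
have S_le q : S q <= `|d q| + de.
  have h0 : 0 <= `|d q| * de by rewrite mulr_ge0// ltW.
  apply: (@le_trans _ _ (Num.sqrt ((`|d q| + de) ^+ 2))); last first.
    by rewrite sqrtr_sqr ger0_norm// addr_ge0// ltW.
  rewrite /S; apply: ler_wsqrtr.
  have -> : (`|d q| + de) ^+ 2 = `|d q| ^+ 2 + 2 * (`|d q| * de) + de ^+ 2 by ring.
  rewrite real_normK ?num_real//; lra.
have slope : (2 * Num.sqrt (d xi ^+ 2 + de ^+ 2))^-1 *
    (2 * d xi * (- (u1 xi + u2 xi) * d xi - (r1 xi - r2 xi))) <= rho.
  have S0 : 0 < Num.sqrt (d xi ^+ 2 + de ^+ 2) by rewrite sqrtr_gt0.
  rewrite mulrC ler_pdivrMr; last by lra.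
  have a1 := p1 xi xi0 (ltW xiq); have a2 := p2 xi xi0 (ltW xiq).
  have a3 := hr xi xi0 (ltW xiq); have a4 := le_absS xi; rewrite /S in a4.
  have a5 : - (d xi * (r1 xi - r2 xi)) <= `|d xi| * rho.
    apply: (le_trans (ler_norm _)); rewrite normrN normrM ler_wpM2l//.
  have a6 : `|d xi| * rho <= Num.sqrt (d xi ^+ 2 + de ^+ 2) * rho by rewrite ler_wpM2r.
  have a7 : 0 <= (u1 xi + u2 xi) * d xi ^+ 2 by rewrite mulr_ge0 ?sqr_ge0// addr_ge0.
  have -> : 2 * d xi * (- (u1 xi + u2 xi) * d xi - (r1 xi - r2 xi)) =
   - 2 * ((u1 xi + u2 xi) * d xi ^+ 2) + 2 * - (d xi * (r1 xi - r2 xi)) by ring.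
  lra.
have b1 := le_absS q0; have b2 := S_le s; have b3 := hC s s0 (ltW sq).
have b4 : S q0 - S s <= rho * q0.
  rewrite E; apply: (@le_trans _ _ (rho * (q0 - s))).
    by rewrite ler_wpM2r// subr_ge0 ltW.
  by rewrite ler_wpM2l// lerBlDr lerDl ltW.
rewrite -/(d q0); move: b3; rewrite -/(d s) => b3; rewrite /de in b2.
lra.
Qed.

End Riccati.

(** * The transform of a profile and its exact identity *)

Section Laplace.
Context {R : realType}.
Local Notation mu := (@lebesgue_measure R).

(** Subtracting the exponential from 1 makes the transform finite from the mass alone, as ex q x <=
    q x. The function u(q) of the overview is [lap f q / q], and [dlap] is the derivative of [lap]
    in q. *)
Definition ex (q x : R) : R := 1 - expR (- (q * x)).
Definition lap (f : R -> R) (q : R) : R := Itg leb1 (fun x => ex q x * f x).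
Definition dlap (f : R -> R) (q : R) : R :=
  Itg leb1 (fun x => x * expR (- (q * x)) * f x).

Lemma ex_bounds (q x : R) : 0 < q -> 0 <= x ->
  [/\ 0 <= ex q x, ex q x <= 1, ex q x <= q * x & q * x - (q * x) ^+ 2 <= ex q x].
Proof.
move=> q0 x0; have qx : 0 <= q * x by rewrite mulr_ge0// ltW.
have h1 := expR_ge1Dx (- (q * x)); have h2 := expR_ge0 (- (q * x)).
have h3 := expRN_le qx.
have h4 : expR (- (q * x)) <= 1 by rewrite -expR0 ler_expR oppr_le0.
by rewrite /ex; split; lra.
Qed.

Lemma msr_ex (q : R) : msr leb1 (ex q).
Proof. by rewrite /ex; msr_tac. Qed.

Lemma msr_expq (q : R) : msr leb1 (fun x : R => expR (- (q * x))).
Proof. by msr_tac. Qed.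

Lemma expq_bounds (q x : R) : 0 < q -> 0 <= x -> 0 <= expR (- (q * x)) <= 1.
Proof.
move=> q0 x0; rewrite expR_ge0 -expR0 ler_expR oppr_le0 mulr_ge0//; exact: ltW.
Qed.

Lemma itg_lap (f : R -> R) (q : R) : 0 < q -> msr leb1 f -> (forall x, x <= 0 -> f x = 0) ->
  itg leb1 (fun x => x * `|f x|) -> itg leb1 (fun x => ex q x * f x).
Proof.
move=> q0 mf f0 i1; apply: itg_le (itgZ q i1); first by apply: msrM => //; exact: msr_ex.
move=> x; have [x0|x0] := leP x 0; first by rewrite f0// !mulr0 normr0 !mulr0.
have [e0 _ eq _] := ex_bounds q0 (ltW x0).
by rewrite normrM (ger0_norm e0) mulrA ler_wpM2r.
Qed.

Lemma itg_dlap (f : R -> R) (q : R) : 0 < q -> msr leb1 f -> (forall x, x <= 0 -> f x = 0) ->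
  itg leb1 (fun x => x * `|f x|) -> itg leb1 (fun x => x * expR (- (q * x)) * f x).
Proof.
move=> q0 mf f0 i1; apply: itg_le i1.
  by apply: msrM => //; apply: msrM; [exact: msr_id|exact: msr_expq].
move=> x; have [x0|x0] := leP x 0; first by rewrite f0// !mulr0 normr0 mulr0.
have /andP[e0 e1] := expq_bounds q0 (ltW x0).
rewrite normrM ler_wpM2r// ger0_norm; last by rewrite mulr_ge0// ltW.
by rewrite ler_piMr// ltW.
Qed.

Lemma is_derive_ex (x q : R) : is_derive q 1 (ex ^~ x) (x * expR (- (q * x))).
Proof.
have h : is_derive q (1 : R) (fun q => - (q * x)) (- x).
  by apply: is_derive_eq; rewrite /GRing.scale/=; ring.
have h2 := @is_derive1_comp _ expR (fun q => - (q * x)) q _ _ (is_derive_expR _) h.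
by rewrite /ex; apply: is_derive_eq; ring.
Qed.

(** Differentiation under the integral: the q-derivative of the integrand is dominated by x |f(x)|
    for all q > 0. *)
Lemma is_derive_lap (f : R -> R) (q : R) : 0 < q -> msr leb1 f ->
  (forall x, x <= 0 -> f x = 0) -> itg leb1 (fun x => x * `|f x|) ->
  is_derive q 1 (lap f) (dlap f q).
Proof.
move=> q0 mf f0 i1.
pose F (q x : R) : R := ex q x * f x.
have dF (x p : R) : is_derive p 1 (F ^~ x) (x * expR (- (p * x)) * f x).
  have h := is_derive_ex x p.
  by rewrite /F; apply: is_derive_eq; rewrite /GRing.scale/=; ring.
have I1 : mu.-integrable setT (EFin \o (fun x => `|x * `|f x| |)).
  by apply: integ_abs; exact/leb1_itgE.
have Iq : `]0, (q + 1)[%classic q by rewrite /= in_itv/= q0 ltrDl ltr01.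
have intF x : `]0, (q + 1)[%classic x -> mu.-integrable setT (EFin \o F x).
  by rewrite /= in_itv/= => /andP[x0 _]; apply/leb1_itgE; exact: itg_lap.
have derF x y : `]0, (q + 1)[%classic x -> setT y -> derivable (F ^~ y) x 1.
  by move=> _ _; have [] := dF y x.
have Gub x y : `]0, (q + 1)[%classic x -> setT y ->
    `|partial1of2 F x y| <= `|y * `|f y| |.
  rewrite /= in_itv/= => /andP[x0 _] _; rewrite /partial1of2 derive1E.
  rewrite (@derive_val _ _ _ _ _ _ _ (dF y x)).
  have [y0|y0] := leP y 0; first by rewrite f0// !(mulr0, normr0).
  have /andP[e0 e1] := expq_bounds x0 (ltW y0).
  rewrite !normrM normr_id ler_wpM2r// ler_piMr// ger0_norm//.
have dl := @derivable_under_integral R _ _ mu F setT measurableT q 0 (q + 1) Iq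
  intF derF _ (fun y => normr_ge0 _) I1 Gub.
have dv := @differentiation_under_integral R _ _ mu F setT measurableT q 0 (q + 1) Iq
  intF derF _ (fun y => normr_ge0 _) I1 Gub.
have lapE : lap f = (fun q => \int[mu]_(y in setT) F q y).
  by apply/funext => p; rewrite /lap leb1_ItgE.
rewrite lapE; apply: DeriveDef => //.
rewrite -derive1E dv /dlap leb1_ItgE; apply: eq_Rintegral => x _.
by rewrite /partial1of2 derive1E (@derive_val _ _ _ _ _ _ _ (dF x q)).
Qed.

Variables (al eps : R) (K : R -> R -> R).
Hypotheses (al0 : 0 <= al) (al1 : al < 1) (hK : kernel al eps K) (e1 : eps <= 1).

Lemma profile_itgx f : profile K f -> itg leb1 (fun x => x * `|f x|).
Proof.
move=> hf; apply: itg_eq (proj1 (profile_mass hf)) _ => x.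
by rewrite ger0_norm ?(pr_ge0 hf).
Qed.

(* Its primitive is [- ex q x / x], which makes the symmetrised increment collapse
   to the product [ex q y * ex q z]. *)
Definition lap_test (q x : R) : R := x `^ (- 2) * ex q x - q * x `^ (- 1) * expR (- (q * x)).

Lemma is_derive_expq (q x : R) :
  is_derive x 1 (fun x : R => expR (- (q * x))) (- (q * expR (- (q * x)))).
Proof.
have h : is_derive x (1 : R) (fun x : R => - (q * x)) (- q).
  by apply: is_derive_eq; rewrite /GRing.scale/=; ring.
have h2 := @is_derive1_comp _ expR (fun x : R => - (q * x)) x _ _ (is_derive_expR _) h.
by apply: is_derive_eq; ring.
Qed.

Lemma is_derive_ex_snd (q x : R) : is_derive x 1 (ex q) (q * expR (- (q * x))).
Proof. have h := is_derive_expq q x; rewrite /ex; apply: is_derive_eq; ring. Qed.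

Lemma continuous_lap_test (q x : R) : 0 < x -> {for x, continuous (lap_test q)}.
Proof.
move=> x0; apply: differentiable_continuous; apply/derivable1_diffP.
have h1 : is_derive x 1 (fun t : R => t `^ (- 2)) (- 2 * x `^ (- 2 - 1)) by exact: is_derive1_powR.
have h2 : is_derive x 1 (fun t : R => t `^ (- 1)) (- 1 * x `^ (- 1 - 1)) by exact: is_derive1_powR.
have h3 := is_derive_expq q x; have h4 := is_derive_ex_snd q x.
suff [? _] : is_derive x 1 (lap_test q) (x `^ (- 2) * (q * expR (- (q * x))) +
   ex q x * (- 2 * x `^ (- 2 - 1)) - (q * x `^ (- 1) * (- (q * expR (- (q * x)))) +
    expR (- (q * x)) * (q * (- 1 * x `^ (- 1 - 1))))) by [].
by rewrite /lap_test; apply: is_derive_eq; rewrite /GRing.scale/=; ring.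
Qed.

Lemma incr_lap (q y z : R) : 0 < q -> 0 < y -> 0 < z ->
  incr (lap_test q) y z = ex q y / y - ex q (y + z) / (y + z).
Proof.
move=> q0 y0 z0.
have dPsi (x : R) : 0 < x ->
    is_derive x 1 (fun x => - (ex q x * x `^ (- 1))) (lap_test q x).
  move=> x0; have h4 := is_derive_ex_snd q x.
  have h2 : is_derive x 1 (fun t : R => t `^ (- 1)) (- 1 * x `^ (- 1 - 1)).
    exact: is_derive1_powR.
  apply: is_derive_eq; rewrite /lap_test /GRing.scale/=.
  have -> : - 2 = - 1 - 1 :> R by ring.
  ring.
rewrite (incr_primitive (@continuous_lap_test q) dPsi y0 z0) !powR_inv1 ?ltW// ?addr_gt0//.
ring.
Qed.

Lemma lap_identity f (q : R) : profile K f -> 0 < q ->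
  itg leb2 (fun p => flux K f f p * (ex q p.1 * ex q p.2)) /\
  2 * (lap f q - q * dlap f q) =
  Itg leb2 (fun p => flux K f f p * (ex q p.1 * ex q p.2)).
Proof.
move=> hf q0; have mf := profile_msr hf; have f0 := pr_supp hf.
have mex := msr_ex q.
have mpsi : msr leb1 (lap_test q) by rewrite /lap_test; msr_tac.
have lpsi : locint (lap_test q) by apply: locint_continuous => x; exact: continuous_lap_test.
have ix := profile_itgx hf.
have iL := itg_lap q0 mf f0 ix; have iD := itg_dlap q0 mf f0 ix.
have psiE x : ex q x * f x - q * (x * expR (- (q * x)) * f x) = x ^+ 2 * f x * lap_test q x.
  have [x0|x0] := leP x 0; first by rewrite f0// !(mulr0, mul0r) subrr.
  rewrite /lap_test; have -> : x `^ (- 2) = (x ^+ 2)^-1 by rewrite (powR_invn 2 (ltW x0)).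
  by rewrite powR_inv1 ?ltW//; field; rewrite gt_eqF.
have [i1 E1] := ItgB_eq iL (itgZ q iD) psiE.
have [i2 E2] := weak_sym hK e1 hf mpsi lpsi i1.
have eqp p : flux K f f p * sincr (lap_test q) p = flux K f f p * (ex q p.1 * ex q p.2).
  have [p1|p1] := leP p.1 0; first by rewrite (flux0 _ f0 f0) ?p1// !mul0r.
  have [p2|p2] := leP p.2 0; first by rewrite (flux0 _ f0 f0) ?p2 ?orbT// !mul0r.
  congr (_ * _); rewrite /sincr !incr_lap// [p.2 + p.1]addrC.
  have y0 : p.1 != 0 by rewrite gt_eqF.
  have z0 : p.2 != 0 by rewrite gt_eqF.
  have yz0 : p.1 + p.2 != 0 by rewrite gt_eqF// addr_gt0.
  have -> : p.1 * (ex q p.1 / p.1 - ex q (p.1 + p.2) / (p.1 + p.2)) +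
    p.2 * (ex q p.2 / p.2 - ex q (p.1 + p.2) / (p.1 + p.2)) =
    ex q p.1 + ex q p.2 - ex q (p.1 + p.2) by field; rewrite yz0 y0 z0.
  rewrite /ex; have -> : - (q * (p.1 + p.2)) = - (q * p.1) + - (q * p.2) by ring.
  by rewrite expRD; ring.
split; first exact: itg_eq i2 eqp.
by rewrite -(Itg_eq _ eqp) -E2 E1 (ItgZ q iD).
Qed.

End Laplace.

(** * Comparison of transforms through the Riccati equation *)

Section LaplaceComparison.
Context {R : realType}.
Variables (al : R).
Hypotheses (al0 : 0 <= al) (al1 : al < 1).
Implicit Types (eps q : R) (K : R -> R -> R) (f g : R -> R).

Definition absmom (s : R) f : R := Itg leb1 (fun x => x `^ s * `|f x|).

(** The exponents are those produced when [Lk] meets the factor y z: Lk(y, z) y z = y^(1+al)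
    z^(1-al) + y^(1-al) z^(1+al). *)
Record balanced f : Prop := Balanced {
  bal_msr : msr leb1 f;
  bal_supp : forall x, x <= 0 -> f x = 0;
  bal_hi : itg leb1 (fun x => x `^ (1 + al) * `|f x|);
  bal_lo : itg leb1 (fun x => x `^ (1 - al) * `|f x|) }.

Lemma kernel_eps_ge0 eps K : kernel al eps K -> 0 <= eps.
Proof.
move=> hK; have h1 := k_ge hK ltr01 ltr01; have h2 := k_le hK ltr01 ltr01.
by have h3 := Lk_ge2 al ltr01 (@ltr01 R); nra.
Qed.

Lemma kernel_near2 eps K y z : kernel al eps K -> 0 < y -> 0 < z ->
  `|K y z - 2| <= eps * Lk al y z.
Proof.
move=> hK y0 z0; have e0 := kernel_eps_ge0 hK; have h1 := k_ge hK y0 z0.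
have h2 := k_le hK y0 z0; have h3 := Lk_ge2 al y0 z0.
by rewrite ler_norml; apply/andP; split; nra.
Qed.

Lemma powR_addx (x s : R) : 0 < x -> x * x `^ s = x `^ (1 + s).
Proof. by move=> x0; rewrite powRDp// powRr1// ltW. Qed.

Definition wflux K f g q (p : R * R) : R :=
  (K p.1 p.2 - 2) * f p.1 * g p.2 * (ex q p.1 * ex q p.2).

(** Combines |K - 2| <= eps Lk with ex q x <= q x. The factor q^2 matters, since the Riccati
    equation divides this term by 2 q^2. *)
Lemma wflux_bound eps K f g q : kernel al eps K -> balanced f -> balanced g -> 0 < q ->
  itg leb2 (wflux K f g q) /\
  `|Itg leb2 (wflux K f g q)| <= eps * q ^+ 2 *
   (absmom (1 + al) f * absmom (1 - al) g + absmom (1 - al) f * absmom (1 + al) g).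
Proof.
move=> hK bf bg q0; have e0 := kernel_eps_ge0 hK.
have [i1 E1] := Itg_prod (bal_hi bf) (bal_lo bg).
have [i2 E2] := Itg_prod (bal_lo bf) (bal_hi bg).
have [i3 E3] := ItgD_eq i1 i2 (fun=> erefl).
have [i4 E4] := ItgZ_eq (c := eps * q ^+ 2) i3 (fun=> erefl).
have mK : msr leb2 (fun p : R * R => K p.1 p.2) by apply/leb2_msrE; exact: k_meas hK.
have m : msr leb2 (wflux K f g q).
  have mf := msr_fst (bal_msr bf); have mg := msr_snd (bal_msr bg).
  have me1 := msr_fst (msr_ex q); have me2 := msr_snd (msr_ex q).
  by rewrite /wflux; msr_tac.
have bnd p : `|wflux K f g q p| <= eps * q ^+ 2 *
    (p.1 `^ (1 + al) * `|f p.1| * (p.2 `^ (1 - al) * `|g p.2|) +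
     p.1 `^ (1 - al) * `|f p.1| * (p.2 `^ (1 + al) * `|g p.2|)).
  have R0 : 0 <= eps * q ^+ 2 *
    (p.1 `^ (1 + al) * `|f p.1| * (p.2 `^ (1 - al) * `|g p.2|) +
     p.1 `^ (1 - al) * `|f p.1| * (p.2 `^ (1 + al) * `|g p.2|)).
    apply: mulr_ge0; first by rewrite mulr_ge0// sqr_ge0.
    by rewrite addr_ge0// !mulr_ge0 ?powR_ge0.
  have [p1|p1] := leP p.1 0; first by move: R0; rewrite /wflux (bal_supp bf p1) !(mulr0, mul0r) normr0.
  have [p2|p2] := leP p.2 0; first by move: R0; rewrite /wflux (bal_supp bg p2) !(mulr0, mul0r) normr0.
  have kn := kernel_near2 hK p1 p2; rewrite LkE// in kn.
  have [a0 _ a1 _] := ex_bounds q0 (ltW p1); have [b0 _ b1 _] := ex_bounds q0 (ltW p2).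
  rewrite /wflux !normrM (ger0_norm a0) (ger0_norm b0) -!powR_addx//.
  have ab : ex q p.1 * ex q p.2 <= (q * p.1) * (q * p.2) by exact: ler_pM.
  apply: (@le_trans _ _ ((eps * (p.1 `^ al * p.2 `^ (- al) + p.1 `^ (- al) * p.2 `^ al)) *
     (`|f p.1| * `|g p.2|) * ((q * p.1) * (q * p.2)))).
    apply: ler_pM => //; rewrite ?mulr_ge0//.
    by rewrite -mulrA ler_wpM2r// mulr_ge0.
  rewrite le_eqVlt; apply/orP; left; apply/eqP; ring.
split; first exact: itg_le m bnd i4.
have h : `|Itg leb2 (wflux K f g q)| <= Itg leb2 (fun p => eps * q ^+ 2 *
    (p.1 `^ (1 + al) * `|f p.1| * (p.2 `^ (1 - al) * `|g p.2|) +
     p.1 `^ (1 - al) * `|f p.1| * (p.2 `^ (1 + al) * `|g p.2|))).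
  by apply: Itg_abs_le => //; exact: itg_le m bnd i4.
by apply: (le_trans h); rewrite E4 E3 E1 E2.
Qed.

Lemma profile_balanced eps K f : kernel al eps K -> eps <= 1 -> profile K f -> balanced f.
Proof.
move=> hK e1 hf; split; [exact: profile_msr hf|exact: pr_supp hf| |].
- have s0 : 0 <= 1 + al by rewrite addr_ge0.
  have [C hC] := moments al0 al1 s0.
  apply: itg_eq (proj1 (hC _ _ _ hK e1 hf)) _ => x.
  by rewrite (ger0_norm (pr_ge0 hf x)).
- have s0 : 0 <= 1 - al by rewrite subr_ge0 ltW.
  have [C hC] := moments al0 al1 s0.
  apply: itg_eq (proj1 (hC _ _ _ hK e1 hf)) _ => x.
  by rewrite (ger0_norm (pr_ge0 hf x)).
Qed.

Lemma balancedB f g : balanced f -> balanced g -> balanced (fun x => f x - g x).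
Proof.
move=> [mf f0 f1 f2] [mg g0 g1 g2]; split.
- exact: msrB.
- by move=> x x0; rewrite f0// g0// subrr.
- apply: itg_le (itgD f1 g1); first by msr_tac.
  move=> x; rewrite -mulrDr normrM normr_id (ger0_norm (powR_ge0 _ _)).
  by rewrite ler_wpM2l ?powR_ge0// ler_normB.
- apply: itg_le (itgD f2 g2); first by msr_tac.
  move=> x; rewrite -mulrDr normrM normr_id (ger0_norm (powR_ge0 _ _)).
  by rewrite ler_wpM2l ?powR_ge0// ler_normB.
Qed.

Lemma lap_le2 eps K f q : kernel al eps K -> eps <= 1 -> profile K f -> 0 < q ->
  [/\ 0 <= lap f q, lap f q <= 2 & lap f q <= q].
Proof.
move=> hK e1 hf q0; have [i0 N2] := profile_number hK e1 hf.
have [i1 E1] := profile_mass hf.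
have iL := itg_lap q0 (profile_msr hf) (pr_supp hf) (profile_itgx hf).
have b x : 0 <= ex q x * f x /\ ex q x * f x <= f x /\ ex q x * f x <= q * (x * f x).
  have [x0|x0] := leP x 0; first by rewrite (pr_supp hf)// !mulr0.
  have [a0 a1 a2 _] := ex_bounds q0 (ltW x0); have f0 := pr_ge0 hf x.
  by split; [rewrite mulr_ge0|split; [rewrite ler_piMl|rewrite mulrA ler_wpM2r]].
split; first by apply: Itg_ge0 => // x; have [] := b x.
- by apply: le_trans N2; apply: Itg_le => // x; have [_ []] := b x.
- have [i2 E2] := ItgZ_eq (c := q) i1 (fun=> erefl).
  have : lap f q <= Itg leb1 (fun x => q * (x * f x)).
    by apply: Itg_le => // x; have [_ []] := b x.
  by rewrite E2 E1 mulr1.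
Qed.

Lemma dlap_le1 eps K f q : kernel al eps K -> eps <= 1 -> profile K f -> 0 < q ->
  0 <= dlap f q <= 1.
Proof.
move=> hK e1 hf q0; have [i1 E1] := profile_mass hf.
have iD := itg_dlap q0 (profile_msr hf) (pr_supp hf) (profile_itgx hf).
have b x : 0 <= x * expR (- (q * x)) * f x /\ x * expR (- (q * x)) * f x <= x * f x.
  have [x0|x0] := leP x 0; first by rewrite (pr_supp hf)// !mulr0.
  have /andP[a0 a1] := expq_bounds q0 (ltW x0); have f0 := pr_ge0 hf x.
  have x0' := ltW x0.
  by split; [rewrite !mulr_ge0|rewrite ler_wpM2r// ler_piMr].
apply/andP; split; first by apply: Itg_ge0 => // x; have [] := b x.
by rewrite -E1; apply: Itg_le => // x; have [] := b x.
Qed.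

(** Unit mass forces u(q) -> 1 at rate O(q). This is the linear a priori bound that
    [riccati_compare] asks for near q = 0; its constant does not enter the conclusion there. *)
Lemma lap_near0 eps K f q : kernel al eps K -> eps <= 1 -> profile K f -> 0 < q ->
  `|lap f q / q - 1| <= q * Itg leb1 (fun x => x `^ 2 * f x).
Proof.
move=> hK e1 hf q0; have [i1 E1] := profile_mass hf.
have [C hC] := moments al0 al1 (ler0n R 2).
have [i2 _] := hC _ _ _ hK e1 hf.
have iL := itg_lap q0 (profile_msr hf) (pr_supp hf) (profile_itgx hf).
have [_ _ Lq] := lap_le2 hK e1 hf q0.
have [i3 E3] := ItgB_eq (itgZ q i1) (itgZ (q ^+ 2) i2) (fun=> erefl).
rewrite (ItgZ _ i1) (ItgZ _ i2) E1 in E3.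
have : q * 1 - q ^+ 2 * Itg leb1 (fun x => x `^ 2 * f x) <= lap f q.
  rewrite -E3; apply: Itg_le => // x.
  have [x0|x0] := leP x 0; first by rewrite (pr_supp hf)// !mulr0 subrr.
  have [_ _ _ a3] := ex_bounds q0 (ltW x0); have f0 := pr_ge0 hf x.
  have -> : q * (x * f x) - q ^+ 2 * (x `^ 2 * f x) = (q * x - (q * x) ^+ 2) * f x.
    by rewrite (powR_mulrn 2 (ltW x0)); ring.
  by rewrite ler_wpM2r.
set m := Itg _ _ => h.
have -> : lap f q / q - 1 = (lap f q - q) / q by field; rewrite gt_eqF.
rewrite normrM normfV (gtr0_norm q0) ler_pdivrMr// ler0_norm; lra.
Qed.

Lemma lap_ode_identity eps K f q : kernel al eps K -> eps <= 1 -> profile K f -> 0 < q ->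
  lap f q - q * dlap f q = lap f q ^+ 2 + Itg leb2 (wflux K f f q) / 2.
Proof.
move=> hK e1 hf q0.
have [i1 E1] := lap_identity hK e1 hf q0.
have bf := profile_balanced hK e1 hf.
have [i2 _] := wflux_bound hK bf bf q0.
have iL := itg_lap q0 (profile_msr hf) (pr_supp hf) (profile_itgx hf).
have [i3 E3] := Itg_prod iL iL.
have [_ E4] := ItgD_eq (itgZ 2 i3) i2 (fun=> erefl).
have E5 : Itg leb2 (fun p => flux K f f p * (ex q p.1 * ex q p.2)) =
   2 * (lap f q * lap f q) + Itg leb2 (wflux K f f q).
  rewrite /lap -E3 -(ItgZ 2 i3) -E4; apply: Itg_eq => p.
  by rewrite /flux /wflux; ring.
by move: E1; rewrite E5 expr2; lra.
Qed.

Lemma lap_ode eps K f q : kernel al eps K -> eps <= 1 -> profile K f -> 0 < q ->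
  is_derive q 1 (fun q => lap f q / q)
    (- (lap f q / q) ^+ 2 - Itg leb2 (wflux K f f q) / (2 * q ^+ 2)).
Proof.
move=> hK e1 hf q0; have E := lap_ode_identity hK e1 hf q0.
have h1 := is_derive_lap q0 (profile_msr hf) (pr_supp hf) (profile_itgx hf).
have qn : q != 0 by rewrite gt_eqF.
have h2 : is_derive q 1 (fun q : R => q^-1) (- q ^- 2).
  have h := is_deriveV (f := id) (x := q) (t := 1) (v := 1) qn.
  by apply: is_derive_eq; rewrite /GRing.scale/= mulr1.
apply: is_derive_eq; rewrite /GRing.scale/=.
have E_ : q * dlap f q = lap f q - lap f q ^+ 2 - Itg leb2 (wflux K f f q) / 2 by lra.
have -> : dlap f q = (lap f q - lap f q ^+ 2 - Itg leb2 (wflux K f f q) / 2) / q.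
  by rewrite -E_; field.
by field.
Qed.


Lemma absmom_profile s : 0 <= s -> exists2 C, 0 <= C & forall eps K f,
  kernel al eps K -> eps <= 1 -> profile K f ->
  [/\ itg leb1 (fun x => x `^ s * `|f x|), 0 <= absmom s f & absmom s f <= C].
Proof.
move=> s0; have [C hC] := moments al0 al1 s0.
exists `|C| => // eps K f hK e1 hf; have [i1 C1] := hC eps K f hK e1 hf.
have h x : x `^ s * f x = x `^ s * `|f x| by rewrite (ger0_norm (pr_ge0 hf x)).
have i2 := itg_eq i1 h; split => //.
  by apply: Itg_ge0 => // x; rewrite mulr_ge0 ?powR_ge0.
by rewrite /absmom -(Itg_eq _ h) (le_trans C1)// ler_norm.
Qed.

(** 1 / (1 + q) is u for the exponential profile and solves u' = - u^2, so the Riccati comparison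
    applies with zero remainder on that side. *)
Lemma lap_compare_harmonic : exists2 C, 0 <= C & forall eps K f q,
  kernel al eps K -> eps <= 1 -> profile K f -> 0 < q ->
  `|lap f q / q - (1 + q)^-1| <= eps * C * q.
Proof.
have s1 : 0 <= 1 + al by rewrite addr_ge0.
have s2 : 0 <= 1 - al by rewrite subr_ge0 ltW.
have [C1 C10 hC1] := absmom_profile s1; have [C2 C20 hC2] := absmom_profile s2.
exists (C1 * C2); first exact: mulr_ge0.
move=> eps K f q0 hK e1 hf q00.
have e0 := kernel_eps_ge0 hK; have bf := profile_balanced hK e1 hf.
have [_ m1 M1] := hC1 _ _ _ hK e1 hf; have [_ m2 M2] := hC2 _ _ _ hK e1 hf.
have mm : absmom (1 + al) f * absmom (1 - al) f <= C1 * C2 by exact: ler_pM.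
have m20 : 0 <= Itg leb1 (fun x => x `^ 2 * f x).
  have [C hC] := moments al0 al1 (ler0n R 2).
  apply: Itg_ge0; first by have [] := hC _ _ _ hK e1 hf.
  by move=> x; rewrite mulr_ge0 ?powR_ge0 ?(pr_ge0 hf).
apply: (@riccati_compare _ (fun q => lap f q / q) (fun q => (1 + q)^-1)
  (fun q => Itg leb2 (wflux K f f q) / (2 * q ^+ 2)) (fun=> 0) _ _
  (Itg leb1 (fun x => x `^ 2 * f x) + 1)) => //.
- by move=> q q1 _; exact: lap_ode hK e1 hf q1.
- move=> q q1 _.
  have qn : 1 + q != 0 by rewrite gt_eqF// ltr_pwDl// ltW.
  have h : is_derive q (1 : R) (fun q : R => 1 + q) 1.
    by apply: is_derive_eq; rewrite /GRing.scale/=; ring.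
  have h2 := is_deriveV (f := fun q : R => 1 + q) (x := q) qn h.
  by apply: is_derive_eq; rewrite /GRing.scale/= mulr1 subr0 -exprVn.
- by move=> q q1 _; have [L0 _ _] := lap_le2 hK e1 hf q1; rewrite divr_ge0// ltW.
- by move=> q q1 _; rewrite invr_ge0 addr_ge0// ltW.
- move=> q q1 _; have [_ W] := wflux_bound hK bf bf q1.
  have d0 : 0 < 2 * q ^+ 2 by rewrite mulr_gt0// exprn_gt0.
  rewrite subr0 normrM normfV (gtr0_norm d0) ler_pdivrMr//; apply: (le_trans W).
  have -> : eps * (C1 * C2) * (2 * q ^+ 2) = eps * q ^+ 2 * (C1 * C2 + C1 * C2) by ring.
  rewrite ler_wpM2l//; first by rewrite mulr_ge0// sqr_ge0.
  by apply: lerD => //; rewrite mulrC.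
- move=> q q1 _; have h := lap_near0 hK e1 hf q1.
  have q1n : 0 < 1 + q by rewrite ltr_pwDl// ltW.
  have -> : lap f q / q - (1 + q)^-1 = (lap f q / q - 1) + q / (1 + q).
    by field; rewrite !gt_eqF.
  apply: (le_trans (ler_normD _ _)); rewrite mulrDl; apply: lerD.
    by rewrite [leRHS]mulrC.
  have d0 : 0 <= q / (1 + q) by apply: divr_ge0; exact: ltW.
  rewrite (ger0_norm d0) mul1r ler_pdivrMr//.
  by rewrite ler_pMr// lerDl ltW.
Qed.

Let ode_diff (l1 l2 d1 d2 w1 w2 : R) : l1 - d1 = l1 ^+ 2 + w1 / 2 ->
  l2 - d2 = l2 ^+ 2 + w2 / 2 ->
  d1 - d2 = (l1 - l2) * (1 - l1 - l2) - (w1 - w2) / 2.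
Proof.
have e (l d v : R) : l - d = l ^+ 2 + v -> d = l - (l ^+ 2 + v) by move=> <-; ring.
by move=> /e -> /e ->; ring.
Qed.

Let norm_le5 (l1 l2 : R) : 0 <= l1 -> l1 <= 2 -> 0 <= l2 -> l2 <= 2 -> `|1 - l1 - l2| <= 5.
Proof. by move=> *; rewrite ler_norml; lra. Qed.

Let half_sum (u w v T : R) : u * v <= T * 5 -> w <= 2 * T -> u * v + w * 2^-1 <= 6 * T.
Proof. by lra. Qed.

(** The remainder is bilinear: W(f1, f1) - W(f2, f2) = W(f1, h) + W(h, f2), so its difference
    carries a factor h besides eps. The bound on the derivatives then follows algebraically from the
    identity for q [dlap]. *)
Lemma lap_compare : exists2 C, 0 <= C & forall eps K f1 f2 q,
  kernel al eps K -> eps <= 1 -> profile K f1 -> profile K f2 -> 0 < q ->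
  let X := absmom (1 + al) (fun x => f1 x - f2 x) +
           absmom (1 - al) (fun x => f1 x - f2 x) in
  `|lap f1 q - lap f2 q| <= C * eps * X * q ^+ 2 /\ `|dlap f1 q - dlap f2 q| <= C * eps * X * q.
Proof.
have s1 : 0 <= 1 + al by rewrite addr_ge0.
have s2 : 0 <= 1 - al by rewrite subr_ge0 ltW.
have [C1 C10 hC1] := absmom_profile s1; have [C2 C20 hC2] := absmom_profile s2.
have CC : 0 <= C1 + C2 by exact: addr_ge0.
(* In the differenced identity the transforms enter with the factor |1 - l1 - l2| <= 5 and the
   remainder contributes one further unit, hence 6. *)
exists (6 * (C1 + C2)); first by rewrite mulr_ge0.
move=> eps K f1 f2 q0 hK e1 hf1 hf2 q00.
have e0 := kernel_eps_ge0 hK.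
have b1 := profile_balanced hK e1 hf1; have b2 := profile_balanced hK e1 hf2.
have [_ m1 M1] := hC1 _ _ _ hK e1 hf1; have [_ m2 M2] := hC2 _ _ _ hK e1 hf1.
have [_ n1 N1] := hC1 _ _ _ hK e1 hf2; have [_ n2 N2] := hC2 _ _ _ hK e1 hf2.
have bh := balancedB b1 b2.
set h := (fun x => f1 x - f2 x) in bh *; move=> X.
have x1 : 0 <= absmom (1 + al) h.
  by apply: Itg_ge0; [exact: bal_hi bh|move=> x; rewrite mulr_ge0 ?powR_ge0].
have x2 : 0 <= absmom (1 - al) h.
  by apply: Itg_ge0; [exact: bal_lo bh|move=> x; rewrite mulr_ge0 ?powR_ge0].
have X0 : 0 <= X by exact: addr_ge0.
have Wd q : 0 < q ->
  `|Itg leb2 (wflux K f1 f1 q) - Itg leb2 (wflux K f2 f2 q)| <=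
   eps * q ^+ 2 * (2 * (C1 + C2) * X).
  move=> q1.
  have [i11 _] := wflux_bound hK b1 b1 q1; have [i22 _] := wflux_bound hK b2 b2 q1.
  have [i1h B1] := wflux_bound hK b1 bh q1; have [ih2 B2] := wflux_bound hK bh b2 q1.
  have [_ E1] := ItgB_eq i11 i22 (fun=> erefl).
  have [_ E2] := ItgD_eq i1h ih2 (fun=> erefl).
  have E : Itg leb2 (wflux K f1 f1 q) - Itg leb2 (wflux K f2 f2 q) =
      Itg leb2 (wflux K f1 h q) + Itg leb2 (wflux K h f2 q).
    by rewrite -E1 -E2; apply: Itg_eq => p; rewrite /wflux /h; ring.
  rewrite E; apply: (le_trans (ler_normD _ _)); apply: (le_trans (lerD B1 B2)).
  rewrite -mulrDr ler_wpM2l//; first by rewrite mulr_ge0// sqr_ge0.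
  have t1 : absmom (1 + al) f1 * absmom (1 - al) h <= C1 * absmom (1 - al) h by exact: ler_wpM2r.
  have t2 : absmom (1 - al) f1 * absmom (1 + al) h <= C2 * absmom (1 + al) h by exact: ler_wpM2r.
  have t3 : absmom (1 + al) h * absmom (1 - al) f2 <= absmom (1 + al) h * C2 by exact: ler_wpM2l.
  have t4 : absmom (1 - al) h * absmom (1 + al) f2 <= absmom (1 - al) h * C1 by exact: ler_wpM2l.
  rewrite /X; set u := absmom (1 + al) h in x1 t2 t3 *; set v := absmom (1 - al) h in x2 t1 t4 *.
  have u1 : 0 <= C1 * u by exact: mulr_ge0.
  have u2 : 0 <= C2 * v by exact: mulr_ge0.
  lra.
have L : `|lap f1 q0 / q0 - lap f2 q0 / q0| <= eps * ((C1 + C2) * X) * q0.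
  apply: (@riccati_compare _ (fun q => lap f1 q / q) (fun q => lap f2 q / q)
    (fun q => Itg leb2 (wflux K f1 f1 q) / (2 * q ^+ 2))
    (fun q => Itg leb2 (wflux K f2 f2 q) / (2 * q ^+ 2)) _ _
    (Itg leb1 (fun x => x `^ 2 * f1 x) + Itg leb1 (fun x => x `^ 2 * f2 x))) => //.
  - by move=> q q1 _; exact: lap_ode hK e1 hf1 q1.
  - by move=> q q1 _; exact: lap_ode hK e1 hf2 q1.
  - by move=> q q1 _; have [L0 _ _] := lap_le2 hK e1 hf1 q1; rewrite divr_ge0// ltW.
  - by move=> q q1 _; have [L0 _ _] := lap_le2 hK e1 hf2 q1; rewrite divr_ge0// ltW.
  - move=> q q1 _; have W := Wd q q1.
    have d0 : 0 < 2 * q ^+ 2 by rewrite mulr_gt0// exprn_gt0.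
    rewrite -mulrBl normrM normfV (gtr0_norm d0) ler_pdivrMr//; apply: (le_trans W).
    by rewrite le_eqVlt; apply/orP; left; apply/eqP; ring.
  - move=> q q1 _; have h1 := lap_near0 hK e1 hf1 q1; have h2 := lap_near0 hK e1 hf2 q1.
    have -> : lap f1 q / q - lap f2 q / q = (lap f1 q / q - 1) - (lap f2 q / q - 1) by ring.
    by apply: (le_trans (ler_normB _ _)); rewrite [leRHS]mulrC [leRHS]mulrDr; exact: lerD.
have L2 : `|lap f1 q0 - lap f2 q0| <= (C1 + C2) * eps * X * q0 ^+ 2.
  move: L; rewrite -mulrBl normrM normfV (gtr0_norm q00) ler_pdivrMr// => L.
  by apply: (le_trans L); rewrite le_eqVlt; apply/orP; left; apply/eqP; ring.
set T := (C1 + C2) * eps * X * q0 ^+ 2 in L2.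
have T0 : 0 <= T by rewrite /T; repeat apply: mulr_ge0 => //; exact: ltW.
split.
  apply: (le_trans L2).
  have -> : 6 * (C1 + C2) * eps * X * q0 ^+ 2 = 6 * T by rewrite /T; ring.
  lra.
have I1 := lap_ode_identity hK e1 hf1 q00; have I2 := lap_ode_identity hK e1 hf2 q00.
have W := Wd q0 q00; have [l0 l2 _] := lap_le2 hK e1 hf1 q00.
have [l0' l2' _] := lap_le2 hK e1 hf2 q00.
rewrite -(ler_pM2l q00); have -> : q0 * (6 * (C1 + C2) * eps * X * q0) = 6 * T by rewrite /T; ring.
rewrite -{1}(gtr0_norm q00) -normrM mulrBr.
have WT : eps * q0 ^+ 2 * (2 * (C1 + C2) * X) = 2 * T by rewrite /T; ring.
rewrite WT in W.
set W1 := Itg leb2 _ in W I1; set W2 := Itg leb2 _ in W I2.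
have -> : q0 * dlap f1 q0 - q0 * dlap f2 q0 =
  (lap f1 q0 - lap f2 q0) * (1 - lap f1 q0 - lap f2 q0) - (W1 - W2) / 2.
  exact: ode_diff.
apply: (le_trans (ler_normB _ _)); rewrite !normrM (@ger0_norm _ 2^-1) ?invr_ge0//.
have h5 : `|1 - lap f1 q0 - lap f2 q0| <= 5 by exact: norm_le5.
apply: half_sum W; exact: ler_pM.
Qed.

Lemma itg_if (T : Type) (I : integration R T) (a b f : T -> R) :
  msr I a -> msr I b -> itg I f -> itg I (fun x => if a x < b x then f x else 0).
Proof.
move=> ma mb hf; apply: itg_le (itg_abs hf).
  by apply: msr_if => //; [exact: itg_msr hf|exact: msr_cst].
by move=> x; case: ifP => _; rewrite ?normr_id// normr0.
Qed.

(* For eps = 0 the transform is q / (1 + q); letting q be large shows that almost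
   all of the unit number of particles sits above a fixed size. *)
Lemma number_tail_ge (eta : R) : 0 < eta -> exists2 delta, 0 < delta &
  exists2 eps1, 0 < eps1 & forall eps K f, kernel al eps K -> eps <= 1 ->
    eps <= eps1 -> profile K f ->
    1 - eta <= Itg leb1 (fun x => if delta < x then f x else 0).
Proof.
move=> eta0; have [C C0 hC] := lap_compare_harmonic.
(* Three errors of eta / 3: the defect of q / (1 + q) from 1, the particles below delta, which
   contribute at most q delta N with N <= 2, and the distance of the transform from the harmonic
   one. *)
pose q := 3 / eta; have q0 : 0 < q by rewrite divr_gt0.
pose delta := eta / (6 * q); have d0 : 0 < delta by rewrite divr_gt0// mulr_gt0.
have D0 : 0 < 3 * (C * q ^+ 2 + 1) by rewrite mulr_gt0// ltr_wpDl// mulr_ge0// sqr_ge0.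
exists delta => //; exists (eta / (3 * (C * q ^+ 2 + 1))); first exact: divr_gt0.
move=> eps K f hK e1 ee hf; have e0 := kernel_eps_ge0 hK.
have [i0 N2] := profile_number hK e1 hf.
have iL := itg_lap q0 (profile_msr hf) (pr_supp hf) (profile_itgx hf).
have iT : itg leb1 (fun x => if delta < x then f x else 0).
  by apply: itg_if => //; [exact: msr_cst|exact: msr_id].
have [i1 E1] := ItgD_eq (itgZ (q * delta) i0) iT (fun=> erefl).
have h1 : lap f q <= q * delta * Itg leb1 f + Itg leb1 (fun x => if delta < x then f x else 0).
  rewrite -(ItgZ _ i0) -E1; apply: Itg_le => // x; have f0 := pr_ge0 hf x.
  have [x0|x0] := leP x 0.
    by rewrite (pr_supp hf)// !mulr0 add0r; case: ifP.
  have [a0 a1 a2 _] := ex_bounds q0 (ltW x0).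
  case: ltP => xd.
    have : ex q x * f x <= 1 * f x by exact: ler_wpM2r.
    have : 0 <= q * delta * f x by apply: mulr_ge0 => //; apply: mulr_ge0; exact: ltW.
    lra.
  rewrite addr0 ler_wpM2r//; apply: (le_trans a2); rewrite ler_wpM2l//; exact: ltW.
have qd : q * delta = eta / 6 by rewrite /delta; field; rewrite gt_eqF.
have h2 : q * delta * Itg leb1 f <= eta / 3 by rewrite qd; nra.
have h3 := hC eps K f q hK e1 hf q0.
have h4 : eps * C * q ^+ 2 <= eta / 3.
  move: ee; rewrite ler_pdivlMr// => ee.
  have t0 : 0 <= C * q ^+ 2 by rewrite mulr_ge0// sqr_ge0.
  have -> : eps * C * q ^+ 2 = eps * (C * q ^+ 2) by ring.
  nra.
have h5 : q / (1 + q) >= 1 - eta / 3.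
  have q1 : 0 < 1 + q by rewrite ltr_pwDl// ltW.
  rewrite ler_pdivlMr//; have : eta * q = 3 by rewrite /q; field; rewrite gt_eqF.
  by move=> h; nra.
have h6 : q / (1 + q) - eps * C * q ^+ 2 <= lap f q.
  move: h3; rewrite ler_norml => /andP[h3 _].
  have : q * (lap f q / q - (1 + q)^-1) >= q * - (eps * C * q).
    by rewrite ler_wpM2l// ltW.
  have -> : q * (lap f q / q - (1 + q)^-1) = lap f q - q / (1 + q).
    by field; rewrite !gt_eqF// ltr_pwDl// ltW.
  rewrite expr2; lra.
lra.
Qed.

End LaplaceComparison.

(** * A negative moment *)

Section NegativeMoment.
Context {R : realType}.
Variables (al : R).
Hypotheses (al0 : 0 <= al) (al1 : al < 1).
Implicit Types (eps : R) (K : R -> R -> R) (f g : R -> R).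

Section Regularised.
Variables (eps b r delta : R) (K : R -> R -> R) (f : R -> R).
Hypotheses (hK : kernel al eps K) (e1 : eps <= 1) (hf : profile K f).
Hypotheses (b0 : 0 <= b) (r0 : 0 < r) (delta0 : 0 < delta).

(** A shifted x^(-2-b): the weight x^2 psi is bounded by r^(-b), and tends to x^(-b) as r -> 0. The
    exponent is split so as to match [incr_powR_shift]. *)
Let psi (x : R) : R := (x + r) `^ ((- 1 - b) - 1).
Let w (x : R) : R := x ^+ 2 * psi x.
Let tail := Itg leb1 (fun x => if delta < x then f x else 0).

Lemma shifted_weightE (x : R) : 0 < x -> w x = (x / (x + r)) ^+ 2 * (x + r) `^ (- b).
Proof.
move=> x0; have xr : 0 < x + r by exact: addr_gt0.
rewrite /w /psi; have -> : - 1 - b - 1 = - 1 + (- 1 + - b) by ring.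
rewrite (powRDp (-1) (-1 + - b) xr) (powRDp (-1) (- b) xr) (powR_inv1 (ltW xr)).
by ring.
Qed.

Lemma shifted_weight_bounds (x : R) : 0 < x ->
  [/\ 0 <= w x, w x <= r `^ (- b) & w x <= x / (x + r) * (x + r) `^ (- b)].
Proof.
move=> x0; have xr : 0 < x + r by exact: addr_gt0.
have t0 : 0 <= x / (x + r) by apply: divr_ge0; exact: ltW.
have t1 : x / (x + r) <= 1 by rewrite ler_pdivrMr// mul1r lerDl ltW.
have t2 : (x / (x + r)) ^+ 2 <= x / (x + r) by rewrite expr2 ler_piMl.
have p0 := powR_ge0 (x + r) (- b).
have p1 : (x + r) `^ (- b) <= r `^ (- b).
  by apply: powR_anti => //; [rewrite lerDr ltW|rewrite oppr_le0].
rewrite shifted_weightE//; split.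
- by apply: mulr_ge0 => //; exact: sqr_ge0.
- apply: le_trans p1; apply: ler_piMl => //; exact: le_trans t2 t1.
- by rewrite ler_wpM2r.
Qed.

(* The part z <= delta of the double integral is nonnegative and discarded; for
   z > delta the increment only loses [delta `^ (- b)]. *)
Lemma shifted_moment_le :
  itg leb1 (fun x => w x * f x) /\
  (2 - eps) * tail * (Itg leb1 (fun x => w x * f x) - delta `^ (- b) * Itg leb1 f) <=
  (1 + b) * Itg leb1 (fun x => w x * f x).
Proof.
have mf := profile_msr hf; have f0 := pr_supp hf; have fge := pr_ge0 hf.
have [iN N2] := profile_number hK e1 hf.
have mpsi : msr leb1 psi by exact: msr_powR_shift.
have psi0 x : 0 <= psi x by exact: powR_ge0.
have lpsi : locint psi by apply: locint_powR_shift; exact: ltW.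
have iw : itg leb1 (fun x => w x * f x).
  apply: itg_le (itgZ (r `^ (- b)) iN).
    by rewrite /w; have mm := mpsi; have mx := msr_id (R := R); apply: msrM => //; apply: msrM => //; apply: msrX.
  move=> x; have [x0|x0] := leP x 0; first by rewrite f0// !mulr0 normr0.
  have [w0 w1 _] := shifted_weight_bounds x0.
  by rewrite normrM (ger0_norm w0) (ger0_norm (fge x)) ler_wpM2r.
split => //.
have i1 : itg leb1 (fun x => x ^+ 2 * f x * psi x).
  by apply: itg_eq iw _ => x; rewrite /w mulrAC.
have E1 : Itg leb1 (fun x => w x * f x) = Itg leb1 (fun x => x ^+ 2 * f x * psi x).
  by apply: Itg_eq => x; rewrite /w mulrAC.
have [/(proj1) /(_ i1) i2 /(_ i1) E2] := weak_ge0 hK e1 hf mpsi psi0 lpsi.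
have iT : itg leb1 (fun x => if delta < x then f x else 0).
  by apply: itg_if => //; [exact: msr_cst|exact: msr_id].
have [iG EG] := ItgB_eq iw (itgZ (delta `^ (- b)) iN) (fun=> erefl).
rewrite (ItgZ _ iN) in EG.
have [iP EP] := Itg_prod iG iT.
have [iZ EZ] := ItgZ_eq (c := 2 - eps) iP (fun=> erefl).
have [iZ2 EZ2] := ItgZ_eq (c := 1 + b) i2 (fun=> erefl).
rewrite {2}E1 E2 -EZ2.
have -> : (2 - eps) * tail * (Itg leb1 (fun x => w x * f x) - delta `^ (- b) * Itg leb1 f) =
  (2 - eps) * ((Itg leb1 (fun x => w x * f x) - delta `^ (- b) * Itg leb1 f) * tail) by ring.
rewrite -EG /tail -EP -EZ; apply: Itg_le => // p.
have F0 : 0 <= flux K f f p * (p.1 * incr psi p.1 p.2).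
  have [p1|p1] := leP p.1 0; first by rewrite (flux0 _ f0 f0) ?p1// mul0r.
  apply: mulr_ge0; first exact: (flux_ge0 hK e1).
  by apply: mulr_ge0; [exact: ltW|exact: incr_ge0].
have b10 : 0 < 1 + b by rewrite ltr_pwDl.
have F1 : 0 <= (1 + b) * (flux K f f p * (p.1 * incr psi p.1 p.2)).
  by apply: mulr_ge0 => //; exact: ltW.
have [p1|p1] := leP p.1 0.
  by apply: le_trans F1; rewrite (f0 _ p1) !mulr0 subrr mul0r mulr0.
case: ltP => pd; last by rewrite !mulr0.
have p2 : 0 < p.2 by exact: lt_trans pd.
set y := p.1 in p1 F0 F1 *; set z := p.2 in p2 pd F0 F1 *.
have yr : 0 < y + r by exact: addr_gt0.
have yzr : 0 < y + z + r by rewrite !addr_gt0.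
have bn : - 1 - b != 0 by rewrite lt_eqF//; lra.
have I : (1 + b) * incr psi y z = (y + r) `^ (- 1 - b) - (y + z + r) `^ (- 1 - b).
  rewrite /psi (incr_powR_shift (ltW r0) bn p1 p2).
  have -> : - 1 - b = - (1 + b) by ring.
  by field; rewrite gt_eqF.
have [w0 _ w2] := shifted_weight_bounds p1.
have J : w y - delta `^ (- b) <= y * ((1 + b) * incr psi y z).
  rewrite I (powRDp _ _ yr) (powRDp _ _ yzr) (powR_inv1 (ltW yr)) (powR_inv1 (ltW yzr)).
  rewrite mulrBr; apply: lerB.
    by apply: (le_trans w2); rewrite mulrA.
  rewrite mulrA; have d0 := powR_ge0 delta (- b).
  have q1 : y / (y + z + r) <= 1 by rewrite ler_pdivrMr// mul1r -addrA lerDl addr_ge0// ltW.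
  have q2 : (y + z + r) `^ (- b) <= delta `^ (- b).
    apply: powR_anti => //; last by rewrite oppr_le0.
    rewrite [y + z]addrC -addrA; apply: (le_trans (ltW pd)).
    by rewrite lerDl addr_ge0// ltW.
  apply: le_trans q2; apply: ler_piMl => //; exact: powR_ge0.
have kge := k_ge hK p1 p2.
have inc0 : 0 <= incr psi y z by exact: incr_ge0.
have ff : 0 <= f y * f z by apply: mulr_ge0.
have -> : (2 - eps) * ((w y * f y - delta `^ (- b) * f y) * f z) =
  ((2 - eps) * (w y - delta `^ (- b))) * (f y * f z) by ring.
have -> : (1 + b) * (flux K f f p * (y * incr psi y z)) =
   (K y z * (y * ((1 + b) * incr psi y z))) * (f y * f z) by rewrite /flux; ring.
rewrite ler_wpM2r//.
have T0 : 0 <= y * ((1 + b) * incr psi y z).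
  by apply: mulr_ge0; [exact: ltW|apply: mulr_ge0 => //; exact: ltW].
apply: (@le_trans _ _ ((2 - eps) * (y * ((1 + b) * incr psi y z)))).
  by apply: ler_wpM2l => //; rewrite subr_ge0 (le_trans e1)// ler1n.
by rewrite ler_wpM2r.
Qed.

End Regularised.

Lemma cvg_harmonic_pow (x s : R) : 0 < x ->
  (fun n => (x + n.+1%:R^-1) `^ s) @ \oo --> x `^ s.
Proof.
move=> x0; have h := @continuous_powR_shift _ s 0 x (lexx 0) x0.
have c : (fun n => x + n.+1%:R^-1) @ \oo --> (x : R).
  rewrite -[X in _ --> X]addr0; apply: cvgD; first exact: cvg_cst.
  exact: cvg_harmonic.
have -> : (fun n => (x + n.+1%:R^-1) `^ s) = (fun t : R => (t + 0) `^ s) \o (fun n => x + n.+1%:R^-1).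
  by apply/funext => n /=; rewrite addr0.
have -> : x `^ s = (x + 0) `^ s by rewrite addr0.
exact: cvg_comp c h.
Qed.

(** In [shifted_moment_le] the moment m occurs on both sides, with factor 1 + b on the right and (2
    - eps) times the tail on the left. The latter is larger because b < 1 and the tail is close to
    1, so m is absorbed, uniformly in r. *)
Lemma negative_moment (b : R) : 0 <= b -> b < 1 -> exists C, exists2 eps1, 0 < eps1 &
  forall eps K f, kernel al eps K -> eps <= 1 -> eps <= eps1 -> profile K f ->
  [/\ itg leb1 (fun x => x `^ (- b) * f x), Itg leb1 (fun x => x `^ (- b) * f x) <= C &
      1 + b + (1 - b) / 2 <= (2 - eps) * Itg leb1 f].
Proof.
(* With s = 1 - b, a tail of at least 1 - s/8 and eps <= s/4 give (2 - eps) tail >= 2 - s/2 = 1 + b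
   + s/2. *)
move=> b0 b1; have eta0 : 0 < (1 - b) / 8 by lra.
have [delta d0 [eps1 e10 H]] := number_tail_ge al0 al1 eta0.
(* The margin (1 - b) / 2 times m is at most 4 * 2 * delta^(-b), as (2 - eps) tail <= 4 and N <=
   2. *)
exists (16 * delta `^ (- b) / (1 - b)), (Num.min eps1 ((1 - b) / 4)).
  by rewrite lt_min e10; lra.
move=> eps K f hK e1; rewrite le_min => /andP[ee1 ee2] hf.
have n1 := H eps K f hK e1 ee1 hf.
have e0 := kernel_eps_ge0 hK.
have [iN N2] := profile_number hK e1 hf.
have iT : itg leb1 (fun x => if delta < x then f x else 0).
  by apply: itg_if => //; [exact: msr_cst|exact: msr_id].
have TN : Itg leb1 (fun x => if delta < x then f x else 0) <= Itg leb1 f.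
  apply: Itg_le => // x; case: ifP => // _; exact: pr_ge0 hf x.
set tl := Itg _ _ in n1 TN; set N := Itg _ _ in N2 TN *.
have big : 1 + b + (1 - b) / 2 <= (2 - eps) * tl by nra.
have dp := powR_ge0 delta (- b).
have N0 : 0 <= N by apply: Itg_ge0 => //; exact: pr_ge0 hf.
have bound r : 0 < r ->
    Itg leb1 (fun x => x ^+ 2 * (x + r) `^ (- 1 - b - 1) * f x) <=
    16 * delta `^ (- b) / (1 - b).
  move=> r0; have [i1] := shifted_moment_le hK e1 hf b0 r0 d0.
  rewrite -/tl -/N; set m := Itg _ _ => h.
  rewrite ler_pdivlMr; last lra.
  have h1 : (2 - eps) * tl <= 4 by nra.
  have h2 : 0 <= m.
    apply: Itg_ge0 => // x; have [x0|x0] := leP x 0; first by rewrite (pr_supp hf x0) mulr0.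
    apply: mulr_ge0; last exact: pr_ge0 hf _.
    by apply: mulr_ge0; [exact: sqr_ge0|exact: powR_ge0].
  set A := (2 - eps) * tl in big h h1; set D := delta `^ (- b) in dp h *.
  have h3 : D * N <= D * 2 by exact: ler_wpM2l.
  have h4 : 0 <= D * N by exact: mulr_ge0.
  have h5 : A * (D * N) <= 4 * (D * 2) by apply: ler_pM => //; lra.
  have h6 : (1 + b + (1 - b) / 2) * m <= A * m by exact: ler_wpM2r.
  by rewrite mulrBr in h; lra.
have [i1 C1] : itg leb1 (fun x => x `^ (- b) * f x) /\
    Itg leb1 (fun x => x `^ (- b) * f x) <= 16 * delta `^ (- b) / (1 - b).
  have rn (n : nat) : 0 < n.+1%:R^-1 :> R by rewrite invr_gt0.
  apply: (@itg_fatou _ _ leb1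
    (fun n x => x ^+ 2 * (x + n.+1%:R^-1) `^ (- 1 - b - 1) * f x)) => //.
  - by move=> n; have [] := shifted_moment_le hK e1 hf b0 (rn n) d0.
  - move=> n x; apply: mulr_ge0; last exact: pr_ge0 hf _.
    by apply: mulr_ge0; [exact: sqr_ge0|exact: powR_ge0].
  - by move=> n; exact: bound.
  - by apply: msrM; [apply: msr_powR; exact: msr_id|exact: profile_msr hf].
  - move=> x; have [x0|x0] := leP x 0.
      rewrite (pr_supp hf x0) mulr0; under eq_fun do rewrite mulr0; exact: cvg_cst.
    apply: cvgM; last exact: cvg_cst.
    have -> : x `^ (- b) = x ^+ 2 * x `^ (- 1 - b - 1).
      rewrite -(powR_mulrn 2 (ltW x0)) -powRDp//; congr (_ `^ _); lra.
    by apply: cvgM; [exact: cvg_cst|exact: cvg_harmonic_pow].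
split => //; apply: (le_trans big); apply: ler_wpM2l => //; lra.
Qed.

End NegativeMoment.

(** * The sign test *)

Section AverageTest.
Context {R : realType}.
Local Notation mu := (@lebesgue_measure R).
Implicit Types (u : R -> R).

Lemma incr_split u y z t : locint u -> 0 < y -> 0 <= z -> 0 <= t ->
  incr u y (z + t) = incr u y z + incr u (y + z) t.
Proof.
move=> lu y0 z0 t0; rewrite /incr.
rewrite -addrA -(@Rintegral_itvB _ u (BRight y) (BRight (y + (z + t))) (y + z)).
- by ring.
- exact: lu.
- by rewrite bnd_simp lerDl.
- by rewrite bnd_simp lerD2l lerDl.
Qed.

Lemma incr_scale u (c y z : R) : 0 < c -> 0 < y -> measurable_fun setT u -> locint u ->
  incr (fun x => u (c * x)) y z = c^-1 * incr u (c * y) (c * z).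
Proof.
move=> c0 y0 mu_ lu; rewrite /incr -mulrDr; set a := y; set b := y + z.
have ci0 : 0 < c^-1 by rewrite invr_gt0.
rewrite /Rintegral integralE [in RHS]integralE.
have m1 : measurable_fun setT (fun x => Num.max (u x) 0) by apply: measurable_maxr.
have m2 : measurable_fun setT (fun x => Num.max (- u x) 0).
  by apply: measurable_maxr => //; exact: measurableT_comp.
have s (v : R -> R) : measurable_fun setT v -> (forall x, 0 <= v x) ->
    (\int[mu]_(x in `]a, b]) (v (c * x))%:E =
     (c^-1)%:E * \int[mu]_(x in `](c * a)%R, (c * b)%R]) (v x)%:E)%E.
  move=> mv v0; have := @ge0_integral_scale_band _ (fun x => v (c * x)) c a b c0.
  have mvc : measurable_fun setT (fun x => v (c * x)).
    by apply: (measurableT_comp mv); exact: mulrl_measurable.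
  move=> /(_ mvc (fun x => v0 _)).
  have -> : (\int[mu]_(x in `](c * a)%R, (c * b)%R]) (v (c * (c^-1 * x)))%:E =
    \int[mu]_(x in `](c * a)%R, (c * b)%R]) (v x)%:E)%E.
    by apply: eq_integral => x _; rewrite mulVKf// gt_eqF.
  by move=> ->; rewrite muleA -EFinM mulVf ?gt_eqF// mul1e.
have p1 : (\int[mu]_(x in `]a, b]) ((fun x => (u (c * x))%:E)^\+ x) =
   (c^-1)%:E * \int[mu]_(x in `](c * a)%R, (c * b)%R]) ((EFin \o u)^\+ x))%E.
  rewrite -[RHS](_ : ((c^-1)%:E * \int[mu]_(x in `](c * a)%R, (c * b)%R]) (Num.max (u x) 0)%:E)%E = _); last first.
    by congr (_ * _)%E; apply: eq_integral => x _; rewrite funeposE /= EFin_max.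
  rewrite -s//; last by move=> x; rewrite le_max lexx orbT.
  by apply: eq_integral => x _; rewrite funeposE /= EFin_max.
have p2 : (\int[mu]_(x in `]a, b]) ((fun x => (u (c * x))%:E)^\- x) =
   (c^-1)%:E * \int[mu]_(x in `](c * a)%R, (c * b)%R]) ((EFin \o u)^\- x))%E.
  rewrite -[RHS](_ : ((c^-1)%:E * \int[mu]_(x in `](c * a)%R, (c * b)%R]) (Num.max (- u x) 0)%:E)%E = _); last first.
    by congr (_ * _)%E; apply: eq_integral => x _; rewrite funenegE /= EFin_max.
  rewrite -s//; last by move=> x; rewrite le_max lexx orbT.
  by apply: eq_integral => x _; rewrite funenegE /= EFin_max.
have il : mu.-integrable `](c * a)%R, (c * b)%R] (EFin \o u) by apply: lu; rewrite mulr_gt0.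
rewrite p1 p2 -(fineK (integrable_pos_fin_num _ il))// -(fineK (integrable_neg_fin_num _ il))//.
by rewrite -!EFinM -!EFinB /= -mulrBr.
Qed.

Lemma measurable_incr u : measurable_fun setT u -> msr leb2 (fun p => incr u p.1 p.2).
Proof.
move=> mu_; apply/leb2_msrE; rewrite /incr /Rintegral.
apply: (measurableT_comp (@fine_measurable R _ measurableT)).
have m1 : measurable_fun setT (fun x => Num.max (u x) 0) by apply: measurable_maxr.
have m2 : measurable_fun setT (fun x => Num.max (- u x) 0).
  by apply: measurable_maxr => //; exact: measurableT_comp.
have h1 := measurable_band_integral m1 (fun x => _).
have h2 := measurable_band_integral m2 (fun x => _).
under eq_fun do rewrite integralE.
apply: emeasurable_funB.
- have : forall x, 0 <= Num.max (u x) 0 by move=> x; rewrite le_max lexx orbT.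
  move=> /h1; congr measurable_fun; apply/funext => p.
  by apply: eq_integral => x _; rewrite funeposE /= EFin_max.
- have : forall x, 0 <= Num.max (- u x) 0 by move=> x; rewrite le_max lexx orbT.
  move=> /h2; congr measurable_fun; apply/funext => p.
  by apply: eq_integral => x _; rewrite funenegE /= EFin_max.
Qed.

(** Near 0 the function u may fail to be integrable, so Lebesgue differentiation is applied to its
    truncations to bands that exhaust (0, oo). *)
Lemma locint_lebesgue_pt u : measurable_fun setT u -> locint u ->
  aev leb1 (fun x => forall m : nat, lebesgue_pt (u \_ `](m.+1%:R^-1), m.+1%:R]) x).
Proof.
move=> mu_ lu; apply/leb1_aeE; apply: ae_foralln => m.
apply: lebesgue_differentiation; apply: open_integrable_locally; first exact: openT.
have : mu.-integrable `](m.+1%:R^-1), m.+1%:R] (EFin \o u) by apply: lu; rewrite invr_gt0.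
by rewrite -restrict_EFin -integrable_mkcond.
Qed.

(** The window ](1 - k) x, x] has length k x, so dividing by k yields x u(x): it is the derivative
    of a primitive at a Lebesgue point. *)
Lemma cvg_incr_average u (x : R) (k : nat -> R) : 0 < x -> locint u ->
  (forall m : nat, lebesgue_pt (u \_ `](m.+1%:R^-1), m.+1%:R]) x) ->
  (forall n, 0 < k n <= 1 / 2) -> k @ \oo --> 0 ->
  (fun n => (k n)^-1 * incr u ((1 - k n) * x) (k n * x)) @ \oo --> x * u x.
Proof.
move=> x0 lu leb k0 kcvg.
(* A band containing ]x / 2, x + 1], hence every window, as k <= 1/2. *)
have [m [m1 m2]] : exists m : nat, m.+1%:R^-1 < x / 2 /\ x + 1 <= m.+1%:R.
  pose t := Num.max (2 / x) (x + 1).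
  have h : t < (Num.trunc t).+1%:R by exact: truncnS_gt.
  exists (Num.trunc t); split.
    have h2 : 2 / x < (Num.trunc t).+1%:R by apply: le_lt_trans h; rewrite le_max lexx.
    rewrite invf_plt ?posrE ?divr_gt0//; apply: le_lt_trans h2.
    by rewrite invfM invrK mulrC.
  by apply: (le_trans _ (ltW h)); rewrite le_max lexx orbT.
have {leb}lm := leb m; set v := u \_ _ in lm.
have x2 : 0 < x / 2 by rewrite divr_gt0.
have vE t : x / 2 < t -> t <= x + 1 -> v t = u t.
  move=> t1 t2; rewrite /v patchE mem_set//= in_itv/=; apply/andP; split.
    exact: lt_trans t1.
  exact: le_trans m2.
have iv : mu.-integrable `]x / 2, x + 1] (EFin \o v).
  have iu := lu _ (x + 1) x2.
  have T := (@eq_integrable _ _ _ mu (`]x / 2, x + 1]%classic : set R)).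
  apply: (T _ (EFin \o u)) => // t; rewrite inE/= in_itv/= => /andP[t1 t2].
  by rewrite /= vE.
have xu : x < x + 1 by rewrite ltrDl.
have ax : (BRight (x / 2) < BRight x)%O by rewrite bnd_simp; lra.
have := @FTC1_lebesgue_pt _ v (BRight (x / 2)) x (x + 1) xu iv ax lm.
set F := (fun y => _) => /= -[dF EF].
have FE n : incr u ((1 - k n) * x) (k n * x) = F x - F (x + - (k n * x)).
  have /andP[kn0 kn1] := k0 n.
  have kx : 0 < k n * x by rewrite mulr_gt0.
  have kx2 : k n * x <= x / 2 by rewrite mulrC; apply: ler_wpM2l; [exact: ltW|lra].
  rewrite /F /incr.
  have -> : (1 - k n) * x = x - k n * x by ring.
  rewrite subrK Rintegral_itvB; last 3 first.
  - apply: integrableS iv => //; apply: subset_itvl; rewrite bnd_simp; lra.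
  - by rewrite bnd_simp; lra.
  - by rewrite bnd_simp; lra.
  apply: eq_Rintegral => t; rewrite inE/= in_itv/= => /andP[t1 t2].
  by rewrite vE//; lra.
have dq : (fun t : R => t^-1 *: (F (t *: 1 + x) - F x)) t @[t --> 0^'] --> u x.
  rewrite -[u x](_ : v x = _); last by rewrite vE//; lra.
  by rewrite -EF derive1E; exact: dF.
have /cvgr_dnbhsP /(_ (fun n => - (k n * x))) := dq.
have kx0 n : 0 < k n * x by rewrite mulr_gt0//; have /andP[] := k0 n.
move=> /(_ _) c.
have {c}c : (fun n => (- (k n * x))^-1 *: (F ((- (k n * x)) *: 1 + x) - F x)) @ \oo --> u x.
  apply: c; split; first by move=> n; rewrite oppr_eq0 gt_eqF.
  rewrite -[X in _ --> X](_ : - (0 * x) = 0); last by rewrite mul0r oppr0.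
  by apply: cvgN; apply: cvgM => //; exact: cvg_cst.
have -> : (fun n => (k n)^-1 * incr u ((1 - k n) * x) (k n * x)) =
    (fun n => x * ((- (k n * x))^-1 *: (F ((- (k n * x)) *: 1 + x) - F x))).
  apply/funext => n; rewrite FE /GRing.scale/= mulr1 [- _ + x]addrC.
  have kn := kx0 n; have /andP[kp _] := k0 n.
  by field; rewrite !gt_eqF.
by apply: cvgM => //; exact: cvg_cst.
Qed.

End AverageTest.

(** * The regularised sign of h as a test function *)

Section SignTest.
Context {R : realType}.
Local Notation mu := (@lebesgue_measure R).
Implicit Types (h : R -> R) (a k x y z : R).

(* [sgn_test] is the difference quotient, along dilations by 1 - k, of the weighted
   sign x sgn(h) (x^(-2-a) + 1); its primitive [- sgn_avg] is a local average, so
   it converges almost everywhere as k -> 0 although the sign is only measurable. *)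
Definition sgnf h x : R := if h x < 0 then -1 else 1.
Definition sgn_weight a x : R := x `^ (- 2 - a) + 1.
Definition sgn_fun a h x : R := sgnf h x * sgn_weight a x.
Definition sgn_avg a h k x : R :=
  k^-1 * incr (sgn_fun a h) ((1 - k) * x) (k * x).
Definition sgn_test a h k x : R :=
  k^-1 * ((1 - k) * sgn_fun a h ((1 - k) * x) - sgn_fun a h x).

Lemma sgnfM h x : h x * sgnf h x = `|h x|.
Proof. by rewrite /sgnf; case: ltP => hx; [rewrite ltr0_norm//|rewrite ger0_norm//]; ring. Qed.

Lemma norm_sgnf h x : `|sgnf h x| = 1.
Proof. by rewrite /sgnf; case: ltP => _; rewrite ?normrN1 ?normr1. Qed.

Lemma msr_sgnf h : msr leb1 h -> msr leb1 (sgnf h).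
Proof. by move=> mh; apply: msr_if => //; exact: msr_cst. Qed.

Lemma sgn_weight_ge0 a x : 0 <= sgn_weight a x.
Proof. by rewrite addr_ge0 ?powR_ge0. Qed.

Lemma norm_sgn_fun a h x : `|sgn_fun a h x| = sgn_weight a x.
Proof. by rewrite normrM norm_sgnf mul1r ger0_norm ?sgn_weight_ge0. Qed.

Lemma msr_sgn_fun a h : msr leb1 h -> msr leb1 (sgn_fun a h).
Proof.
move=> mh; apply: msrM; first exact: msr_sgnf.
by apply: msrD; [apply: msr_powR; exact: msr_id|exact: msr_cst].
Qed.

Lemma locint_powR_add1 (s c d : R) : locint (fun x => c * x `^ s + d).
Proof.
apply: locint_continuous => x x0.
apply: differentiable_continuous; apply/derivable1_diffP.
have h : is_derive x 1 (fun t : R => t `^ s) (s * x `^ (s - 1)) by exact: is_derive1_powR.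
suff [? _] : is_derive x 1 (fun x => c * x `^ s + d) (c * (s * x `^ (s - 1))) by [].
by apply: is_derive_eq; rewrite /GRing.scale/=; ring.
Qed.

Lemma locintZ c (u : R -> R) : locint u -> locint (fun x => c * u x).
Proof. by move=> lu p q p0; exact: (integrableZl _ c (lu p q p0)). Qed.

Lemma locintB (u v : R -> R) : locint u -> locint v -> locint (fun x => u x - v x).
Proof. by move=> lu lv p q p0; exact: (integrableB _ (lu p q p0) (lv p q p0)). Qed.

Lemma incrZ c (u : R -> R) y z : 0 < y -> locint u ->
  incr (fun x => c * u x) y z = c * incr u y z.
Proof. by move=> y0 lu; rewrite /incr RintegralZl//; exact: lu. Qed.

Lemma locint_sgn_fun a h : msr leb1 h -> locint (sgn_fun a h).
Proof.
move=> mh; apply: (@locint_le _ (sgn_fun a h) (fun x => 1 * x `^ (- 2 - a) + 1)).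
- by apply/leb1_msrE; exact: msr_sgn_fun.
- move=> x _; rewrite norm_sgn_fun mul1r ler_norm//.
- exact: locint_powR_add1.
Qed.

(** Here t >= x / 2, and halving the argument costs 2^(2+a) <= 8 because a <= 1. *)
Lemma sgn_weight_half a k x t : 0 <= a -> a <= 1 -> 0 < x -> 0 < k -> k <= 1 / 2 ->
  (1 - k) * x <= t -> sgn_weight a t <= 8 * x `^ (- 2 - a) + 1.
Proof.
move=> a0 a1 x0 k0 k1 xt; rewrite /sgn_weight lerD2r.
have x2 : 0 < 2^-1 * x by rewrite mulr_gt0.
apply: (@le_trans _ _ ((2^-1 * x) `^ (- 2 - a))).
  apply: powR_anti => //; last by lra.
  by apply: le_trans xt; rewrite ler_pM2r//; lra.
rewrite powRM ?invr_ge0 ?(ltW x0)//; apply: ler_wpM2r; first exact: powR_ge0.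
have -> : 2^-1 = 2 `^ (-1) :> R by rewrite powR_inv1.
rewrite -powRrM; have -> : 8 = 2 `^ 3%:R :> R by rewrite powR_mulrn//; ring.
by apply: ler_powR; [rewrite ler1n|lra].
Qed.

Lemma locint_sgn_test a h k : 0 <= a -> a <= 1 -> 0 < k -> k <= 1 / 2 ->
  msr leb1 h -> msr leb1 (sgn_test a h k) /\ locint (sgn_test a h k) /\
  forall x, 0 < x -> `|sgn_test a h k x| <= k^-1 * (9 * x `^ (- 2 - a) + 2).
Proof.
move=> a0 a1 k0 k1 mh; have mS := msr_sgn_fun a mh.
have mT : msr leb1 (sgn_test a h k).
  have mSk : msr leb1 (fun x => sgn_fun a h ((1 - k) * x)).
    move/leb1_msrE : mS => mS; apply/leb1_msrE.
    by apply: (measurableT_comp mS); exact: mulrl_measurable.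
  by rewrite /sgn_test; msr_tac.
have b x : 0 < x -> `|sgn_test a h k x| <= k^-1 * (9 * x `^ (- 2 - a) + 2).
  move=> x0; rewrite /sgn_test normrM ger0_norm ?invr_ge0 ?(ltW k0)//.
  rewrite ler_pM2l ?invr_gt0//; apply: (le_trans (ler_normB _ _)).
  rewrite normrM !norm_sgn_fun ger0_norm; last lra.
  have w1 := sgn_weight_half a0 a1 x0 k0 k1 (lexx _).
  have w0 := sgn_weight_ge0 a ((1 - k) * x).
  have w2 : sgn_weight a x = x `^ (- 2 - a) + 1 by [].
  have w3 : (1 - k) * sgn_weight a ((1 - k) * x) <= sgn_weight a ((1 - k) * x).
    by apply: ler_piMl => //; lra.
  rewrite w2; lra.
split=> //; split=> //.
apply: (@locint_le _ _ (fun x => (k^-1 * 9) * x `^ (- 2 - a) + k^-1 * 2)).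
- exact/leb1_msrE.
- move=> x x0; apply: (le_trans (b x x0)); rewrite mulrDr mulrA; exact: ler_norm.
- exact: locint_powR_add1.
Qed.

(** After rescaling, the integral over the dilated interval minus that over the original one leaves
    two short windows, one at each end; these are the averages. *)
Lemma incr_sgn_test a h k y z : 0 < k -> k <= 1 / 2 -> 0 < y -> 0 < z -> msr leb1 h ->
  incr (sgn_test a h k) y z = sgn_avg a h k y - sgn_avg a h k (y + z).
Proof.
move=> k0 k1 y0 z0 mh; have lS := @locint_sgn_fun a h mh.
have /leb1_msrE mS := msr_sgn_fun a mh.
have l0 : 0 < 1 - k by lra.
have E1 := incr_scale z l0 y0 mS lS.
set S := sgn_fun a h in lS mS E1 *.
have lSk : locint (fun x => S ((1 - k) * x)).
  apply: (@locint_le _ _ (fun x => (1 - k) `^ (- 2 - a) * x `^ (- 2 - a) + 1)).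
  - by apply: (measurableT_comp mS); exact: mulrl_measurable.
  - move=> x x0; rewrite norm_sgn_fun /sgn_weight powRM ?(ltW l0) ?(ltW x0)//.
    exact: ler_norm.
  - exact: locint_powR_add1.
have -> : incr (sgn_test a h k) y z =
    k^-1 * ((1 - k) * incr (fun x => S ((1 - k) * x)) y z - incr S y z).
  by rewrite -(incrZ _ _ y0 lSk) -(incrB _ y0 (locintZ _ lSk) lS) -(incrZ _ _ y0 (locintB (locintZ _ lSk) lS)).
rewrite E1 mulVKf ?gt_eqF//.
have ky : 0 < (1 - k) * y by rewrite mulr_gt0.
have e1 := @incr_split _ S _ (k * y) z lS ky (ltW (mulr_gt0 k0 y0)) (ltW z0).
have e2 := @incr_split _ S _ ((1 - k) * z) (k * (y + z)) lS ky (ltW (mulr_gt0 l0 z0)) (ltW (mulr_gt0 k0 (addr_gt0 y0 z0))).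
have q1 : (1 - k) * y + k * y = y by ring.
have q2 : (1 - k) * y + (1 - k) * z = (1 - k) * (y + z) by ring.
have q3 : (1 - k) * z + k * (y + z) = k * y + z by ring.
rewrite q1 in e1; rewrite q2 q3 e1 in e2.
have L (A B C D : R) : A + B = C + D -> C - B = A - D.
  by move=> e; rewrite -[C](addrK D) -e addrAC addrK.
by rewrite /sgn_avg -/S -mulrBr; congr (_ * _); exact: L.
Qed.

Lemma sgn_avg_le a h k x : 0 <= a -> a <= 1 -> 0 < k -> k <= 1 / 2 -> 0 < x -> msr leb1 h ->
  `|sgn_avg a h k x| <= (8 * x `^ (- 2 - a) + 1) * x.
Proof.
move=> a0 a1 k0 k1 x0 mh; have lS := @locint_sgn_fun a h mh.
have lx : 0 < (1 - k) * x by rewrite mulr_gt0//; lra.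
have kx : 0 < k * x by rewrite mulr_gt0.
have b t : (1 - k) * x < t -> `|sgn_fun a h t| <= 8 * x `^ (- 2 - a) + 1.
  by move=> xt; rewrite norm_sgn_fun; apply: (sgn_weight_half a0 a1 x0 k0 k1); exact: ltW.
have lc : locint (fun=> 0 : R) by apply: locint_continuous => t _; exact: cvg_cst.
have lN : locint (fun x => 0 - sgn_fun a h x).
  apply: locint_le lS; last by move=> t _; rewrite sub0r normrN.
  apply/leb1_msrE; apply: msrB; [exact: msr_cst|exact: msr_sgn_fun].
have h1 : incr (sgn_fun a h) ((1 - k) * x) (k * x) <= (8 * x `^ (- 2 - a) + 1) * (k * x).
  by apply: incr_le_sup => // t t1 _; apply: (le_trans (ler_norm _)); exact: b.
have h2 : incr (fun x => 0 - sgn_fun a h x) ((1 - k) * x) (k * x) <= (8 * x `^ (- 2 - a) + 1) * (k * x).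
  by apply: incr_le_sup => // t t1 _; rewrite sub0r; apply: (le_trans (ler_norm _)); rewrite normrN; exact: b.
have z0 : incr (fun=> 0 : R) ((1 - k) * x) (k * x) = 0.
  by rewrite /incr Rintegral_cst// mul0r.
rewrite (incrB _ lx lc lS) z0 sub0r in h2.
rewrite /sgn_avg normrM ger0_norm ?invr_ge0 ?(ltW k0)//.
rewrite mulrC ler_pdivrMr// ler_norml; apply/andP; split; lra.
Qed.

Lemma msr_sgn_avg a h k : msr leb1 h -> msr leb1 (sgn_avg a h k).
Proof.
move=> mh; have /leb1_msrE mS := msr_sgn_fun a mh.
have /leb2_msrE mI := measurable_incr mS.
apply: msrM; first exact: msr_cst.
apply/leb1_msrE.
apply: (measurableT_comp (f := fun p : R * R => incr (sgn_fun a h) p.1 p.2)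
  (g := fun x => ((1 - k) * x, k * x)) mI).
by apply: measurable_fun_pair; exact: mulrl_measurable.
Qed.

End SignTest.

(** * The two weights and bilinear integrability *)

Section WeightedPairs.
Context {R : realType}.
Variables (al a b B : R).
Hypotheses (al0 : 0 <= al) (a0 : 0 < a) (ab : b = a + al) (b1 : b < 1)
  (hB : 4 + al <= B).
Let ab_facts : [/\ 0 <= al, 0 < a, b = a + al, b < 1 & 4 + al <= B].
Proof. by []. Qed.
Implicit Types (eps s t : R) (K : R -> R -> R) (f g h : R -> R).

(** [rho] is the weight under which profiles have bounded moments, [tau] the one in which h is
    measured. Since [Lk] moves exponents by al, monomials with exponents in [-a, 4] land in [-b, B];
    this dictates b = a + al and B >= 4 + al. *)
Definition rho (x : R) : R := x `^ (- b) + x `^ B.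
Definition tau (x : R) : R := x `^ (- a) + x `^ 2%:R.

Lemma rho_ge0 x : 0 <= rho x. Proof. by rewrite addr_ge0 ?powR_ge0. Qed.
Lemma tau_ge0 x : 0 <= tau x. Proof. by rewrite addr_ge0 ?powR_ge0. Qed.

Lemma powR_le_rho (x s : R) : 0 < x -> - b <= s -> s <= B -> x `^ s <= rho x.
Proof. by move=> x0 s1 s2; exact: powR_le_add. Qed.

Lemma powR_le_tau (x s : R) : 0 < x -> - a <= s -> s <= 2%:R -> x `^ s <= tau x.
Proof. by move=> x0 s1 s2; exact: powR_le_add. Qed.

Record tame f : Prop := Tame {
  tm_msr : msr leb1 f;
  tm_supp : forall x, x <= 0 -> f x = 0;
  tm_itg : itg leb1 (fun x => rho x * `|f x|) }.

Lemma tame_pow f s : tame f -> - b <= s -> s <= B ->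
  itg leb1 (fun x => x `^ s * `|f x|).
Proof.
move=> hf s1 s2; apply: itg_le (tm_itg hf).
  by have mf := tm_msr hf; msr_tac.
move=> x; have [x0|x0] := leP x 0; first by rewrite (tm_supp hf)// normr0 !mulr0 normr0.
rewrite normrM normr_id (ger0_norm (powR_ge0 _ _)) ler_wpM2r//.
exact: powR_le_rho.
Qed.

Lemma tame_comb f g c d : tame f -> tame g -> tame (fun x => c * f x + d * g x).
Proof.
move=> hf hg; have mf := tm_msr hf; have mg := tm_msr hg; split.
- by msr_tac.
- by move=> x x0; rewrite (tm_supp hf)// (tm_supp hg)// !mulr0 addr0.
- apply: itg_le (itgD (itgZ `|c| (tm_itg hf)) (itgZ `|d| (tm_itg hg))).
    by rewrite /rho; msr_tac.
  move=> x; rewrite normrM normr_id (ger0_norm (rho_ge0 x)).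
  have -> : `|c| * (rho x * `|f x|) + `|d| * (rho x * `|g x|) =
    rho x * (`|c * f x| + `|d * g x|) by rewrite !normrM; ring.
  by rewrite ler_wpM2l ?rho_ge0// ler_normD.
Qed.

Lemma tame_norm f : tame f -> tame (fun x => `|f x|).
Proof.
move=> hf; split; first by apply: msr_norm; exact: tm_msr hf.
  by move=> x x0; rewrite (tm_supp hf)// normr0.
by apply: itg_eq (tm_itg hf) _ => x; rewrite normr_id.
Qed.

Lemma tameB f g : tame f -> tame g -> tame (fun x => f x - g x).
Proof.
move=> hf hg; have := tame_comb 1 (-1) hf hg.
by congr tame; apply/funext => x; ring.
Qed.

Lemma tame_avg f g : tame f -> tame g -> tame (fun x => (f x + g x) / 2).
Proof.
move=> hf hg; have := tame_comb (1 / 2) (1 / 2) hf hg.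
by congr tame; apply/funext => x; field.
Qed.

(** Collects, with one threshold for eps, the negative moment, a high moment and the lower bound on
    the number of particles that coercivity needs. *)
Lemma profile_tame : exists C, exists2 eps1, 0 < eps1 & forall eps K f,
  kernel al eps K -> eps <= 1 -> eps <= eps1 -> profile K f ->
  [/\ tame f, Itg leb1 (fun x => rho x * `|f x|) <= C &
      1 + b + (1 - b) / 2 <= (2 - eps) * Itg leb1 f].
Proof.
have [? ? ? ? ?] := ab_facts; have al1 : al < 1 by lra.
have b0 : 0 <= b by rewrite ab addr_ge0// ltW.
have B0 : 0 <= B by lra.
have [C1 [eps1 e10 H1]] := negative_moment al0 al1 b0 b1.
have [C2 H2] := moments al0 al1 B0.
exists (C1 + C2), eps1 => // eps K f hK e1 ee hf.
have [i1 c1 big] := H1 _ _ _ hK e1 ee hf; have [i2 c2] := H2 _ _ _ hK e1 hf.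
have h x : x `^ (- b) * f x + x `^ B * f x = rho x * `|f x|.
  by rewrite (ger0_norm (pr_ge0 hf x)) -mulrDl.
have [i3 E3] := ItgD_eq i1 i2 h.
split => //; last by rewrite E3 lerD.
by split => //; [exact: profile_msr hf|exact: pr_supp hf].
Qed.

Lemma Lk_monomial (y z s t : R) : 0 < y -> 0 < z ->
  Lk al y z * (y `^ s * z `^ t) =
  y `^ (s + al) * z `^ (t - al) + y `^ (s - al) * z `^ (t + al).
Proof. by move=> y0 z0; rewrite LkE// !powRDp//; ring. Qed.

Lemma Lk_monomial_le (y z s t : R) : 0 < y -> 0 < z ->
  - a <= s -> s <= 4 -> - a <= t -> t <= 4 ->
  Lk al y z * (y `^ s * z `^ t) <= 2 * (rho y * rho z).
Proof.
move=> y0 z0 s1 s2 t1 t2; have [? ? ? ? ?] := ab_facts; rewrite Lk_monomial//.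
have h u v : - b <= u -> u <= B -> - b <= v -> v <= B ->
    y `^ u * z `^ v <= rho y * rho z.
  by move=> *; apply: ler_pM; rewrite ?powR_ge0//; exact: powR_le_rho.
have : y `^ (s + al) * z `^ (t - al) <= rho y * rho z by apply: h; lra.
have : y `^ (s - al) * z `^ (t + al) <= rho y * rho z by apply: h; lra.
lra.
Qed.

Lemma itg_flux_rho eps K f g (k : R * R -> R) C : kernel al eps K -> eps <= 1 ->
  tame f -> tame g -> msr leb2 k ->
  (forall y z, 0 < y -> 0 < z -> Lk al y z * `|k (y, z)| <= C * (rho y * rho z)) ->
  itg leb2 (fun p => flux K f g p * k p).
Proof.
move=> hK e1 hf hg mk hk.
apply: (itg_bilin (C := 2 * C) _ _ (tm_itg hf) (tm_itg hg)).
  by apply: (msr_flux hK) => //; [exact: tm_msr hf|exact: tm_msr hg].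
move=> [y z] /=; rewrite /flux /=.
have [y0|y0] := leP y 0; first by rewrite (tm_supp hf)// !(normr0, mulr0, mul0r).
have [z0|z0] := leP z 0; first by rewrite (tm_supp hg)// !(normr0, mulr0, mul0r).
rewrite !normrM (ger0_norm (kernel_ge0 hK e1 y0 z0)).
have -> : K y z * `|f y| * `|g z| * `|k (y, z)| =
  (K y z * `|k (y, z)|) * (`|f y| * `|g z|) by ring.
have -> : 2 * C * (rho y * `|f y| * (rho z * `|g z|)) =
  (2 * (C * (rho y * rho z))) * (`|f y| * `|g z|) by ring.
rewrite ler_wpM2r//.
apply: (@le_trans _ _ (2 * (Lk al y z * `|k (y, z)|))).
  by rewrite mulrA ler_wpM2r//; exact: kernel_le2L hK e1 y0 z0.
by rewrite ler_pM2l//; exact: hk.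
Qed.

End WeightedPairs.

(** * The inequality produced by the sign test *)

Section SignTestInequality.
Context {R : realType}.
Variables (al a b B : R).
Hypotheses (al0 : 0 <= al) (a0 : 0 < a) (a1 : a <= 1) (ab : b = a + al) (b1 : b < 1)
  (hB : 4 + al <= B).
Let facts : [/\ 0 <= al, 0 < a, b = a + al, b < 1 & 4 + al <= B].
Proof. by []. Qed.

Local Notation rho := (rho b B).
Local Notation tau := (tau a).
Local Notation tame := (tame b B).

Let exponents : [/\ - a <= 0, - a <= 1, - a <= 2 & - a <= 4] /\
  [/\ 0 <= 4 :> R, 1 <= 4 :> R & 2 <= 4 :> R].
Proof. by have [? ? ? ? ?] := facts; do !split; lra. Qed.

(** The polynomial dominates every increment that occurs below; each monomial costs 2, and 2 (16 + 2
    + 2 + 2 + 8) = 60. *)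
Lemma Lk_poly_le (y z : R) : 0 < y -> 0 < z ->
  Lk al y z * (16 * y `^ (- a) + 2 * y `^ 2%:R + 2 * (y * z) + 2 * z `^ 2%:R + 8 * z `^ (- a))
  <= 60 * (rho y * rho z).
Proof.
move=> y0 z0; have H := Lk_monomial_le al0 a0 ab b1 hB y0 z0.
have [[? ? ? ?] [? ? ?]] := exponents.
have r0 := powRr0 y; have r1 := powRr0 z.
have H1 : Lk al y z * (y `^ (- a) * z `^ 0) <= 2 * (rho y * rho z) by apply: H.
have H2 : Lk al y z * (y `^ 2%:R * z `^ 0) <= 2 * (rho y * rho z) by apply: H.
have H3 : Lk al y z * (y `^ 1 * z `^ 1) <= 2 * (rho y * rho z) by apply: H.
have H4 : Lk al y z * (y `^ 0 * z `^ 2%:R) <= 2 * (rho y * rho z) by apply: H.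
have H5 : Lk al y z * (y `^ 0 * z `^ (- a)) <= 2 * (rho y * rho z) by apply: H.
rewrite r1 mulr1 in H1; rewrite r1 mulr1 in H2; rewrite r0 mul1r in H4.
rewrite r0 mul1r in H5; rewrite (powRr1 (ltW y0)) (powRr1 (ltW z0)) in H3.
set L := Lk al y z in H1 H2 H3 H4 H5 *; set r := rho y * rho z in H1 H2 H3 H4 H5 *.
move: H1 H2 H3 H4 H5.
move: (y `^ _) (y `^ _) (z `^ _) (z `^ _) (y * z) => A1 A2 A3 A4 A5 H1 H2 H3 H4 H5.
by clear -H1 H2 H3 H4 H5; lra.
Qed.

Lemma sgn_avg_mul_le (h : R -> R) (k x : R) : 0 < k -> k <= 1 / 2 -> 0 < x -> msr leb1 h ->
  `|x * sgn_avg a h k x| <= 8 * x `^ (- a) + x `^ 2%:R.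
Proof.
move=> k0 k1 x0 mh; rewrite normrM (gtr0_norm x0).
apply: (@le_trans _ _ (x * ((8 * x `^ (- 2 - a) + 1) * x))).
  by rewrite ler_pM2l//; apply: sgn_avg_le => //; exact: ltW.
have -> : x `^ (- a) = x `^ (- 2 - a) * x `^ 2%:R.
  by rewrite -powRDp//; congr (_ `^ _); ring.
rewrite (powR_mulrn 2 (ltW x0)) le_eqVlt; apply/orP; left; apply/eqP; ring.
Qed.

Lemma sgn_test_harmonic (n : nat) : 0 < (n.+2%:R^-1 : R) <= 1 / 2.
Proof.
rewrite invr_gt0 ltr0n /= mul1r lef_pV2 ?posrE ?ltr0n//.
by rewrite ler_nat.
Qed.

Lemma cvg_harmonic2 : (fun n => (n.+2%:R^-1 : R)) @ \oo --> 0.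
Proof. by have := @cvg_harmonic R; rewrite -(cvg_shiftS (@harmonic R)). Qed.

Lemma cvg_slope_powR (s : R) :
  (fun n => ((1 - n.+2%:R^-1) `^ s - 1) / n.+2%:R^-1) @ \oo --> - s.
Proof.
have h : is_derive (1 : R) (1 : R) (fun t : R => t `^ s) (s * 1 `^ (s - 1)).
  by apply: is_derive1_powR.
have [dF EF] := h; rewrite powR1 mulr1 in EF.
have dq : (fun t : R => t^-1 *: ((t *: 1 + 1) `^ s - 1 `^ s)) t @[t --> 0^'] --> s.
  by rewrite -[X in _ --> X]EF; exact: dF.
have /cvgr_dnbhsP /(_ (fun n => - (n.+2%:R^-1 : R))) := dq => /(_ _) c.
have {c}c : (fun n => (- (n.+2%:R^-1 : R))^-1 *: ((- (n.+2%:R^-1 : R) *: 1 + 1) `^ s - 1 `^ s)) @ \oo --> s.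
  apply: c; split; first by move=> n; rewrite oppr_eq0 invr_eq0 pnatr_eq0.
  by rewrite -[X in _ --> X]oppr0; apply: cvgN; exact: cvg_harmonic2.
have -> : (fun n => ((1 - n.+2%:R^-1) `^ s - 1) / n.+2%:R^-1) =
  (fun n => - ((- (n.+2%:R^-1 : R))^-1 *: ((- (n.+2%:R^-1 : R) *: 1 + 1) `^ s - 1 `^ s))).
  apply/funext => n; rewrite /GRing.scale/= mulr1 powR1 [- _ + 1]addrC.
  have : (n.+2%:R : R) != 0 by rewrite pnatr_eq0.
  set N := n.+2%:R; set P := _ `^ _ => N0.
  by field.
exact: cvgN.
Qed.

(** The dilated sign may disagree with that of h(x), but h(x) times it is at most |h(x)|, whereas
    the undilated term is exactly -|h(x)|. The mismatch goes in the favourable direction, so nothing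
    is asked of the sign changes of h. The coefficient of x^(-a) tends to 1 + a. *)
Lemma sgn_test_lhs_le (h : R -> R) (k x : R) : 0 < k -> k <= 1 / 2 -> 0 < x ->
  x ^+ 2 * h x * sgn_test a h k x <=
  ((1 - k) `^ (- 1 - a) - 1) / k * (x `^ (- a) * `|h x|) - x `^ 2%:R * `|h x|.
Proof.
move=> k0 k1 x0; have l0 : 0 < 1 - k by lra.
rewrite /sgn_test /sgn_fun.
have -> : x ^+ 2 * h x * (k^-1 * ((1 - k) * (sgnf h ((1 - k) * x) * sgn_weight a ((1 - k) * x)) -
   sgnf h x * sgn_weight a x)) =
   k^-1 * (x ^+ 2 * ((1 - k) * sgn_weight a ((1 - k) * x) * (h x * sgnf h ((1 - k) * x)) -
    sgn_weight a x * (h x * sgnf h x))) by ring.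
rewrite sgnfM.
have hs : h x * sgnf h ((1 - k) * x) <= `|h x|.
  by apply: (le_trans (ler_norm _)); rewrite normrM norm_sgnf mulr1.
have w0 : 0 <= (1 - k) * sgn_weight a ((1 - k) * x).
  by rewrite mulr_ge0 ?sgn_weight_ge0// ltW.
have -> : ((1 - k) `^ (- 1 - a) - 1) / k * (x `^ (- a) * `|h x|) - x `^ 2%:R * `|h x| =
  k^-1 * (x ^+ 2 * ((1 - k) * sgn_weight a ((1 - k) * x) * `|h x| - sgn_weight a x * `|h x|)).
  rewrite /sgn_weight powRM ?(ltW l0) ?(ltW x0)//.
  have -> : (1 - k) `^ (- 1 - a) = (1 - k) * (1 - k) `^ (- 2 - a).
    by rewrite powR_addx//; congr (_ `^ _); ring.
  have -> : x `^ (- a) = x `^ (- 2 - a) * x `^ 2%:R.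
    by rewrite -powRDp//; congr (_ `^ _); ring.
  rewrite (powR_mulrn 2 (ltW x0)); set p := (1 - k) `^ _; set q := x `^ _.
  by field; rewrite gt_eqF.
rewrite ler_pM2l ?invr_gt0// ler_pM2l ?exprn_gt0// lerD2r.
exact: ler_wpM2l.
Qed.

Lemma normr_flux eps K (f h : R -> R) (p : R * R) : kernel al eps K -> eps <= 1 ->
  (forall x, x <= 0 -> f x = 0) -> (forall x, 0 <= f x) -> (forall x, x <= 0 -> h x = 0) ->
  `|flux K f h p| = flux K f (fun x => `|h x|) p.
Proof.
move=> hK e1 f0 fge h0; rewrite /flux.
have [p1|p1] := leP p.1 0; first by rewrite f0// !(mulr0, mul0r) normr0.
have [p2|p2] := leP p.2 0; first by rewrite h0// normr0 !mulr0 normr0.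
rewrite normrM ger0_norm// mulr_ge0//; exact: kernel_ge0 hK e1 p1 p2.
Qed.

Variables (eps : R) (K : R -> R -> R) (f1 f2 : R -> R).
Hypotheses (hK : kernel al eps K) (e1 : eps <= 1) (hf1 : profile K f1) (hf2 : profile K f2)
  (tf1 : tame f1) (tf2 : tame f2).

Let h (x : R) : R := f1 x - f2 x.
Let fb (x : R) : R := (f1 x + f2 x) / 2.
Let ha (x : R) : R := `|h x|.
(** Bounds the terms without a usable sign: the loss at y, at most 8 y^(-a) + y^2, and the gain at y
    + z, at most 8 y^(-a) + (y + z)^2. *)
Let D (p : R * R) : R :=
  16 * p.1 `^ (- a) + 2 * p.1 `^ 2%:R + 2 * (p.1 * p.2) + p.2 `^ 2%:R.

Let mh : msr leb1 h. Proof. exact: msrB (tm_msr tf1) (tm_msr tf2). Qed.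
Let th : tame h. Proof. exact: tameB tf1 tf2. Qed.
Let tha : tame ha. Proof. exact: tame_norm th. Qed.
Let tfb : tame fb. Proof. exact: tame_avg tf1 tf2. Qed.
Let fb_ge0 x : 0 <= fb x.
Proof. by rewrite divr_ge0// addr_ge0 ?(pr_ge0 hf1) ?(pr_ge0 hf2). Qed.
Let nflux p : `|flux K fb h p| = flux K fb ha p.
Proof. exact: normr_flux hK e1 (tm_supp tfb) fb_ge0 (tm_supp th). Qed.

Lemma sincr_sgn_test (k : R) (p : R * R) : 0 < k -> k <= 1 / 2 -> 0 < p.1 -> 0 < p.2 ->
  sincr (sgn_test a h k) p = p.1 * sgn_avg a h k p.1 + p.2 * sgn_avg a h k p.2 -
    (p.1 + p.2) * sgn_avg a h k (p.1 + p.2).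
Proof.
move=> k0 k1 p1 p2; rewrite /sincr !incr_sgn_test// [p.2 + p.1]addrC; ring.
Qed.

Lemma sincr_sgn_test_err (k : R) (p : R * R) : 0 < k -> k <= 1 / 2 -> 0 < p.1 -> 0 < p.2 ->
  `|sincr (sgn_test a h k) p - p.2 * sgn_avg a h k p.2| <= D p.
Proof.
move=> k0 k1 p1 p2; rewrite sincr_sgn_test//.
have p12 : 0 < p.1 + p.2 by exact: addr_gt0.
have b1' := sgn_avg_mul_le k0 k1 p1 mh.
have b2' := sgn_avg_mul_le k0 k1 p12 mh.
have an : (p.1 + p.2) `^ (- a) <= p.1 `^ (- a).
  by apply: powR_anti; rewrite ?lerDl ?oppr_le0 ?ltW.
have sq : (p.1 + p.2) `^ 2%:R = p.1 `^ 2%:R + 2 * (p.1 * p.2) + p.2 `^ 2%:R.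
  rewrite (powR_mulrn 2 (ltW p12)) (powR_mulrn 2 (ltW p1)) (powR_mulrn 2 (ltW p2)); ring.
rewrite sq in b2'.
have -> : p.1 * sgn_avg a h k p.1 + p.2 * sgn_avg a h k p.2 -
    (p.1 + p.2) * sgn_avg a h k (p.1 + p.2) - p.2 * sgn_avg a h k p.2 =
    p.1 * sgn_avg a h k p.1 - (p.1 + p.2) * sgn_avg a h k (p.1 + p.2) by ring.
apply: (le_trans (ler_normB _ _)); apply: (le_trans (lerD b1' b2')).
rewrite /D; move: an.
move: (p.1 `^ _) (p.1 `^ _) (p.2 `^ _) (_ `^ _) (p.1 * p.2) => A1 A2 A3 A4 A5 *; lra.
Qed.

Lemma itg_flux_bound (g k : R * R -> R) : (forall p, `|g p| <= `|flux K fb h p|) ->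
  msr leb2 g -> msr leb2 k ->
  (forall y z, 0 < y -> 0 < z -> `|k (y, z)| <=
    16 * y `^ (- a) + 2 * y `^ 2%:R + 2 * (y * z) + 2 * z `^ 2%:R + 8 * z `^ (- a)) ->
  itg leb2 (fun p => g p * k p).
Proof.
move=> hg mg mk hk.
have i1 : itg leb2 (fun p => flux K fb ha p * `|k p|).
  apply: (itg_flux_rho (C := 60) (k := fun p => `|k p|) hK e1 tfb tha (msr_norm mk)).
  move=> y z y0 z0; rewrite normr_id.
  apply: le_trans (Lk_poly_le y0 z0); apply: ler_wpM2l; last exact: hk.
  by have := Lk_ge2 al y0 z0; apply: le_trans.
apply: itg_le i1; first exact: msrM.
by move=> p; rewrite normrM ler_wpM2r// -nflux.
Qed.

(** Only the loss at z keeps the sign of h(z), the argument of h in the flux; the other two terms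
    are estimated in absolute value by [D]. *)
Lemma sign_test_step (k : R) : 0 < k -> k <= 1 / 2 ->
  [/\ itg leb2 (fun p => flux K fb h p * (p.2 * sgn_avg a h k p.2)),
      itg leb2 (fun p => flux K fb ha p * D p) &
  Itg leb2 (fun p => flux K fb h p * (p.2 * sgn_avg a h k p.2)) -
  Itg leb2 (fun p => flux K fb ha p * D p) <=
  ((1 - k) `^ (- 1 - a) - 1) / k * absmom (- a) h - absmom 2%:R h].
Proof.
move=> k0 k1; have [mpsi [lpsi psib]] := locint_sgn_test (ltW a0) a1 k0 k1 mh.
have mF : msr leb2 (flux K fb h).
  by apply: msr_eq (msr_flux hK (tm_msr tfb) mh (msr_cst leb2 1)) _ => p; rewrite mulr1.
have mFa : msr leb2 (flux K fb ha).
  by apply: msr_eq (msr_flux hK (tm_msr tfb) (tm_msr tha) (msr_cst leb2 1)) _ => p; rewrite mulr1.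
have mP := msr_snd (msr_sgn_avg a k mh).
have p0 (x s : R) : 0 <= x `^ s := powR_ge0 x s.
have iT : itg leb2 (fun p => flux K fb h p * (p.2 * sgn_avg a h k p.2)).
  apply: (itg_flux_bound (k := fun p => p.2 * sgn_avg a h k p.2)) => //.
    by apply: msrM => //; exact: msr_p2.
  move=> y z y0 z0 /=; apply: (le_trans (sgn_avg_mul_le k0 k1 z0 mh)).
  have yz : 0 <= y * z by apply: mulr_ge0; exact: ltW.
  move: (p0 y (- a)) (p0 y 2%:R) (p0 z 2%:R) (p0 z (- a)) yz.
  move: (y `^ _) (y `^ _) (z `^ _) (z `^ _) (y * z) => A1 A2 A3 A4 A5 *; lra.
have mD : msr leb2 D by rewrite /D; msr_tac.
have iD : itg leb2 (fun p => flux K fb ha p * D p).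
  apply: itg_flux_bound => //.
    by move=> p; rewrite -nflux normr_id.
  move=> y z y0 z0; rewrite /D /=.
  have yz : 0 <= y * z by apply: mulr_ge0; exact: ltW.
  move: (p0 y (- a)) (p0 y 2%:R) (p0 z 2%:R) (p0 z (- a)) yz.
  move: (y `^ _) (y `^ _) (z `^ _) (z `^ _) (y * z) => A1 A2 A3 A4 A5 *.
  rewrite ger0_norm; lra.
have iS : itg leb2 (fun p => flux K fb h p * sincr (sgn_test a h k) p).
  apply: (itg_flux_bound (k := sincr (sgn_test a h k))) => //.
    have /leb1_msrE m1 := mpsi; have m2 := measurable_incr m1; have m3 := msr_swap m2.
    by rewrite /sincr; apply: msrD; [apply: msrM => //; exact: msr_p1|apply: msrM; [exact: msr_p2|exact: m3]].
  move=> y z y0 z0.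
  have e := @sincr_sgn_test_err k (y, z) k0 k1 y0 z0.
  have e2 := sgn_avg_mul_le k0 k1 z0 mh.
  have -> : sincr (sgn_test a h k) (y, z) = (sincr (sgn_test a h k) (y, z) - z * sgn_avg a h k z) + z * sgn_avg a h k z by ring.
  apply: (le_trans (ler_normD _ _)); apply: (le_trans (lerD e e2)).
  rewrite /D /=.
  move: (y `^ _) (y `^ _) (z `^ _) (z `^ _) (y * z) => A1 A2 A3 A4 A5 *; lra.
split => //.
have tm s : - b <= s -> s <= B -> itg leb1 (fun x => x `^ s * `|h x|).
  by move=> *; exact: tame_pow th _ _.
have [? ? ? ? ?] := facts.
have iX : itg leb1 (fun x => x `^ (- a) * `|h x|) by apply: tm; lra.
have iX2 : itg leb1 (fun x => x `^ 2%:R * `|h x|) by apply: tm; lra.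
have ix2 f : tame f -> itg leb1 (fun x => x ^+ 2 * f x * sgn_test a h k x).
  move=> tf.
  have j1 : itg leb1 (fun x => x `^ (- a) * `|f x|) by apply: (tame_pow tf); lra.
  have j2 : itg leb1 (fun x => x `^ 2%:R * `|f x|) by apply: (tame_pow tf); lra.
  apply: itg_le (itgD (itgZ (k^-1 * 9) j1) (itgZ (k^-1 * 2) j2)).
    by have mf := tm_msr tf; msr_tac.
  move=> x; have [x0|x0] := leP x 0; first by rewrite (tm_supp tf x0) !(mulr0, mul0r) normr0 !(mulr0, mul0r) addr0.
  rewrite normrM [X in X * _]normrM (ger0_norm (sqr_ge0 x)) mulrAC.
  have -> : k^-1 * 9 * (x `^ (- a) * `|f x|) + k^-1 * 2 * (x `^ 2%:R * `|f x|) =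
    (x ^+ 2 * (k^-1 * (9 * x `^ (- 2 - a) + 2))) * `|f x|.
    have -> : x `^ (- a) = x `^ (- 2 - a) * x `^ 2%:R.
      by rewrite -powRDp//; congr (_ `^ _); ring.
    rewrite (powR_mulrn 2 (ltW x0)); ring.
  by rewrite ler_wpM2r// ler_wpM2l ?sqr_ge0// psib.
have E := weak_diff hK e1 hf1 hf2 mpsi lpsi (ix2 _ tf1) (ix2 _ tf2) iS.
have [iR ER] := ItgB_eq (itgZ (((1 - k) `^ (- 1 - a) - 1) / k) iX) iX2 (fun=> erefl).
rewrite (ItgZ _ iX) in ER.
have -> : ((1 - k) `^ (- 1 - a) - 1) / k * absmom (- a) h - absmom 2%:R h =
  Itg leb1 (fun x => ((1 - k) `^ (- 1 - a) - 1) / k * (x `^ (- a) * `|h x|) - x `^ 2%:R * `|h x|).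
  by rewrite ER.
have ih : itg leb1 (fun x => x ^+ 2 * h x * sgn_test a h k x).
  by apply: itg_eq (itgB (ix2 _ tf1) (ix2 _ tf2)) _ => x; rewrite /h; ring.
apply: (@le_trans _ _ (Itg leb1 (fun x => x ^+ 2 * h x * sgn_test a h k x))); last first.
  apply: Itg_le => // x; have [x0|x0] := leP x 0.
    by rewrite (tm_supp th x0) normr0 !(mulr0, mul0r) subr0.
  exact: sgn_test_lhs_le.
rewrite E; have [iTD ETD] := ItgB_eq iT iD (fun=> erefl).
rewrite -ETD; apply: Itg_le => // p.
have [p1|p1] := leP p.1 0.
  by rewrite !(flux0 _ (tm_supp tfb) (tm_supp th)) ?p1// !(flux0 _ (tm_supp tfb) (tm_supp tha)) ?p1// !mul0r subr0.
have [p2|p2] := leP p.2 0.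
  by rewrite !(flux0 _ (tm_supp tfb) (tm_supp th)) ?p2 ?orbT// !(flux0 _ (tm_supp tfb) (tm_supp tha)) ?p2 ?orbT// !mul0r subr0.
have e := sincr_sgn_test_err k0 k1 p1 p2.
rewrite lerBlDr -lerBlDl -mulrBr -nflux; apply: (le_trans (ler_norm _)).
by rewrite normrM; apply: ler_wpM2l => //; rewrite distrC.
Qed.

(** The limit k -> 0 of [sign_test_step]: dominated convergence on the left, the derivative of a
    power at 1 on the right. *)
Lemma sign_test_limit :
  [/\ itg leb2 (fun p => flux K fb ha p * tau p.2),
      itg leb2 (fun p => flux K fb ha p * D p) &
  Itg leb2 (fun p => flux K fb ha p * tau p.2) - Itg leb2 (fun p => flux K fb ha p * D p) <=
  (1 + a) * absmom (- a) h - absmom 2%:R h].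
Proof.
(* The offset 2 keeps k <= 1/2 from n = 0 on. *)
pose k n : R := n.+2%:R^-1.
have k0 n : 0 < k n by have /andP[] := sgn_test_harmonic n.
have k1 n : k n <= 1 / 2 by have /andP[] := sgn_test_harmonic n.
have S n := sign_test_step (k0 n) (k1 n).
have p0 (x s : R) : 0 <= x `^ s := powR_ge0 x s.
have mF : msr leb2 (flux K fb h).
  by apply: msr_eq (msr_flux hK (tm_msr tfb) mh (msr_cst leb2 1)) _ => p; rewrite mulr1.
have mFa : msr leb2 (flux K fb ha).
  by apply: msr_eq (msr_flux hK (tm_msr tfb) (tm_msr tha) (msr_cst leb2 1)) _ => p; rewrite mulr1.
have iG : itg leb2 (fun p => flux K fb ha p * (8 * p.2 `^ (- a) + p.2 `^ 2%:R)).
  apply: itg_flux_bound => //; [by move=> p; rewrite -nflux normr_id|by msr_tac|].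
  move=> y z y0 z0 /=; have yz : 0 <= y * z by apply: mulr_ge0; exact: ltW.
  move: (p0 y (- a)) (p0 y 2%:R) (p0 z 2%:R) (p0 z (- a)) yz.
  move: (y `^ _) (y `^ _) (z `^ _) (z `^ _) (y * z) => A1 A2 A3 A4 A5 *.
  rewrite ger0_norm; lra.
have [_ iD _] := S 0.
have [iT cT] : itg leb2 (fun p => flux K fb ha p * tau p.2) /\
  (fun n => Itg leb2 (fun p => flux K fb h p * (p.2 * sgn_avg a h (k n) p.2))) @ \oo -->
  Itg leb2 (fun p => flux K fb ha p * tau p.2).
  apply: (@Itg_dct _ _ leb2 (fun n p => flux K fb h p * (p.2 * sgn_avg a h (k n) p.2)) _ _ _ _ _ iG).
  - by move=> n; have [i1 _ _] := S n; exact: itg_msr i1.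
  - by apply: msrM => //; rewrite /tau; msr_tac.
  - move=> n p; rewrite normrM nflux.
    have [p2|p2] := leP p.2 0.
      by rewrite !(flux0 _ (tm_supp tfb) (tm_supp tha)) ?p2 ?orbT// !mul0r.
    apply: ler_wpM2l; first by rewrite -nflux.
    exact: sgn_avg_mul_le.
  (* At a Lebesgue point z the average tends to z times the weighted sign, and h(z) turns z^2 times
     the weighted sign into |h(z)| tau(z). *)
  - have /leb1_msrE mS := msr_sgn_fun a mh.
    have L := aev_snd (locint_lebesgue_pt mS (locint_sgn_fun a mh)).
    apply: aevS L => p Lp.
    have [p1|p1] := leP p.1 0.
      rewrite (flux0 _ (tm_supp tfb) (tm_supp tha)) ?p1// mul0r.
      by under eq_fun do rewrite (flux0 _ (tm_supp tfb) (tm_supp th)) ?p1// mul0r; exact: cvg_cst.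
    have [p2|p2] := leP p.2 0.
      rewrite (flux0 _ (tm_supp tfb) (tm_supp tha)) ?p2 ?orbT// mul0r.
      by under eq_fun do rewrite (flux0 _ (tm_supp tfb) (tm_supp th)) ?p2 ?orbT// mul0r; exact: cvg_cst.
    have c := cvg_incr_average p2 (locint_sgn_fun a mh) Lp sgn_test_harmonic cvg_harmonic2.
    have -> : flux K fb ha p * tau p.2 = flux K fb h p * (p.2 * (p.2 * sgn_fun a h p.2)).
      rewrite /flux /ha -sgnfM /sgn_fun /sgn_weight /tau.
      have -> : p.2 `^ (- a) = p.2 `^ (- 2 - a) * p.2 `^ 2%:R.
        by rewrite -powRDp//; congr (_ `^ _); ring.
      by rewrite (powR_mulrn 2 (ltW p2)); ring.
    apply: cvgM; first exact: cvg_cst.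
    by apply: cvgM; [exact: cvg_cst|exact: c].
split => //.
have cs : (fun n => ((1 - k n) `^ (- 1 - a) - 1) / k n * absmom (- a) h - absmom 2%:R h) @ \oo -->
   (1 + a) * absmom (- a) h - absmom 2%:R h.
  apply: cvgB; last exact: cvg_cst.
  apply: cvgM; last exact: cvg_cst.
  have -> : 1 + a = - (- 1 - a) by ring.
  exact: cvg_slope_powR.
have cl : (fun n => Itg leb2 (fun p => flux K fb h p * (p.2 * sgn_avg a h (k n) p.2)) -
    Itg leb2 (fun p => flux K fb ha p * D p)) @ \oo -->
  Itg leb2 (fun p => flux K fb ha p * tau p.2) - Itg leb2 (fun p => flux K fb ha p * D p).
  by apply: cvgB => //; exact: cvg_cst.
apply: (ler_cvg_to cl cs); apply: nearW => n; by have [] := S n.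
Qed.

End SignTestInequality.

(** * Coercivity: the loss terms dominate *)

Section Coercivity.
Context {R : realType}.
Variables (al a b B : R).
Hypotheses (al0 : 0 <= al) (a0 : 0 < a) (a1 : a <= 1) (ab : b = a + al) (b1 : b < 1)
  (hB : 4 + al <= B) (hB2 : 2 + al + 2 * (al / a) <= B).
Let facts : [/\ 0 <= al, 0 < a, a <= 1, b = a + al & b < 1] /\
  [/\ 4 + al <= B, 2 + al + 2 * (al / a) <= B & 0 <= al / a].
Proof. by split => //; split => //; rewrite divr_ge0// ltW. Qed.

Local Notation rho := (rho b B).
Local Notation tau := (tau a).
Local Notation tame := (tame b B).

(** What remains of the error once its z^2 has cancelled the z^2 of [tau]: the net weight is z^(-a)
    minus this. *)
Definition bad_weight (y z : R) : R := 16 * y `^ (- a) + 2 * y `^ 2%:R + 2 * (y * z).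

Lemma monomial_rho_tau (y z s t : R) : 0 < y -> 0 < z -> - b <= s -> s <= B ->
  - a <= t -> t <= 2%:R -> y `^ s * z `^ t <= rho y * tau z.
Proof.
move=> *; apply: ler_pM; rewrite ?powR_ge0//; first exact: powR_le_rho.
exact: powR_le_tau.
Qed.

Lemma bad_weight_small (y z : R) : 0 < y -> 0 < z -> z <= 1 ->
  z `^ (- a) < bad_weight y z ->
  z `^ (- al) <= 36 `^ (al / a) * y `^ (- al) \/
  z `^ (- al) <= 36 `^ (al / a) * y `^ (2 * (al / a)).
Proof.
move=> y0 z0 z1 h; have [[? ? ? ? ?] [? ? ?]] := facts.
have r0 : 0 <= al / a by rewrite divr_ge0// ltW.
have yy : y <= y `^ (- a) + y `^ 2%:R.
  by rewrite -{1}(powRr1 (ltW y0)); apply: powR_le_add => //; lra.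
have yz : y * z <= y by apply: ler_piMr => //; exact: ltW.
have zE : z `^ (- al) = (z `^ (- a)) `^ (al / a).
  by rewrite -powRrM; congr (_ `^ _); field; rewrite gt_eqF.
have h2 : z `^ (- a) <= 18 * (y `^ (- a) + y `^ 2%:R).
  apply: (le_trans (ltW h)); rewrite /bad_weight; have := powR_ge0 y 2%:R; lra.
have fin (v : R) : 0 < v -> z `^ (- a) <= v -> z `^ (- al) <= v `^ (al / a).
  by move=> v0 zv; rewrite zE; apply: powR_mono => //; rewrite powR_gt0.
case: (leP y 1) => y1; [left|right].
  have g : y `^ 2%:R <= y `^ (- a).
    by apply: ger_powR; [rewrite y0|lra].
  have : z `^ (- a) <= 36 * y `^ (- a) by lra.
  move=> /(fin _ _) => /(_ _)/le_trans; apply; first by rewrite mulr_gt0// powR_gt0.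
  rewrite powRM ?powR_ge0// -powRrM le_eqVlt; apply/orP; left; apply/eqP.
  by congr (_ * _ `^ _); field; rewrite gt_eqF.
have g : y `^ (- a) <= y `^ 2%:R.
  by apply: ler_powR; [exact: ltW|lra].
have : z `^ (- a) <= 36 * y `^ 2%:R by lra.
move=> /(fin _ _) => /(_ _)/le_trans; apply; first by rewrite mulr_gt0// powR_gt0.
by rewrite powRM ?powR_ge0// -powRrM.
Qed.

Let bad_sum (T u1 u2 u3 u4 d r : R) : T <= 18 * (1 + d) * r -> u1 <= r -> u2 <= r ->
  u3 <= r -> u4 <= r -> T + 16 * u1 + 2 * u2 + 2 * u3 + 2 * u4 <= (40 + 18 * d) * r.
Proof. by move=> *; lra. Qed.

Let exponents (e : R) : - al <= e -> e <= 2 * (al / a) ->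
  [/\ - b <= - a + (al + e), - a + (al + e) <= B, - b <= 2 + (al + e) & 2 + (al + e) <= B].
Proof. by have [[? ? ? ? ?] [? ? ?]] := facts; split; lra. Qed.

Let exponents_y :
  [/\ - b <= - a + al, - a + al <= B, - b <= 2 + al & 2 + al <= B] /\
  [/\ - b <= - a - al, - a - al <= B, - b <= 2 - al & 2 - al <= B] /\
  [/\ - b <= 1 - al, 1 - al <= B, - b <= 1 + al & 1 + al <= B].
Proof. by have [[? ? ? ? ?] [? ? ?]] := facts; do !split; lra. Qed.

Let exponents_z :
  [/\ - a <= 0, 0 <= 2 :> R, - a <= al, al <= 2 & - al <= 2 * (al / a)] /\
  [/\ - a <= 1 + al, 1 + al <= 2, - a <= 1 - al & 1 - al <= 2].
Proof. by have [[? ? ? ? ?] [? ? ?]] := facts; do !split; lra. Qed.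

(* Where the bad weight exceeds z^(-a), z is bounded below by a power of y (or z > 1),
   so the singular factor z^(-al) costs only a higher moment in y. *)
Lemma Lk_bad_weight : exists2 C, 0 <= C & forall y z : R, 0 < y -> 0 < z ->
  z `^ (- a) < bad_weight y z -> Lk al y z * bad_weight y z <= C * (rho y * tau z).
Proof.
pose d : R := 36 `^ (al / a); have d0 : 0 <= d by exact: powR_ge0.
exists (40 + 18 * d); first by rewrite addr_ge0// mulr_ge0.
move=> y z y0 z0 h; have [[? ? ? ? ?] [? ? ?]] := facts.
have r0 : 0 <= al / a by rewrite divr_ge0// ltW.
have [[? ? ? ?] [[? ? ? ?] [? ? ? ?]]] := exponents_y.
have [[? ? ? ? ?] [? ? ? ?]] := exponents_z.
have M := monomial_rho_tau y0 z0.
have z00 := powRr0 z; have yz1 : y * z = y `^ 1 * z `^ 1 by rewrite !powRr1// ltW.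
(* The only monomials with the factor z^(-al), whose exponent may lie below -a; all others fall
   directly within the ranges of [rho] and [tau]. *)
have T : (16 * y `^ (- a) + 2 * y `^ 2%:R) * (y `^ al * z `^ (- al)) <=
    18 * (1 + d) * (rho y * tau z).
  have [z1|z1] := leP z 1.
    have K e : z `^ (- al) <= d * y `^ e -> - al <= e -> e <= 2 * (al / a) ->
      (16 * y `^ (- a) + 2 * y `^ 2%:R) * (y `^ al * z `^ (- al)) <=
       18 * (1 + d) * (rho y * tau z).
      move=> he e1 e2.
      have [? ? ? ?] := exponents e1 e2.
      have m1 : y `^ (- a + (al + e)) * z `^ 0 <= rho y * tau z by apply: M.
      have m2 : y `^ (2%:R + (al + e)) * z `^ 0 <= rho y * tau z by apply: M.
      rewrite z00 mulr1 in m1; rewrite z00 mulr1 in m2.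
      rewrite (powRDp (- a)) // in m1; rewrite (powRDp 2%:R)// in m2.
      rewrite (powRDp al)// in m1 m2.
      have g0 : 0 <= 16 * y `^ (- a) + 2 * y `^ 2%:R.
        by rewrite addr_ge0// mulr_ge0 ?powR_ge0.
      apply: (@le_trans _ _ ((16 * y `^ (- a) + 2 * y `^ 2%:R) * (y `^ al * (d * y `^ e)))).
        by apply: ler_wpM2l => //; apply: ler_wpM2l => //; exact: powR_ge0.
      have rt : 0 <= rho y * tau z by rewrite mulr_ge0 ?rho_ge0 ?tau_ge0.
      have -> : (16 * y `^ (- a) + 2 * y `^ 2%:R) * (y `^ al * (d * y `^ e)) =
        d * (16 * (y `^ (- a) * (y `^ al * y `^ e)) + 2 * (y `^ 2%:R * (y `^ al * y `^ e))) by ring.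
      apply: (@le_trans _ _ (d * (18 * (rho y * tau z)))).
        by apply: ler_wpM2l => //; lra.
      have -> : 18 * (1 + d) * (rho y * tau z) =
        d * (18 * (rho y * tau z)) + 18 * (rho y * tau z) by ring.
      by rewrite lerDl mulr_ge0.
    have [] := bad_weight_small y0 z0 z1 h => he; exact: (K _ he).
  have zl : z `^ (- al) <= 1.
    by rewrite -(powRr0 z); apply: ler_powR; [exact: ltW|lra].
  have m1 : y `^ (- a + al) * z `^ 0 <= rho y * tau z by apply: M.
  have m2 : y `^ (2%:R + al) * z `^ 0 <= rho y * tau z by apply: M.
  rewrite z00 mulr1 powRDp// in m1; rewrite z00 mulr1 powRDp// in m2.
  have g0 : 0 <= 16 * y `^ (- a) + 2 * y `^ 2%:R.
    by rewrite addr_ge0// mulr_ge0 ?powR_ge0.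
  apply: (@le_trans _ _ ((16 * y `^ (- a) + 2 * y `^ 2%:R) * (y `^ al * 1))).
    by apply: ler_wpM2l => //; apply: ler_wpM2l => //; exact: powR_ge0.
  rewrite mulr1 mulrDl -!mulrA.
  have rt : 0 <= d * (rho y * tau z) by rewrite mulr_ge0// mulr_ge0 ?rho_ge0 ?tau_ge0.
  have -> : 18 * ((1 + d) * (rho y * tau z)) =
    18 * (rho y * tau z) + 18 * (d * (rho y * tau z)) by ring.
  lra.
have m1 : y `^ (- a - al) * z `^ al <= rho y * tau z by apply: M.
have m2 : y `^ (2%:R - al) * z `^ al <= rho y * tau z by apply: M.
have m3 : y `^ (1 - al) * z `^ (1 + al) <= rho y * tau z by apply: M.
have m4 : y `^ (1 + al) * z `^ (1 - al) <= rho y * tau z by apply: M.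
have -> : Lk al y z * bad_weight y z =
  (16 * y `^ (- a) + 2 * y `^ 2%:R) * (y `^ al * z `^ (- al)) +
  16 * (y `^ (- a - al) * z `^ al) + 2 * (y `^ (2%:R - al) * z `^ al) +
  2 * (y `^ (1 - al) * z `^ (1 + al)) + 2 * (y `^ (1 + al) * z `^ (1 - al)).
  by rewrite /bad_weight yz1 LkE// !(powRDp _ _ y0) !(powRDp _ _ z0); ring.
exact: bad_sum T m1 m2 m3 m4.
Qed.

(** Where the net weight is nonnegative, K >= 2 - eps suffices. Where it is negative, the excess of
    K over 2 - eps is at most 2 eps Lk, which is exactly the situation covered by
    [Lk_bad_weight]. *)
Lemma kernel_bad_weight C eps K y z : kernel al eps K -> 0 < y -> 0 < z -> 0 <= C ->
  (z `^ (- a) < bad_weight y z -> Lk al y z * bad_weight y z <= C * (rho y * tau z)) ->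
  (2 - eps) * (z `^ (- a) - bad_weight y z) - 2 * eps * (C * (rho y * tau z)) <=
  K y z * (z `^ (- a) - bad_weight y z).
Proof.
move=> hK y0 z0 C0 P; have e0 := kernel_eps_ge0 hK.
have kg := k_ge hK y0 z0; have kl := k_le hK y0 z0; have L2 := Lk_ge2 al y0 z0.
have rt : 0 <= C * (rho y * tau z) by rewrite mulr_ge0// mulr_ge0 ?rho_ge0 ?tau_ge0.
have w0 : 0 <= bad_weight y z.
  rewrite /bad_weight; have := powR_ge0 y (- a); have := powR_ge0 y 2%:R.
  have : 0 <= y * z by apply: mulr_ge0; exact: ltW.
  by move=> *; lra.
have v0 := powR_ge0 z (- a).
move: rt w0 v0 kg kl L2 P.
move: (C * _) (bad_weight y z) (z `^ _) (K y z) (Lk al y z) => W A v k L W0 A0 v0 kg kl L2 P.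
have eW : 0 <= eps * W by rewrite mulr_ge0.
have [Av|vA] := leP A v.
  have : (2 - eps) * (v - A) <= k * (v - A) by rewrite ler_wpM2r// subr_ge0.
  lra.
have LW := P vA.
have eL : 2 * eps <= eps * L by rewrite mulrC ler_wpM2l.
have k1' : (k - (2 - eps)) * A <= 2 * eps * L * A by apply: ler_wpM2r => //; lra.
have k2' : 2 * eps * L * A <= 2 * eps * W.
  by rewrite -!mulrA ler_pM2l// ler_wpM2l.
have k3' : 0 <= (k - (2 - eps)) * v by rewrite mulr_ge0// subr_ge0.
lra.
Qed.

(** Near 0 and near oo the weight [tau] beats 1 + x by any factor; on the compact interval in
    between, x^2 exp(-x) is bounded below. *)
Lemma low_weight_split (t : R) : 0 < t -> exists2 C, 0 <= C & forall x : R, 0 < x ->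
  1 + x <= t * tau x + C * (x ^+ 2 * expR (- x)).
Proof.
move=> t0; have [[? ? ? ? ?] _] := facts.
pose d : R := Num.min 1 ((2 / t) `^ (- a^-1)).
pose M : R := Num.max 1 (2 / t).
have q0 : 0 < 2 / t by rewrite divr_gt0.
have d0 : 0 < d by rewrite lt_min ltr01 powR_gt0.
have d1 : d <= 1 by rewrite ge_min lexx.
have M1 : 1 <= M by rewrite le_max lexx.
have M2 : 2 / t <= M by rewrite le_max lexx orbT.
have dd : 2 / t <= d `^ (- a).
  have -> : 2 / t = ((2 / t) `^ (- a^-1)) `^ (- a).
    rewrite -powRrM mulrNN mulVf ?gt_eqF//; first by rewrite powRr1// ltW.
  by apply: powR_anti => //; [rewrite ge_min lexx orbT|lra].
have E0 : 0 < d ^+ 2 * expR (- M) by rewrite mulr_gt0 ?expR_gt0// exprn_gt0.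
exists ((1 + M) / (d ^+ 2 * expR (- M))); first by rewrite divr_ge0 ?ltW//; lra.
move=> x x0.
have g0 : 0 <= (1 + M) / (d ^+ 2 * expR (- M)) * (x ^+ 2 * expR (- x)).
  rewrite mulr_ge0//; first by rewrite divr_ge0 ?(ltW E0)//; lra.
  by rewrite mulr_ge0 ?expR_ge0// sqr_ge0.
have [xd|xd] := leP x d.
  have h1 : 2 / t <= x `^ (- a).
    by apply: (le_trans dd); apply: powR_anti => //; lra.
  have h2 : 2 <= t * x `^ (- a) by rewrite mulrC -ler_pdivrMr.
  have h3 : 0 <= t * x `^ 2%:R by rewrite mulr_ge0 ?powR_ge0// ltW.
  by rewrite /tau mulrDr; lra.
have [xM|xM] := leP M x.
  have h1 : 2 <= t * x by rewrite mulrC -ler_pdivrMr//; exact: le_trans xM.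
  have h2 : t * x `^ 2%:R >= 2 * x.
    by rewrite (powR_mulrn 2 (ltW x0)) expr2 mulrA ler_wpM2r// ltW.
  have h3 : 0 <= t * x `^ (- a) by rewrite mulr_ge0 ?powR_ge0// ltW.
  by rewrite /tau mulrDr; lra.
have h1 : 0 <= t * tau x by rewrite mulr_ge0 ?tau_ge0// ltW.
have h2 : d ^+ 2 * expR (- M) <= x ^+ 2 * expR (- x).
  apply: ler_pM; rewrite ?sqr_ge0 ?expR_ge0//.
    by rewrite ler_sqr ?nnegrE ?ltW.
  by rewrite ler_expR lerN2 ltW.
have h3 : 1 + M <= (1 + M) / (d ^+ 2 * expR (- M)) * (x ^+ 2 * expR (- x)).
  rewrite mulrAC ler_pdivlMr// ler_wpM2l//; lra.
lra.
Qed.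

(** [wnorm] and [enorm] are the quantities Y and Z of the overview. *)
Definition wnorm (h : R -> R) : R := Itg leb1 (fun x => tau x * `|h x|).
Definition enorm (h : R -> R) : R := Itg leb1 (fun x => x ^+ 2 * expR (- x) * `|h x|).

Lemma tame_tau h : tame h ->
  itg leb1 (fun x => tau x * `|h x|) /\ wnorm h = absmom (- a) h + absmom 2%:R h.
Proof.
move=> th; have [[? ? ? ? ?] [? ? ?]] := facts.
have i1 : itg leb1 (fun x => x `^ (- a) * `|h x|) by apply: (tame_pow th); lra.
have i2 : itg leb1 (fun x => x `^ 2%:R * `|h x|) by apply: (tame_pow th); lra.
by apply: ItgD_eq i1 i2 _ => x; rewrite -mulrDl.
Qed.

(** The loss exceeds (1 + a) Xa by at least c Xa, and X2 >= c X2. The eps term uses up half of c.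
    The remaining errors are at most 36 C2 (X0 + X1), with 36 = 2 * 16 + 2 * 2, and dividing by c /
    2 gives 72 C2 / c. *)
Lemma coercive_algebra (eps c C0 C2 N ma m2 m1 mr Xa X2 X0 X1 : R) :
  0 <= eps -> eps <= 1 -> 0 < c -> c <= 1 -> a <= b -> 1 + b + c <= (2 - eps) * N ->
  ma <= C2 -> m2 <= C2 -> m1 <= C2 -> mr <= C2 -> 0 <= C2 -> 0 <= C0 ->
  0 <= Xa -> 0 <= X2 -> 0 <= X0 -> 0 <= X1 -> eps * (4 * (C0 * C2) + 1) <= c ->
  (2 - eps) * (N * Xa) - (2 - eps) * 16 * (ma * X0) - (2 - eps) * 2 * (m2 * X0) -
  (2 - eps) * 2 * (m1 * X1) - 2 * eps * C0 * (mr * (Xa + X2)) <= (1 + a) * Xa - X2 ->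
  Xa + X2 <= 72 * C2 / c * (X0 + X1).
Proof.
move=> e0 e1 c0 c1 ab' Nb hma hm2 hm1 hmr C20 C00 xa x2 x0 x1 ee low.
have b1' : (1 + b + c) * Xa <= (2 - eps) * (N * Xa) by rewrite mulrA ler_wpM2r.
have CX0 : 0 <= C2 * X0 by exact: mulr_ge0.
have CX1 : 0 <= C2 * X1 by exact: mulr_ge0.
have half (m X : R) : m <= C2 -> 0 <= X -> 0 <= C2 * X -> (2 - eps) * (m * X) <= 2 * (C2 * X).
  move=> h1 h2 h3; have mX : m * X <= C2 * X by exact: ler_wpM2r.
  have h4 : (2 - eps) * (m * X) <= (2 - eps) * (C2 * X) by apply: ler_wpM2l => //; lra.
  have h5 : 0 <= eps * (C2 * X) by exact: mulr_ge0.
  lra.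
have t1 := half _ _ hma x0 CX0; have t2 := half _ _ hm2 x0 CX0.
have t3 := half _ _ hm1 x1 CX1.
have Y0 : 0 <= Xa + X2 by exact: addr_ge0.
have t4 : 2 * eps * C0 * (mr * (Xa + X2)) <= c / 2 * (Xa + X2).
  rewrite mulrA; apply: ler_wpM2r => //.
  have s1 : eps * C0 * mr <= eps * C0 * C2 by apply: ler_wpM2l => //; exact: mulr_ge0.
  lra.
have t5 : a * Xa <= b * Xa by exact: ler_wpM2r.
have t6 : c * X2 <= X2 by rewrite ler_piMl.
rewrite mulrAC ler_pdivlMr//.
lra.
Qed.

Let avg_le (u v c : R) : u <= c -> v <= c -> 1 / 2 * u + 1 / 2 * v <= c.
Proof. by lra. Qed.

Let avg_ge (c s u v : R) : c <= s * u -> c <= s * v -> c <= s * (1 / 2 * u + 1 / 2 * v).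
Proof. by lra. Qed.

(** The pointwise bound of [kernel_bad_weight] is integrated against fb(y) |h(z)|. Each of its terms
    separates into a moment of fb times a moment of h, which yields the products handled by
    [coercive_algebra]. *)
Lemma sign_test_coercive : exists C, exists2 eps1, 0 < eps1 &
  forall eps K f1 f2, kernel al eps K -> eps <= 1 -> eps <= eps1 ->
    profile K f1 -> profile K f2 ->
  let h x := f1 x - f2 x in
  [/\ tame f1, tame f2, 0 <= C & wnorm h <= C * Itg leb1 (fun x => (1 + x) * `|h x|)].
Proof.
have [[q0 qa qa1 qab qb1] [qB qB2 _]] := facts.
have [ba aB ab2] : [/\ - b <= - a, - a <= B & a <= b] by split; lra.
have [b2 B2 bz Bz] : [/\ - b <= 2%:R, 2%:R <= B, - b <= 0 & 0 <= B] by split; lra.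
have [bo Bo] : - b <= 1 /\ 1 <= B by split; lra.
have [C1 [eps1 e10 H1]] := profile_tame al0 a0 ab b1 hB.
have [C0 C00 H0] := Lk_bad_weight.
pose c := (1 - b) / 2; have c0 : 0 < c by rewrite divr_gt0// subr_gt0.
have b0 : 0 < b by lra.
have c1 : c <= 1 by rewrite /c; lra.
pose C2 := `|C1|; have C20 : 0 <= C2 by exact: normr_ge0.
have D0 : 0 < 4 * (C0 * C2) + 1 by rewrite ltr_wpDl// mulr_ge0// mulr_ge0.
exists (72 * C2 / c), (Num.min eps1 (c / (4 * (C0 * C2) + 1))).
  by rewrite lt_min e10 divr_gt0.
move=> eps K f1 f2 hK e1; rewrite le_min => /andP[ee1 ee2] hf1 hf2 h.
have e0 := kernel_eps_ge0 hK.
have [tf1 r1 n1] := H1 _ _ _ hK e1 ee1 hf1.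
have [tf2 r2 n2] := H1 _ _ _ hK e1 ee1 hf2.
split => //; first by rewrite divr_ge0 ?(ltW c0)// mulr_ge0.
have th : tame h := tameB tf1 tf2.
have tha := tame_norm th.
have tfb := tame_avg tf1 tf2.
pose fb x := (f1 x + f2 x) / 2; pose ha x := `|h x|.
have fbE x : `|fb x| = fb x.
  by rewrite ger0_norm// /fb divr_ge0// addr_ge0 ?(pr_ge0 hf1) ?(pr_ge0 hf2).
have [iT iD ST] := sign_test_limit al0 a0 a1 ab b1 hB hK e1 hf1 hf2 tf1 tf2.
rewrite -/h -/fb -/ha in iT iD ST.
have [iTD ETD] := ItgB_eq iT iD (fun=> erefl).
have ipow (g : R -> R) s : tame g -> - b <= s -> s <= B -> itg leb1 (fun x => x `^ s * `|g x|).
  by move=> tg s1 s2; exact: tame_pow tg s1 s2.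
have ib s : - b <= s -> s <= B -> itg leb1 (fun x => x `^ s * fb x).
  by move=> s1 s2; apply: itg_eq (ipow _ s tfb s1 s2) _ => x; rewrite fbE.
have irb : itg leb1 (fun x => rho x * fb x).
  by apply: itg_eq (tm_itg tfb) _ => x; rewrite -/(fb x) fbE.
have rb : Itg leb1 (fun x => rho x * fb x) <= C2.
  have g x : 1 / 2 * (rho x * `|f1 x|) + 1 / 2 * (rho x * `|f2 x|) = rho x * fb x.
    by rewrite /fb (ger0_norm (pr_ge0 hf1 x)) (ger0_norm (pr_ge0 hf2 x)); field.
  have [_ ->] := ItgD_eq (itgZ (1 / 2) (tm_itg tf1)) (itgZ (1 / 2) (tm_itg tf2)) g.
  rewrite (ItgZ _ (tm_itg tf1)) (ItgZ _ (tm_itg tf2)).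
  by apply: avg_le; [apply: (le_trans r1)|apply: (le_trans r2)]; exact: ler_norm.
have fbs s : - b <= s -> s <= B -> 0 <= Itg leb1 (fun x => x `^ s * fb x) /\
    Itg leb1 (fun x => x `^ s * fb x) <= C2.
  move=> s1 s2; split.
    by apply: Itg_ge0; [exact: ib|move=> x; rewrite -fbE mulr_ge0// powR_ge0].
  apply: le_trans rb; apply: Itg_le => //; first exact: ib.
  move=> x; have [x0|x0] := leP x 0; first by rewrite /fb (tm_supp tf1 x0) (tm_supp tf2 x0) addr0 mul0r !mulr0.
  by rewrite -fbE ler_wpM2r//; apply: powR_le_rho.
have [if1 _] := profile_number hK e1 hf1; have [if2 _] := profile_number hK e1 hf2.
have [ifb Nfb] : itg leb1 fb /\ 1 + b + c <= (2 - eps) * Itg leb1 fb.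
  have g x : 1 / 2 * f1 x + 1 / 2 * f2 x = fb x by rewrite /fb; field.
  have [i3 ->] := ItgD_eq (itgZ (1 / 2) if1) (itgZ (1 / 2) if2) g.
  by rewrite (ItgZ _ if1) (ItgZ _ if2); split => //; exact: avg_ge.
have [iY EY] := tame_tau th.
have iXa : itg leb1 (fun x => x `^ (- a) * ha x) by apply: (ipow h).
have iX0 : itg leb1 ha.
  have i : itg leb1 (fun x => x `^ 0 * `|h x|) by apply: (ipow h).
  by apply: itg_eq i _ => x; rewrite powRr0 mul1r.
have iX1 : itg leb1 (fun x => x * ha x).
  have i : itg leb1 (fun x => x `^ 1 * `|h x|) by apply: (ipow h).
  apply: itg_eq i _ => x; have [x0|x0] := leP x 0.
    by rewrite /ha (tm_supp th x0) normr0 !mulr0.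
  by rewrite powRr1// ltW.
have im1 : itg leb1 (fun x => x * fb x).
  have i : itg leb1 (fun x => x `^ 1 * fb x) by apply: ib.
  apply: itg_eq i _ => x; have [x0|x0] := leP x 0.
    by rewrite /fb (tm_supp tf1 x0) (tm_supp tf2 x0) addr0 mul0r !mulr0.
  by rewrite powRr1// ltW.
have m1C : Itg leb1 (fun x => x * fb x) <= C2.
  have -> : Itg leb1 (fun x => x * fb x) = Itg leb1 (fun x => x `^ 1 * fb x).
    apply: Itg_eq => x; have [x0|x0] := leP x 0.
      by rewrite /fb (tm_supp tf1 x0) (tm_supp tf2 x0) addr0 mul0r !mulr0.
    by rewrite powRr1// ltW.
  exact: (fbs 1 bo Bo).2.
have ima : itg leb1 (fun x => x `^ (- a) * fb x) by apply: ib.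
have im2 : itg leb1 (fun x => x `^ 2%:R * fb x) by apply: ib.
have maC : Itg leb1 (fun x => x `^ (- a) * fb x) <= C2 by exact: (fbs (- a) ba aB).2.
have m2C : Itg leb1 (fun x => x `^ 2%:R * fb x) <= C2 by exact: (fbs 2%:R b2 B2).2.
have [j1 E1] := Itg_prod ifb iXa.
have [j2 E2] := Itg_prod ima iX0.
have [j3 E3] := Itg_prod im2 iX0.
have [j4 E4] := Itg_prod im1 iX1.
have [j5 E5] := Itg_prod irb iY.
have [k1 F1] := ItgB_eq (itgZ (2 - eps) j1) (itgZ ((2 - eps) * 16) j2) (fun=> erefl).
have [k2 F2] := ItgB_eq k1 (itgZ ((2 - eps) * 2) j3) (fun=> erefl).
have [k3 F3] := ItgB_eq k2 (itgZ ((2 - eps) * 2) j4) (fun=> erefl).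
have [k4 F4] := ItgB_eq k3 (itgZ (2 * eps * C0) j5) (fun=> erefl).
rewrite F3 F2 F1 (ItgZ _ j1) (ItgZ _ j2) (ItgZ _ j3) (ItgZ _ j4) (ItgZ _ j5) E1 E2 E3 E4 E5 in F4.
have low : Itg leb2 (fun p => (2 - eps) * (fb p.1 * (p.2 `^ (- a) * ha p.2)) -
    (2 - eps) * 16 * (p.1 `^ (- a) * fb p.1 * ha p.2) -
    (2 - eps) * 2 * (p.1 `^ 2%:R * fb p.1 * ha p.2) -
    (2 - eps) * 2 * (p.1 * fb p.1 * (p.2 * ha p.2)) -
    2 * eps * C0 * (rho p.1 * fb p.1 * (tau p.2 * ha p.2))) <=
    (1 + a) * absmom (- a) h - absmom 2%:R h.
  apply: le_trans ST; rewrite -ETD; apply: Itg_le => // p.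
  have [p1|p1] := leP p.1 0.
    have fb0 : fb p.1 = 0 by rewrite /fb (tm_supp tf1 p1) (tm_supp tf2 p1) addr0 mul0r.
    by rewrite /flux fb0 !(mulr0, mul0r) !subr0.
  have [p2|p2] := leP p.2 0.
    have ha0 : ha p.2 = 0 by rewrite /ha (tm_supp th p2) normr0.
    by rewrite /flux ha0 !(mulr0, mul0r) !subr0.
  have fh0 : 0 <= fb p.1 * ha p.2 by rewrite -fbE; apply: mulr_ge0; exact: normr_ge0.
  have key := kernel_bad_weight hK p1 p2 C00 (H0 _ _ p1 p2).
  have -> : flux K fb ha p * tau p.2 - flux K fb ha p *
     (16 * p.1 `^ (- a) + 2 * p.1 `^ 2%:R + 2 * (p.1 * p.2) + p.2 `^ 2%:R) =
     K p.1 p.2 * (p.2 `^ (- a) - bad_weight p.1 p.2) * (fb p.1 * ha p.2).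
    by rewrite /flux /tau /bad_weight; ring.
  apply: le_trans (ler_wpM2r fh0 key).
  by rewrite le_eqVlt; apply/orP; left; apply/eqP; rewrite /bad_weight; ring.
rewrite F4 in low.
have [iXX EXX] : itg leb1 (fun x => (1 + x) * `|h x|) /\
    Itg leb1 (fun x => (1 + x) * `|h x|) = Itg leb1 ha + Itg leb1 (fun x => x * ha x).
  by apply: ItgD_eq iX0 iX1 _ => x; rewrite /ha; ring.
have X0 (u : R -> R) : (forall x, 0 < x -> 0 <= u x) -> itg leb1 (fun x => u x * ha x) ->
    0 <= Itg leb1 (fun x => u x * ha x).
  move=> u0 iu; apply: Itg_ge0 => // x; have [x0|x0] := leP x 0.
    by rewrite /ha (tm_supp th x0) normr0 mulr0.
  by apply: mulr_ge0; [exact: u0|exact: normr_ge0].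
have iX2 : itg leb1 (fun x => x `^ 2%:R * ha x) by apply: (ipow h).
rewrite EXX EY.
have ee3 : eps * (4 * (C0 * C2) + 1) <= c by rewrite -ler_pdivlMr.
have xa := X0 _ (fun x _ => powR_ge0 x (- a)) iXa.
have x2 := X0 _ (fun x _ => powR_ge0 x 2%:R) iX2.
have x1 := X0 id (fun x => @ltW _ _ 0 x) iX1.
have x0 : 0 <= Itg leb1 ha by apply: Itg_ge0 => // x; exact: normr_ge0.
have EY' : Itg leb1 (fun x => tau x * `|h x|) = absmom (- a) h + absmom 2%:R h.
  exact: (tame_tau th).2.
rewrite EY' in low.
exact: (coercive_algebra e0 e1 c0 c1 ab2 Nfb maC m2C m1C rb C20 C00 xa x2 x0 x1 ee3 low).
Qed.

Let inv_half (c : R) : 0 <= c -> c * (2 * c + 1)^-1 <= 1 / 2.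
Proof. by move=> c0; rewrite ler_pdivrMr; lra. Qed.

Let absorb (w u v : R) : w <= u + v -> u <= 1 / 2 * w -> w <= 2 * v.
Proof. by lra. Qed.

Lemma coercivity : exists C, exists2 eps1, 0 < eps1 &
  forall eps K f1 f2, kernel al eps K -> eps <= 1 -> eps <= eps1 ->
    profile K f1 -> profile K f2 ->
  let h x := f1 x - f2 x in
  [/\ tame f1, tame f2, 0 <= C & wnorm h <= C * enorm h].
Proof.
have [[? ? ? ? ?] [? ? ?]] := facts.
have [? ? ? ?] : [/\ - b <= 0, 0 <= B, - b <= 1 & 1 <= B] by split; lra.
have [? ?] : - b <= 2 /\ 2 <= B by split; lra.
have [C [eps1 e10 H]] := sign_test_coercive.
pose C' := `|C|; have C0' : 0 <= C' by exact: normr_ge0.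
have D0 : 0 < 2 * C' + 1 by rewrite ltr_wpDl// mulr_ge0.
(* With this t the part C' t Y is at most Y / 2 and is absorbed on the left. *)
have t0 : 0 < (2 * C' + 1)^-1 by rewrite invr_gt0.
have [Ct Ct0 hCt] := low_weight_split t0.
exists (2 * (C' * Ct)), eps1 => // eps K f1 f2 hK e1 ee hf1 hf2 h.
have [tf1 tf2 Cp L] := H _ _ _ _ hK e1 ee hf1 hf2.
rewrite -/h in L; have CE : C' = C by rewrite /C' ger0_norm.
split => //; first by rewrite mulr_ge0// mulr_ge0.
have th : tame h := tameB tf1 tf2.
have [iY _] := tame_tau th.
have mh := tm_msr th.
have iZ : itg leb1 (fun x => x ^+ 2 * expR (- x) * `|h x|).
  have i : itg leb1 (fun x => x `^ 2%:R * `|h x|) by exact: tame_pow th _ _.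
  apply: itg_le i; first by msr_tac.
  move=> x; have [x0|x0] := leP x 0; first by rewrite (tm_supp th x0) normr0 !mulr0 normr0.
  have g : 0 <= x ^+ 2 * expR (- x) by rewrite mulr_ge0 ?sqr_ge0 ?expR_ge0.
  rewrite normrM normr_id (ger0_norm g) (powR_mulrn 2 (ltW x0)) ler_wpM2r//.
  by rewrite ler_piMr ?sqr_ge0// -expR0 ler_expR oppr_le0 ltW.
have iL : itg leb1 (fun x => (1 + x) * `|h x|).
  have i0 : itg leb1 (fun x => x `^ 0 * `|h x|) by exact: tame_pow th _ _.
  have i1 : itg leb1 (fun x => x `^ 1 * `|h x|) by exact: tame_pow th _ _.
  apply: itg_eq (itgD i0 i1) _ => x; have [x0|x0] := leP x 0.
    by rewrite (tm_supp th x0) normr0 !mulr0 addr0.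
  by rewrite powRr0 (powRr1 (ltW x0)); ring.
have [iS ES] := ItgD_eq (itgZ (2 * C' + 1)^-1 iY) (itgZ Ct iZ) (fun=> erefl).
rewrite (ItgZ _ iY) (ItgZ _ iZ) -/(wnorm h) -/(enorm h) in ES.
have L2 : Itg leb1 (fun x => (1 + x) * `|h x|) <= (2 * C' + 1)^-1 * wnorm h + Ct * enorm h.
  rewrite -ES; apply: Itg_le => // x; have [x0|x0] := leP x 0.
    by rewrite (tm_supp th x0) normr0 !mulr0 addr0.
  by rewrite !(mulrA _ _ `|h x|) -mulrDl ler_wpM2r//; exact: hCt.
have Y0 : 0 <= wnorm h by apply: Itg_ge0 => // x; rewrite mulr_ge0 ?tau_ge0.
have L3 : wnorm h <= C' * ((2 * C' + 1)^-1 * wnorm h + Ct * enorm h).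
  by apply: (le_trans L); rewrite -CE ler_wpM2l.
have L4 : C' * (2 * C' + 1)^-1 <= 1 / 2 by exact: inv_half.
have L5 : C' * (2 * C' + 1)^-1 * wnorm h <= 1 / 2 * wnorm h by rewrite ler_wpM2r.
by rewrite -2!mulrA; apply: absorb L5; rewrite mulrDr mulrA in L3.
Qed.

End Coercivity.

(** * The damped sign test *)

Section Bernstein.
Context {R : realType}.
Implicit Types (g : nat -> R) (t : R).

(* The Bernstein polynomial of g(0), ..., g(n), by conditioning on the first of n
   Bernoulli trials. *)
Fixpoint bernstein (n : nat) g : {poly R} :=
  if n is m.+1 then (1 - 'X) * bernstein m g + 'X * bernstein m (fun k => g k.+1)
  else (g 0)%:P.

Lemma bernsteinS n g t : (bernstein n.+1 g).[t] =
  (1 - t) * (bernstein n g).[t] + t * (bernstein n (fun k => g k.+1)).[t].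
Proof. by rewrite /= !hornerE. Qed.

Lemma size_bernstein n g : (size (bernstein n g) <= n.+1)%N.
Proof.
elim: n g => [|n ih] g /=; first by rewrite size_polyC; case: eqP.
have s1 : (size (1 - 'X : {poly R})%R <= 2)%N.
  by rewrite -opprB size_polyN size_XsubC.
apply: (leq_trans (size_polyD _ _)); rewrite geq_max; apply/andP; split.
  apply: (leq_trans (size_polyMleq _ _)).
  by apply: (@leq_trans (2 + n.+1).-1); rewrite // -ltnS; case: (size _ + _)%N (leq_add s1 (ih g)) => //= *; rewrite ltnS.
apply: (leq_trans (size_polyMleq _ _)); rewrite size_polyX addSn /=.
exact: ih.
Qed.

(** One step of the recursion at most triples the coefficients: 1 - X contributes twice and X once.
    The bound does not depend on g, which matters because g will depend on the profiles. *)
Lemma coef_bernstein_le n g i : (forall k, `|g k| <= 1) ->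
  `|(bernstein n g)`_i| <= 3 ^+ n.
Proof.
elim: n g i => [|n ih] g i hg.
  by rewrite /= coefC; case: eqP => _; rewrite ?normr0// expr0.
rewrite /= mulrBl mul1r coefD coefB !coefXM.
have h1 := ih g i hg; have h2 := ih g i.-1 hg.
have h3 := ih (fun k => g k.+1) i.-1 (fun k => hg k.+1).
have p0 : 0 <= 3 ^+ n :> R by exact: exprn_ge0.
apply: (le_trans (ler_normD _ _)); rewrite exprS.
have a1 : `|(bernstein n g)`_i - (if i == 0 then 0 else (bernstein n g)`_i.-1)| <= 3 ^+ n + 3 ^+ n.
  apply: (le_trans (ler_normB _ _)); apply: lerD => //.
  by case: eqP => _ //; rewrite normr0.
have a2 : `|if i == 0 then 0 else (bernstein n (fun k => g k.+1))`_i.-1| <= 3 ^+ n.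
  by case: eqP => _ //; rewrite normr0.
by apply: (le_trans (lerD a1 a2)); lra.
Qed.

Lemma bernstein_le n g g' t : 0 <= t -> t <= 1 -> (forall k, (k <= n)%N -> g k <= g' k) ->
  (bernstein n g).[t] <= (bernstein n g').[t].
Proof.
move=> t0 t1; elim: n g g' => [|n ih] g g' hg; first by rewrite /= !hornerE hg.
rewrite !bernsteinS; apply: lerD.
  by apply: ler_wpM2l; [lra|apply: ih => k kn; apply: hg; exact: leqW].
by apply: ler_wpM2l => //; apply: ih => k kn; exact: hg.
Qed.

Lemma bernstein_lin n g g' (c d : R) t :
  (bernstein n (fun k => c * g k + d * g' k)).[t] =
  c * (bernstein n g).[t] + d * (bernstein n g').[t].
Proof.
elim: n g g' => [|n ih] g g'; first by rewrite /= !hornerE.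
by rewrite !bernsteinS !ih; ring.
Qed.

Lemma bernstein_cst n (c : R) t : (bernstein n (fun=> c)).[t] = c.
Proof.
elim: n => [|n ih]; first by rewrite /= !hornerE.
by rewrite bernsteinS ih; ring.
Qed.

(** The second moment about c of a binomial variable with parameters n and t: squared bias plus
    variance. *)
Lemma bernstein_sqr n (c : R) t : (bernstein n (fun k => (k%:R - c) ^+ 2)).[t] =
  (n%:R * t - c) ^+ 2 + n%:R * t * (1 - t).
Proof.
elim: n c => [|n ih] c; first by rewrite /= !hornerE /=; ring.
rewrite bernsteinS ih.
have -> : (fun k => (k.+1%:R - c) ^+ 2) = (fun k : nat => (k%:R - (c - 1)) ^+ 2).
  by apply/funext => k; rewrite -natr1; congr (_ ^+ 2); ring.
by rewrite ih -natr1; ring.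
Qed.

(** A Chebyshev-type argument: Bernstein operators are monotone, so a quadratic majorant of the
    error can be evaluated exactly. *)
Lemma bernstein_approx n g t (y e l : R) : 0 <= t -> t <= 1 -> (0 < n)%N -> 0 < l ->
  (forall k, (k <= n)%N -> `|y - g k| <= `|t - k%:R / n%:R| + e) ->
  `|y - (bernstein n g).[t]| <= l + 1 / (n%:R * l) + e.
Proof.
move=> t0 t1 n0 l0 hg; have N0 : 0 < n%:R :> R by rewrite ltr0n.
(* The majorant comes from u <= l + u^2 / l with u = |t - k/n|. *)
pose H (k : nat) : R := (l + e) * 1 + (n%:R ^+ 2 * l)^-1 * (k%:R - n%:R * t) ^+ 2.
have hH k : (k <= n)%N -> `|y - g k| <= H k.
  move=> kn; apply: (le_trans (hg k kn)); rewrite /H mulr1.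
  have -> : (n%:R ^+ 2 * l)^-1 * (k%:R - n%:R * t) ^+ 2 = `|t - k%:R / n%:R| ^+ 2 / l.
    rewrite real_normK ?num_real//; field; rewrite !gt_eqF//.
  set u := `|_|; have u0 : 0 <= u by exact: normr_ge0.
  suff : u <= l + u ^+ 2 / l by lra.
  rewrite -(ler_pM2r l0) mulrDl divfK ?gt_eqF//.
  by have := sqr_ge0 (u - l); nra.
have HE : (bernstein n H).[t] <= l + 1 / (n%:R * l) + e.
  rewrite /H bernstein_lin bernstein_cst bernstein_sqr.
  have -> : (l + e) * 1 + (n%:R ^+ 2 * l)^-1 * ((n%:R * t - n%:R * t) ^+ 2 + n%:R * t * (1 - t)) =
    l + e + (t * (1 - t)) / (n%:R * l) by field; rewrite !gt_eqF.
  have : (t * (1 - t)) / (n%:R * l) <= 1 / (n%:R * l).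
    by rewrite ler_wpM2r ?invr_ge0 ?mulr_ge0 ?(ltW N0) ?(ltW l0)//; nra.
  lra.
apply: le_trans HE; rewrite ler_norml; apply/andP; split.
  have : (bernstein n (fun k => 1 * g k + -1 * H k)).[t] <= (bernstein n (fun=> y)).[t].
    apply: bernstein_le => // k kn; have := hH k kn; rewrite ler_norml => /andP[]; lra.
  by rewrite bernstein_lin bernstein_cst; lra.
have : (bernstein n (fun=> y)).[t] <= (bernstein n (fun k => 1 * g k + 1 * H k)).[t].
  apply: bernstein_le => // k kn; have := hH k kn; rewrite ler_norml => /andP[]; lra.
by rewrite bernstein_lin bernstein_cst; lra.
Qed.

(** G is a Lipschitz function of t = exp(-x), approximated by a Bernstein polynomial in t. The
    degree depends on eta only and the coefficients are bounded uniformly over all such G. *)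
Lemma lipschitz_exp_approx (eta : R) : 0 < eta -> exists n : nat,
  forall G : R -> R, (forall x, 0 < x -> `|G x| <= 1) ->
  (forall x y, 0 < x -> 0 < y -> `|G x - G y| <= `|expR (- x) - expR (- y)|) ->
  exists2 c : nat -> R, (forall i, `|c i| <= 3 ^+ n) &
    forall x, 0 < x -> `|G x - \sum_(i < n.+1) c i * expR (- (i%:R * x))| <= eta.
Proof.
move=> eta0; pose l := eta / 3; have l0 : 0 < l by rewrite divr_gt0.
(* Large enough that 1 / (n l) <= l and 1 / n <= l; the three errors of size l = eta / 3 add up to
   eta. *)
pose n := (Num.trunc (1 / l ^+ 2 + 1 / l)).+1.
have n0 : (0 < n)%N by [].
have N0 : 0 < n%:R :> R by rewrite ltr0n.
have nb : 1 / l ^+ 2 + 1 / l < n%:R by exact: truncnS_gt.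
have l2 : 0 < 1 / l ^+ 2 by rewrite divr_gt0// exprn_gt0.
have l1 : 0 < 1 / l by rewrite divr_gt0.
have n1 : 1 / (n%:R * l) <= l.
  rewrite ler_pdivrMr ?mulr_gt0//.
  have : 1 / l ^+ 2 <= n%:R by lra.
  by rewrite ler_pdivrMr ?exprn_gt0// expr2; lra.
have n2 : 1 / n%:R <= l.
  have : 1 / l <= n%:R by lra.
  by rewrite !ler_pdivrMr// mulrC.
exists n => G G1 Glip.
(* exp (- x) ranges over the open interval (0, 1), hence the shifted nodes. *)
pose node (k : nat) : R := (maxn (minn k n) 1)%:R / n.+1%:R.
have node0 k : 0 < node k by rewrite divr_gt0// ltr0n leq_max orbT.
have node1 k : node k < 1.
  by rewrite ltr_pdivrMr// mul1r ltr_nat ltnS geq_max geq_minr n0.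
have xn0 k : 0 < - ln (node k) by rewrite oppr_gt0 ln_lt0// node0 node1.
have En k : expR (- - ln (node k)) = node k by rewrite opprK lnK// posrE.
pose g k := G (- ln (node k)).
exists (fun i => (bernstein n g)`_i); first by move=> i; apply: coef_bernstein_le => k; exact: G1.
move=> x x0; pose t := expR (- x).
have t0 : 0 <= t by exact: expR_ge0.
have t1 : t <= 1 by rewrite /t -expR0 ler_expR oppr_le0 ltW.
have -> : \sum_(i < n.+1) (bernstein n g)`_i * expR (- (i%:R * x)) = (bernstein n g).[t].
  rewrite (horner_coef_wide t (size_bernstein n g)); apply: eq_bigr => i _.
  by congr (_ * _); rewrite /t -expRM_natl mulrN.
have h : `|G x - (bernstein n g).[t]| <= l + 1 / (n%:R * l) + l.
  apply: bernstein_approx => // k kn; apply: (le_trans (Glip x _ x0 (xn0 k))).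
  rewrite En -/t; have d : `|k%:R / n%:R - node k| <= l.
    apply: le_trans n2; rewrite /node (minn_idPl kn).
    have S0 : 0 < n.+1%:R :> R by [].
    have nn : n%:R <= n.+1%:R :> R by rewrite ler_nat.
    have kn' : k%:R <= n%:R :> R by rewrite ler_nat.
    have k0' : 0 <= k%:R :> R by [].
    have -> : k%:R / n%:R - (maxn k 1)%:R / n.+1%:R =
       (k%:R * n.+1%:R - (maxn k 1)%:R * n%:R) / (n%:R * n.+1%:R) :> R.
      by field; rewrite !gt_eqF.
    have D0 : 0 < n%:R * n.+1%:R :> R by rewrite mulr_gt0.
    rewrite normrM normfV (gtr0_norm D0) ler_pdivrMr//.
    have -> : 1 / n%:R * (n%:R * n.+1%:R) = n.+1%:R :> R by field; rewrite gt_eqF.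
    case: k {kn} kn' k0' => [|k] kn' k0'.
      by rewrite max0n mul0r mul1r sub0r normrN ger0_norm.
    have -> : maxn k.+1 1 = k.+1 by apply/maxn_idPl.
    have -> : k.+1%:R * n.+1%:R - k.+1%:R * n%:R = k.+1%:R :> R by rewrite -[n.+1%:R]natr1; ring.
    by rewrite ger0_norm//; exact: le_trans nn.
  have -> : t - node k = (t - k%:R / n%:R) + (k%:R / n%:R - node k) by ring.
  by apply: (le_trans (ler_normD _ _)); rewrite lerD2l.
by apply: (le_trans h); rewrite /l in n1 *; lra.
Qed.

End Bernstein.

(** * Primitives of tests dominated by an exponential *)

Section DampedPrimitive.
Context {R : realType}.
Local Notation mu := (@lebesgue_measure R).
Implicit Types (psi h : R -> R) (x y z : R).

Lemma incr_norm_le psi (w : R -> R) y z : 0 < y -> locint psi -> locint w ->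
  (forall x, y < x -> `|psi x| <= w x) -> `|incr psi y z| <= incr w y z.
Proof.
move=> y0 lp lw hw; rewrite /incr.
have lpi := lp y (y + z) y0; have lwi := lw y (y + z) y0.
apply: (le_trans (le_normr_Rintegral _ _)) => //.
apply: le_Rintegral => //; last first.
  by move=> x; rewrite /= in_itv/= => /andP[? _]; exact: hw.
exact: (integrable_norm lpi).
Qed.

Lemma continuous_expRN x : {for x, continuous (fun t : R => expR (- t))}.
Proof. by apply: continuous_comp; [exact: opp_continuous|exact: continuous_expR]. Qed.

Lemma incr_expRN y z : 0 < y -> 0 < z ->
  incr (fun t => expR (- t)) y z = expR (- y) - expR (- (y + z)).
Proof.
move=> y0 z0.
have dP (x : R) : 0 < x -> is_derive x 1 (fun t : R => - expR (- t)) (expR (- x)).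
  move=> _; have h : is_derive x (1 : R) (fun t : R => - t) (-1).
    by apply: is_derive_eq.
  have h2 := @is_derive1_comp _ expR (fun t : R => - t) x _ _ (is_derive_expR _) h.
  by apply: is_derive_eq; ring.
by rewrite (incr_primitive (fun x _ => continuous_expRN (x := x)) dP y0 z0); ring.
Qed.

(** psi is merely measurable, but its increments are dominated by those of the primitive of exp(-x),
    so its primitive is 1-Lipschitz as a function of exp(-x). *)
Lemma damped_primitive psi : measurable_fun setT psi ->
  (forall x, 0 < x -> `|psi x| <= expR (- x)) ->
  locint psi /\ exists G : R -> R, [/\ (forall x, 0 < x -> `|G x| <= 1),
    (forall x y, 0 < x -> 0 < y -> `|G x - G y| <= `|expR (- x) - expR (- y)|) &
    forall y z, 0 < y -> 0 < z -> incr psi y z = G (y + z) - G y].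
Proof.
move=> mpsi bpsi.
have lw : locint (fun t : R => expR (- t)).
  by apply: locint_continuous => x _; exact: continuous_expRN.
have lp : locint psi.
  by apply: locint_le lw => // x x0; apply: (le_trans (bpsi x x0)); exact: ler_norm.
split => //.
have i0 b : mu.-integrable `]0, b] (EFin \o psi).
  have ib : mu.-integrable `]0, b] (EFin \o (fun=> 1 : R)).
    apply: (@integrableS _ _ _ mu `[0, b]) => //; first exact: subset_itv_oc_cc.
    apply: continuous_compact_integrable; first exact: segment_compact.
    by apply: continuous_in_subspaceT => x _; exact: cvg_cst.
  apply: le_integrable ib => //.
    by apply/measurable_EFinP; exact: measurable_funS mpsi.
  move=> x; rewrite /= in_itv/= => /andP[x0 _]; rewrite lee_fin normr1.
  apply: (le_trans (bpsi x x0)); rewrite -expR0 ler_expR oppr_le0; exact: ltW.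
pose J x := \int[mu]_(t in `]0, x]) psi t.
have JE y z : 0 < y -> 0 < z -> incr psi y z = J (y + z) - J y.
  move=> y0 z0; rewrite /incr /J -(@Rintegral_itvB _ psi (BRight 0) (BRight (y + z)) y) //.
  - by rewrite bnd_simp ltW.
  - by rewrite bnd_simp lerDl ltW.
have Jlip x y : 0 < x -> 0 < y -> x <= y -> `|J y - J x| <= expR (- x) - expR (- y).
  move=> x0 y0; rewrite le_eqVlt => /orP[/eqP ->|xy]; first by rewrite !subrr normr0.
  have yx : 0 < y - x by rewrite subr_gt0.
  have e := JE x (y - x) x0 yx; rewrite [x + _]addrC subrK in e.
  rewrite -e; have e2 := incr_expRN x0 yx; rewrite [x + _]addrC subrK in e2.
  rewrite -e2; apply: incr_norm_le => // t xt; apply: bpsi; exact: lt_trans xt.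
have Jl x y : 0 < x -> 0 < y -> `|J x - J y| <= `|expR (- x) - expR (- y)|.
  move=> x0 y0; have [xy|/ltW yx] := leP x y.
    rewrite distrC; apply: (le_trans (Jlip _ _ x0 y0 xy)); exact: ler_norm.
  apply: (le_trans (Jlip _ _ y0 x0 yx)); rewrite distrC; exact: ler_norm.
(* Normalised at 1, so that the Lipschitz bound also gives |G| <= 1. *)
exists (fun x => J x - J 1); split.
- move=> x x0; apply: (le_trans (Jl x 1 x0 ltr01)).
  have b (t : R) : 0 < t -> 0 <= expR (- t) /\ expR (- t) <= 1.
    by move=> t0; rewrite expR_ge0 -expR0 ler_expR oppr_le0 ltW.
  have [h1 h2] := b x x0; have [h3 h4] := b 1 ltr01.
  by rewrite ler_norml; apply/andP; split; lra.
- move=> x y x0 y0; have -> : J x - J 1 - (J y - J 1) = J x - J y by ring.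
  exact: Jl.
- by move=> y z y0 z0; rewrite JE//; ring.
Qed.

End DampedPrimitive.

(** * Estimate of Z by a small multiple of Y *)

Section DampedEstimate.
Context {R : realType}.
Variables (al a b B : R).
Hypotheses (al0 : 0 <= al) (a0 : 0 < a) (a1 : a <= 1) (ab : b = a + al) (b1 : b < 1)
  (hB : 4 + al <= B).
Let facts : [/\ 0 <= al, 0 < a, a <= 1, b = a + al & b < 1] /\ 4 + al <= B.
Proof. by []. Qed.

Local Notation rho := (rho b B).
Local Notation tau := (tau a).
Local Notation tame := (tame b B).
Local Notation wnorm := (wnorm a).

(* [bracket q] is the symmetrised increment of exp (- q x), i.e. the effect of the
   exponential test functions on the constant kernel. *)
Definition bracket (q : R) (p : R * R) : R :=
  - (p.1 * expR (- (q * p.1)) * ex q p.2 + p.2 * expR (- (q * p.2)) * ex q p.1).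

(** The term i = 0 is constant in x and drops out, which shifts the index by one. *)
Lemma expsum_increment (n : nat) (c : nat -> R) (y z : R) :
  \sum_(i < n.+1) c i * expR (- (i%:R * (y + z))) - \sum_(i < n.+1) c i * expR (- (i%:R * y)) =
  - \sum_(i < n) c i.+1 * (expR (- (i.+1%:R * y)) * ex i.+1%:R z).
Proof.
rewrite -sumrB big_ord_recl /= !mul0r subrr add0r -sumrN; apply: eq_bigr => i _; rewrite /ex /bump /= add1n.
have -> : - (i.+1%:R * (y + z)) = - (i.+1%:R * y) + - (i.+1%:R * z) by ring.
by rewrite expRD; ring.
Qed.

Lemma expsum_bracket (n : nat) (c : nat -> R) (G : R -> R) (eta y z : R) :
  0 < y -> 0 < z ->
  (forall x, 0 < x -> `|G x - \sum_(i < n.+1) c i * expR (- (i%:R * x))| <= eta) ->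
  `|y * (G (y + z) - G y) + z * (G (z + y) - G z) -
    \sum_(i < n) c i.+1 * bracket i.+1%:R (y, z)| <= 2 * eta * (y + z).
Proof.
move=> y0 z0 hG; pose P x := \sum_(i < n.+1) c i * expR (- (i%:R * x)).
have -> : \sum_(i < n) c i.+1 * bracket i.+1%:R (y, z) =
    y * (P (y + z) - P y) + z * (P (z + y) - P z).
  rewrite /P !expsum_increment !mulrN -opprD !mulr_sumr -big_split -sumrN /=.
  by apply: eq_bigr => i _; rewrite /bracket /=; ring.
have -> : y * (G (y + z) - G y) + z * (G (z + y) - G z) -
   (y * (P (y + z) - P y) + z * (P (z + y) - P z)) =
   y * ((G (y + z) - P (y + z)) - (G y - P y)) + z * ((G (z + y) - P (z + y)) - (G z - P z)).
  ring.
have d u v : 0 < u -> 0 < v -> `|(G u - P u) - (G v - P v)| <= 2 * eta.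
  by move=> u0 v0; apply: (le_trans (ler_normB _ _)); have := hG u u0; have := hG v v0; rewrite -/(P u) -/(P v); lra.
have d1 := d (y + z) y (addr_gt0 y0 z0) y0; have d2 := d (z + y) z (addr_gt0 z0 y0) z0.
apply: (le_trans (ler_normD _ _)); rewrite !normrM (gtr0_norm y0) (gtr0_norm z0) mulrDr.
by apply: lerD; rewrite [leRHS]mulrC; apply: ler_wpM2l => //; exact: ltW.
Qed.

Lemma itg_bracket (f g : R -> R) (q : R) : 0 < q ->
  msr leb1 f -> (forall x, x <= 0 -> f x = 0) -> itg leb1 (fun x => x * `|f x|) ->
  msr leb1 g -> (forall x, x <= 0 -> g x = 0) -> itg leb1 (fun x => x * `|g x|) ->
  itg leb2 (fun p => f p.1 * g p.2 * bracket q p) /\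
  Itg leb2 (fun p => f p.1 * g p.2 * bracket q p) =
  - (dlap f q * lap g q + lap f q * dlap g q).
Proof.
move=> q0 mf f0 if1 mg g0 ig1.
have [i1 E1] := Itg_prod (itg_dlap q0 mf f0 if1) (itg_lap q0 mg g0 ig1).
have [i2 E2] := Itg_prod (itg_lap q0 mf f0 if1) (itg_dlap q0 mg g0 ig1).
have [i3 E3] := ItgD_eq i1 i2 (fun=> erefl).
have e p : - (p.1 * expR (- (q * p.1)) * f p.1 * (ex q p.2 * g p.2) +
  ex q p.1 * f p.1 * (p.2 * expR (- (q * p.2)) * g p.2)) = f p.1 * g p.2 * bracket q p.
  by rewrite /bracket; ring.
split; first exact: itg_eq (itgN i3) e.
by rewrite -(Itg_eq _ e) (ItgN i3) E3 E1 E2.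
Qed.

(** Each increment is at most exp(-y) (1 - exp(-z)) <= z. The resulting factor y z absorbs the
    negative powers in [Lk]. *)
Lemma sincr_damped_le (psi : R -> R) (p : R * R) : measurable_fun setT psi ->
  (forall x, 0 < x -> `|psi x| <= expR (- x)) -> 0 < p.1 -> 0 < p.2 ->
  `|sincr psi p| <= 2 * (p.1 * p.2).
Proof.
move=> mpsi bpsi p1 p2; have [lp [G [_ Glip GE]]] := damped_primitive mpsi bpsi.
have d y z : 0 < y -> 0 < z -> `|incr psi y z| <= z.
  move=> y0 z0; rewrite GE//; apply: (le_trans (Glip _ _ (addr_gt0 y0 z0) y0)).
  rewrite opprD expRD distrC.
  have -> : expR (- y) - expR (- y) * expR (- z) = expR (- y) * (1 - expR (- z)) by ring.
  have e1 : expR (- y) <= 1 by rewrite -expR0 ler_expR oppr_le0 ltW.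
  have e2 : 1 - expR (- z) <= z by have := expR_ge1Dx (- z); lra.
  have e3 : 0 <= 1 - expR (- z) by rewrite subr_ge0 -expR0 ler_expR oppr_le0 ltW.
  rewrite ger0_norm; last by rewrite mulr_ge0 ?expR_ge0.
  by apply: le_trans e2; rewrite ler_piMl.
rewrite /sincr; apply: (le_trans (ler_normD _ _)).
rewrite !normrM (gtr0_norm p1) (gtr0_norm p2).
have h1 : p.1 * `|incr psi p.1 p.2| <= p.1 * p.2 by rewrite ler_pM2l// d.
have h2 : p.2 * `|incr psi p.2 p.1| <= p.2 * p.1 by rewrite ler_pM2l// d.
by rewrite mulrC in h2 *; lra.
Qed.

Lemma absmom_le_wnorm (h : R -> R) s : tame h -> - a <= s -> s <= 2%:R ->
  [/\ itg leb1 (fun x => x `^ s * `|h x|), 0 <= absmom s h & absmom s h <= wnorm h].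
Proof.
move=> th s1 s2; have [[? ? ? ? ?] ?] := facts.
have i : itg leb1 (fun x => x `^ s * `|h x|) by apply: (tame_pow th); lra.
have ia : itg leb1 (fun x => x `^ (- a) * `|h x|) by apply: (tame_pow th); lra.
have i2 : itg leb1 (fun x => x `^ 2%:R * `|h x|) by apply: (tame_pow th); lra.
have iY : itg leb1 (fun x => tau x * `|h x|).
  by apply: itg_eq (itgD ia i2) _ => x; rewrite -mulrDl.
split => //; first by apply: Itg_ge0 => // x; rewrite mulr_ge0 ?powR_ge0.
apply: Itg_le => // x; have [x0|x0] := leP x 0; first by rewrite (tm_supp th x0) normr0 !mulr0.
by rewrite ler_wpM2r//; exact: powR_le_tau.
Qed.

Let avg_ge0 (u v : R) : 0 <= u -> 0 <= v -> 0 <= 1 / 2 * u + 1 / 2 * v.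
Proof. by lra. Qed.

Let avg_le (u v c : R) : u <= c -> v <= c -> 1 / 2 * u + 1 / 2 * v <= c.
Proof. by lra. Qed.

(** For a bracket the double integral factors into transforms of fb, bounded by 2 and 1, and of h,
    which are the differences controlled by [lap_compare]. *)
Lemma bracket_small : al < 1 -> exists2 C, 0 <= C & forall eps K f1 f2 q,
  kernel al eps K -> eps <= 1 -> profile K f1 -> profile K f2 -> 0 < q ->
  let fb x := (f1 x + f2 x) / 2 in let h x := f1 x - f2 x in
  itg leb2 (fun p => fb p.1 * h p.2 * bracket q p) /\
  `|Itg leb2 (fun p => fb p.1 * h p.2 * bracket q p)| <=
     eps * C * (q ^+ 2 + 2 * q) * (absmom (1 + al) h + absmom (1 - al) h).
Proof.
move=> al1; have [[qa0 _ _ _ _] _] := facts.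
have [CL CL0 HL] := lap_compare qa0 al1.
exists CL => // eps K f1 f2 q hK e1 hf1 hf2 q1 fb h.
have bf1 := profile_balanced qa0 al1 hK e1 hf1.
have bf2 := profile_balanced qa0 al1 hK e1 hf2.
have [L1 L2] := HL _ _ _ _ _ hK e1 hf1 hf2 q1; rewrite -/h in L1 L2.
have mh : msr leb1 h by exact: msrB (bal_msr bf1) (bal_msr bf2).
have e x : 1 / 2 * f1 x + 1 / 2 * f2 x = fb x by rewrite /fb; field.
have mfb : msr leb1 fb.
  by apply: msr_eq e; apply: msrD; apply: msrM; [exact: msr_cst|exact: bal_msr bf1|exact: msr_cst|exact: bal_msr bf2].
have hs0 x : x <= 0 -> h x = 0 by move=> x0; rewrite /h (bal_supp bf1 x0) (bal_supp bf2 x0) subrr.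
have fbs0 x : x <= 0 -> fb x = 0 by move=> x0; rewrite /fb (bal_supp bf1 x0) (bal_supp bf2 x0) addr0 mul0r.
have x1 := profile_itgx hf1; have x2 := profile_itgx hf2.
have fb0 x : 0 <= fb x by rewrite divr_ge0// addr_ge0 ?(pr_ge0 hf1) ?(pr_ge0 hf2).
have ixfb : itg leb1 (fun x => x * `|fb x|).
  apply: itg_eq (itgD (itgZ (1 / 2) x1) (itgZ (1 / 2) x2)) _ => x.
  rewrite (ger0_norm (fb0 x)) (ger0_norm (pr_ge0 hf1 x)) (ger0_norm (pr_ge0 hf2 x)) -e; ring.
have ixh : itg leb1 (fun x => x * `|h x|).
  apply: itg_le (itgD x1 x2); first by apply: msrM; [exact: msr_id|exact: msr_norm].
  move=> x; have [x0|x0] := leP x 0.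
    by rewrite hs0// (bal_supp bf1 x0) (bal_supp bf2 x0) normr0 !mulr0 addr0 normr0.
  rewrite -mulrDr normrM normr_id (gtr0_norm x0); apply: ler_wpM2l; first exact: ltW.
  exact: ler_normB.
have [j1 ->] := itg_bracket q1 mfb fbs0 ixfb mh hs0 ixh; split => //.
have a1' := itg_lap q1 (bal_msr bf1) (bal_supp bf1) x1.
have a2' := itg_lap q1 (bal_msr bf2) (bal_supp bf2) x2.
have a3' := itg_dlap q1 (bal_msr bf1) (bal_supp bf1) x1.
have a4' := itg_dlap q1 (bal_msr bf2) (bal_supp bf2) x2.
have Elh : lap h q = lap f1 q - lap f2 q.
  by apply: (proj2 (ItgB_eq a1' a2' _)) => x; rewrite /h; ring.
have Edh : dlap h q = dlap f1 q - dlap f2 q.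
  by apply: (proj2 (ItgB_eq a3' a4' _)) => x; rewrite /h; ring.
have Elb : lap fb q = 1 / 2 * lap f1 q + 1 / 2 * lap f2 q.
  rewrite -(ItgZ _ a1') -(ItgZ _ a2').
  by apply: (proj2 (ItgD_eq (itgZ (1 / 2) a1') (itgZ (1 / 2) a2') _)) => x; rewrite -e; ring.
have Edb : dlap fb q = 1 / 2 * dlap f1 q + 1 / 2 * dlap f2 q.
  rewrite -(ItgZ _ a3') -(ItgZ _ a4').
  by apply: (proj2 (ItgD_eq (itgZ (1 / 2) a3') (itgZ (1 / 2) a4') _)) => x; rewrite -e; ring.
have [l1 l2 _] := lap_le2 hK e1 hf1 q1; have [l3 l4 _] := lap_le2 hK e1 hf2 q1.
have /andP[d1 d2] := dlap_le1 hK e1 hf1 q1; have /andP[d3 d4] := dlap_le1 hK e1 hf2 q1.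
have lb0 : 0 <= lap fb q by rewrite Elb; exact: avg_ge0.
have lb2 : lap fb q <= 2 by rewrite Elb; exact: avg_le.
have db0 : 0 <= dlap fb q by rewrite Edb; exact: avg_ge0.
have db1 : dlap fb q <= 1 by rewrite Edb; exact: avg_le.
rewrite normrN; apply: (le_trans (ler_normD _ _)).
rewrite !normrM (ger0_norm lb0) (ger0_norm db0) Elh Edh.
move: L1 L2; move: (absmom _ h + _) => X L1 L2.
have b1' : dlap fb q * `|lap f1 q - lap f2 q| <= 1 * (CL * eps * X * q ^+ 2) by exact: ler_pM.
have b2' : lap fb q * `|dlap f1 q - dlap f2 q| <= 2 * (CL * eps * X * q) by exact: ler_pM.
apply: (le_trans (lerD b1' b2')).
by rewrite le_eqVlt; apply/orP; left; apply/eqP; ring.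
Qed.

Let normr3 (u v w : R) : `|u * v * w| = `|u| * `|v| * `|w|.
Proof. by rewrite !normrM. Qed.

Let double_le (u v r : R) : u * v <= 2 * r -> u * (2 * v) <= 4 * r.
Proof. by lra. Qed.

(** The order of choices is the point: t fixes eta, eta fixes the number of exponentials and the
    size of their coefficients, and only then is eps made small against the total of the bracket
    bounds. *)
Lemma damped_estimate (t : R) : 0 < t -> exists2 eps1, 0 < eps1 &
  forall eps K f1 f2, kernel al eps K -> eps <= 1 -> eps <= eps1 ->
    profile K f1 -> profile K f2 -> tame f1 -> tame f2 ->
    enorm (fun x => f1 x - f2 x) <= t * wnorm (fun x => f1 x - f2 x).
Proof.
move=> t0; have [[q0 qa qa1 qab qb1] qB] := facts.
have al1 : al < 1 by lra.
have a_1 : - a <= 1 by lra.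
have o4 : 1 <= 4 :> R by lra.
have [a_0 ap am ap2 am2] :
  [/\ - a <= 0, - a <= 1 + al, - a <= 1 - al, 1 + al <= 2 & 1 - al <= 2] by split; lra.
have [b_2 B_2 z2 o2] : [/\ - b <= 2, 2 <= B, 0 <= 2 :> R & 1 <= 2 :> R].
  by split; lra.
have s1 : 0 <= 1 + al by lra.
have s2 : 0 <= 1 - al by lra.
have [C1 C10 H1] := absmom_profile al0 al1 s1.
have [C2 C20 H2] := absmom_profile al0 al1 s2.
have [CL CL0 HL] := bracket_small al1.
(* The approximation error enters as 12 eta Y, which is t Y / 2; the threshold on eps provides the
   other half. *)
pose eta := t / 24; have eta0 : 0 < eta by rewrite divr_gt0.
have [n Hn] := @lipschitz_exp_approx R eta eta0.
(* The bound of [bracket_small] at q = i, doubled because the two moments of h there are each at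
   most Y. *)
pose D (i : nat) : R := 2 * CL * (i%:R ^+ 2 + 2 * i%:R).
pose S : R := \sum_(i < n) 3 ^+ n * D i.+1.
have S0 : 0 <= S.
  apply: sumr_ge0 => i _; rewrite mulr_ge0 ?exprn_ge0// /D mulr_ge0//.
  by rewrite mulr_ge0.
pose C3 := 2 * (C1 + C2) + 2 * S; have C30 : 0 <= C3 by rewrite /C3; lra.
exists (t / 2 / (C3 + 1)); first by rewrite !divr_gt0// ltr_wpDl.
move=> eps K f1 f2 hK e1 ee hf1 hf2 tf1 tf2.
pose h x := f1 x - f2 x; rewrite -/h.
have e0 := kernel_eps_ge0 hK.
have th : tame h := tameB tf1 tf2.
have tfb := tame_avg tf1 tf2.
pose fb x := (f1 x + f2 x) / 2.
have mh : msr leb1 h := tm_msr th. have mfb : msr leb1 fb := tm_msr tfb.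
have fb0 x : 0 <= fb x by rewrite divr_ge0// addr_ge0 ?(pr_ge0 hf1) ?(pr_ge0 hf2).
have hs0 : forall x, x <= 0 -> h x = 0 := tm_supp th.
have fbs0 : forall x, x <= 0 -> fb x = 0 := tm_supp tfb.
set Y := wnorm h.
have [iX0 x00 X0Y] : [/\ itg leb1 (fun x => x `^ 0 * `|h x|), 0 <= absmom 0 h & absmom 0 h <= Y].
  by exact: absmom_le_wnorm.
have [iX1 x10 X1Y] : [/\ itg leb1 (fun x => x `^ 1 * `|h x|), 0 <= absmom 1 h & absmom 1 h <= Y].
  by exact: absmom_le_wnorm.
have [iXp xp0 XpY] : [/\ itg leb1 (fun x => x `^ (1 + al) * `|h x|), 0 <= absmom (1 + al) h & absmom (1 + al) h <= Y].
  by exact: absmom_le_wnorm.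
have [iXm xm0 XmY] : [/\ itg leb1 (fun x => x `^ (1 - al) * `|h x|), 0 <= absmom (1 - al) h & absmom (1 - al) h <= Y].
  by exact: absmom_le_wnorm.
have Y0 : 0 <= Y by exact: le_trans X0Y.
pose psi x := sgnf h x * expR (- x).
have mpsi : msr leb1 psi.
  by apply: msrM; [exact: msr_sgnf|apply: msr_expR; apply: msrN; exact: msr_id].
have bpsi x : 0 < x -> `|psi x| <= expR (- x).
  by move=> _; rewrite normrM norm_sgnf mul1r ger0_norm ?expR_ge0.
have /leb1_msrE mpsi' := mpsi.
have [lpsi [G [G1 Glip GE]]] := damped_primitive mpsi' bpsi.
have [c c3 hc] := Hn G G1 Glip.
have sb := sincr_damped_le mpsi' bpsi.
have mS : msr leb2 (sincr psi).
  have m2 := measurable_incr mpsi'; have m3 := msr_swap m2.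
  by rewrite /sincr; apply: msrD; [apply: msrM => //; exact: msr_p1|apply: msrM; [exact: msr_p2|exact: m3]].
have iS : itg leb2 (fun p => flux K fb h p * sincr psi p).
  apply: (itg_flux_rho (C := 4) (k := sincr psi) hK e1 tfb th mS) => y z y0 z0.
  have L := Lk_monomial_le al0 a0 ab b1 hB y0 z0 a_1 o4 a_1 o4.
  have L2 := Lk_ge2 al y0 z0.
  have {}L : Lk al y z * (y * z) <= 2 * (rho y * rho z).
    by move: L; rewrite (powRr1 (ltW y0)) (powRr1 (ltW z0)); exact.
  apply: (@le_trans _ _ (Lk al y z * (2 * (y * z)))).
    by apply: ler_wpM2l; [exact: le_trans L2|exact: (sb (y, z))].
  exact: double_le.
have ix2 f : tame f -> itg leb1 (fun x => x ^+ 2 * f x * psi x).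
  move=> tf; have j2 : itg leb1 (fun x => x `^ 2%:R * `|f x|) by exact: tame_pow tf _ _.
  apply: itg_le j2; first by have mf := tm_msr tf; msr_tac.
  move=> x; have [x0|x0] := leP x 0; first by rewrite (tm_supp tf x0) !(mulr0, mul0r) normr0 mulr0.
  rewrite normrM [X in X * _]normrM (ger0_norm (sqr_ge0 x)) (powR_mulrn 2 (ltW x0)).
  rewrite ler_piMr//; first by rewrite mulr_ge0// sqr_ge0.
  apply: (le_trans (bpsi x x0)); rewrite -expR0 ler_expR oppr_le0; exact: ltW.
have E := weak_diff hK e1 hf1 hf2 mpsi lpsi (ix2 _ tf1) (ix2 _ tf2) iS.
rewrite -/h -/fb in E.
have EZ : enorm h = Itg leb1 (fun x => x ^+ 2 * h x * psi x).
  by apply: Itg_eq => x; rewrite -sgnfM /psi; ring.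
have fbm s C : 0 <= C -> itg leb1 (fun x => x `^ s * `|f1 x|) -> itg leb1 (fun x => x `^ s * `|f2 x|) ->
    absmom s f1 <= C -> absmom s f2 <= C ->
    itg leb1 (fun x => x `^ s * fb x) /\ 0 <= Itg leb1 (fun x => x `^ s * fb x) /\
    Itg leb1 (fun x => x `^ s * fb x) <= C.
  move=> C0 j1 j2 m1 m2.
  have g x : 1 / 2 * (x `^ s * `|f1 x|) + 1 / 2 * (x `^ s * `|f2 x|) = x `^ s * fb x.
    by rewrite (ger0_norm (pr_ge0 hf1 x)) (ger0_norm (pr_ge0 hf2 x)) /fb; field.
  have [i3 E3] := ItgD_eq (itgZ (1 / 2) j1) (itgZ (1 / 2) j2) g.
  split => //; split; first by apply: Itg_ge0 => // x; rewrite mulr_ge0 ?powR_ge0.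
  by rewrite E3 (ItgZ _ j1) (ItgZ _ j2); exact: avg_le.
have [p1i p10 p1C] := H1 _ _ _ hK e1 hf1; have [p2i p20 p2C] := H1 _ _ _ hK e1 hf2.
have [m1i m10 m1C] := H2 _ _ _ hK e1 hf1; have [m2i m20 m2C] := H2 _ _ _ hK e1 hf2.
have [ifp [fp0 fpC]] := fbm _ _ C10 p1i p2i p1C p2C.
have [ifm [fm0 fmC]] := fbm _ _ C20 m1i m2i m1C m2C.
have [if1 N1] := profile_number hK e1 hf1; have [if2 N2] := profile_number hK e1 hf2.
have [ifb Nfb] : itg leb1 fb /\ Itg leb1 fb <= 2.
  have g x : 1 / 2 * f1 x + 1 / 2 * f2 x = fb x by rewrite /fb; field.
  have [i3 ->] := ItgD_eq (itgZ (1 / 2) if1) (itgZ (1 / 2) if2) g.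
  by rewrite (ItgZ _ if1) (ItgZ _ if2); split => //; exact: avg_le.
have [ix1 M1] := profile_mass hf1; have [ixx2 M2] := profile_mass hf2.
have [ixb Mfb] : itg leb1 (fun x => x * fb x) /\ Itg leb1 (fun x => x * fb x) = 1.
  have g x : 1 / 2 * (x * f1 x) + 1 / 2 * (x * f2 x) = x * fb x by rewrite /fb; field.
  have [i3 ->] := ItgD_eq (itgZ (1 / 2) ix1) (itgZ (1 / 2) ixx2) g.
  by rewrite (ItgZ _ ix1) (ItgZ _ ixx2) M1 M2; split => //; field.
have ih0 : itg leb1 (fun x => `|h x|) by apply: itg_eq iX0 _ => x; rewrite powRr0 mul1r.
have Eh0 : Itg leb1 (fun x => `|h x|) = absmom 0 h by apply: Itg_eq => x; rewrite powRr0 mul1r.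
have h1E x : x `^ 1 * `|h x| = x * `|h x|.
  have [x0|x0] := leP x 0; first by rewrite (hs0 _ x0) normr0 !mulr0.
  by rewrite powRr1// ltW.
have ih1 : itg leb1 (fun x => x * `|h x|) := itg_eq iX1 h1E.
have Eh1 : Itg leb1 (fun x => x * `|h x|) = absmom 1 h := esym (Itg_eq _ h1E).
have mK : msr leb2 (fun p : R * R => K p.1 p.2) by apply/leb2_msrE; exact: k_meas hK.
have m1' := msr_fst mfb; have m2' := msr_snd mh.
(* The flux is split as K = (K - 2) + 2: [W] is the perturbation, and [M] below the part of the
   constant kernel. *)
pose W (p : R * R) : R := (K p.1 p.2 - 2) * fb p.1 * h p.2 * sincr psi p.
have [w1 Ew1] := Itg_prod ifp iXm; have [w2 Ew2] := Itg_prod ifm iXp.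
have [w3 Ew3] := ItgD_eq w1 w2 (fun=> erefl).
have [w4 Ew4] := ItgZ_eq (c := 2 * eps) w3 (fun=> erefl).
have Wb p : `|W p| <= 2 * eps * (p.1 `^ (1 + al) * fb p.1 * (p.2 `^ (1 - al) * `|h p.2|) +
    p.1 `^ (1 - al) * fb p.1 * (p.2 `^ (1 + al) * `|h p.2|)).
  have [p1|p1] := leP p.1 0; first by rewrite /W (fbs0 _ p1) !(mulr0, mul0r) addr0 normr0 mulr0.
  have [p2|p2] := leP p.2 0; first by rewrite /W (hs0 _ p2) !(normr0, mulr0, mul0r) addr0 mulr0.
  have kn := kernel_near2 hK p1 p2; rewrite LkE// in kn.
  rewrite /W normrM normr3 (ger0_norm (fb0 p.1)) -!powR_addx//.
  apply: (@le_trans _ _ ((eps * (p.1 `^ al * p.2 `^ (- al) + p.1 `^ (- al) * p.2 `^ al)) *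
     (fb p.1 * `|h p.2|) * (2 * (p.1 * p.2)))).
    apply: ler_pM => //; [by apply: mulr_ge0 => //; apply: mulr_ge0| |exact: sb].
    by rewrite -mulrA; apply: ler_wpM2r => //; apply: mulr_ge0.
  by rewrite le_eqVlt; apply/orP; left; apply/eqP; ring.
have iW : itg leb2 W.
  by apply: itg_le w4 => //; rewrite /W; msr_tac.
have WY : `|Itg leb2 W| <= eps * (2 * (C1 + C2)) * Y.
  apply: (le_trans (Itg_abs_le iW w4 Wb)); rewrite Ew4 Ew3 Ew1 Ew2.
  have t1 : Itg leb1 (fun x => x `^ (1 + al) * fb x) * absmom (1 - al) h <= C1 * Y by exact: ler_pM.
  have t2 : Itg leb1 (fun x => x `^ (1 - al) * fb x) * absmom (1 + al) h <= C2 * Y by exact: ler_pM.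
  have -> : eps * (2 * (C1 + C2)) * Y = 2 * eps * (C1 * Y + C2 * Y) by ring.
  by apply: ler_wpM2l; [exact: mulr_ge0|exact: lerD].
pose M (p : R * R) : R := fb p.1 * h p.2 * sincr psi p.
have iM : itg leb2 M.
  apply: (itg_bilin (C := 2) _ _ ixb ih1); first by rewrite /M; msr_tac.
  move=> p.
  have [p1|p1] := leP p.1 0; first by rewrite /M (fbs0 _ p1) !(mulr0, mul0r) normr0.
  have [p2|p2] := leP p.2 0; first by rewrite /M (hs0 _ p2) !(normr0, mulr0, mul0r).
  rewrite /M normr3 (ger0_norm (fb0 p.1)).
  have -> : 2 * (p.1 * fb p.1 * (p.2 * `|h p.2|)) = fb p.1 * `|h p.2| * (2 * (p.1 * p.2)) by ring.
  by apply: ler_wpM2l; [exact: mulr_ge0|exact: sb].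
have EWM : Itg leb2 (fun p => flux K fb h p * sincr psi p) = Itg leb2 W + 2 * Itg leb2 M.
  have g p : W p + 2 * M p = flux K fb h p * sincr psi p by rewrite /W /M /flux; ring.
  by have [_ ->] := ItgD_eq iW (itgZ 2 iM) g; rewrite (ItgZ _ iM).
have ixh : itg leb1 (fun x => x * `|h x|) := ih1.
have ixfb : itg leb1 (fun x => x * `|fb x|).
  by apply: itg_eq ixb _ => x; rewrite (ger0_norm (fb0 x)).
have br q : 0 < q -> itg leb2 (fun p => fb p.1 * h p.2 * bracket q p) /\
    `|Itg leb2 (fun p => fb p.1 * h p.2 * bracket q p)| <=
     eps * (2 * CL * (q ^+ 2 + 2 * q)) * Y.
  move=> q1; have [j1 j2] := HL _ _ _ _ _ hK e1 hf1 hf2 q1; split => //.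
  apply: (le_trans j2).
  have -> : eps * (2 * CL * (q ^+ 2 + 2 * q)) * Y = (eps * CL * (q ^+ 2 + 2 * q)) * (Y + Y) by ring.
  apply: ler_wpM2l; last exact: lerD.
  apply: mulr_ge0; first exact: mulr_ge0.
  by rewrite addr_ge0 ?sqr_ge0// mulr_ge0// ltW.
(* [M] with the primitive of psi replaced by its exponential sum: a finite combination of
   brackets. *)
pose T (p : R * R) : R := \sum_(i < n) c i.+1 * (fb p.1 * h p.2 * bracket i.+1%:R p).
have q1 (i : nat) : 0 < i.+1%:R :> R by rewrite ltr0n.
have iT : itg leb2 T.
  by apply: itg_sum => i; apply: itgZ; have [] := br _ (q1 i).
have TY : `|Itg leb2 T| <= eps * S * Y.
  rewrite /T Itg_sum; last by move=> i; apply: itgZ; have [] := br _ (q1 i).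
  apply: (le_trans (ler_norm_sum _ _ _)); rewrite /S mulr_sumr mulr_suml.
  apply: ler_sum => i _; have [j1 b1'] := br _ (q1 i).
  rewrite (ItgZ _ j1) normrM.
  have -> : eps * (3 ^+ n * D i.+1) * Y = 3 ^+ n * (eps * D i.+1 * Y) by ring.
  by apply: ler_pM.
have [iMT EMT] := ItgB_eq iM iT (fun=> erefl).
have [k1 F1] := Itg_prod ixb ih0; have [k2 F2] := Itg_prod ifb ih1.
have [k3 F3] := ItgD_eq k1 k2 (fun=> erefl).
have [k4 F4] := ItgZ_eq (c := 2 * eta) k3 (fun=> erefl).
have MTb p : `|M p - T p| <= 2 * eta * (p.1 * fb p.1 * `|h p.2| + fb p.1 * (p.2 * `|h p.2|)).
  have -> : M p - T p = fb p.1 * h p.2 * (sincr psi p - \sum_(i < n) c i.+1 * bracket i.+1%:R p).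
    by rewrite mulrBr mulr_sumr /M /T; congr (_ - _); apply: eq_bigr => i _; ring.
  have [p1|p1] := leP p.1 0; first by rewrite (fbs0 _ p1) !(mulr0, mul0r) addr0 normr0 mulr0.
  have [p2|p2] := leP p.2 0; first by rewrite (hs0 _ p2) !(normr0, mulr0, mul0r) addr0 mulr0.
  have sE : sincr psi p = p.1 * (G (p.1 + p.2) - G p.1) + p.2 * (G (p.2 + p.1) - G p.2).
    by rewrite /sincr !GE.
  rewrite sE normr3 (ger0_norm (fb0 p.1)).
  have -> : 2 * eta * (p.1 * fb p.1 * `|h p.2| + fb p.1 * (p.2 * `|h p.2|)) =
    fb p.1 * `|h p.2| * (2 * eta * (p.1 + p.2)) by ring.
  apply: ler_wpM2l; first exact: mulr_ge0.
  have := expsum_bracket p1 p2 hc; by case: p {p1 p2 sE}.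
have MTY : `|Itg leb2 M - Itg leb2 T| <= 6 * eta * Y.
  rewrite -EMT; apply: (le_trans (Itg_abs_le iMT k4 MTb)).
  rewrite F4 F3 F1 F2 Mfb Eh0 Eh1 mul1r.
  have t1 : Itg leb1 fb * absmom 1 h <= 2 * Y.
    by apply: ler_pM => //; apply: Itg_ge0.
  have -> : 6 * eta * Y = 2 * eta * (Y + 2 * Y) by ring.
  by apply: ler_wpM2l; [rewrite mulr_ge0// ltW|exact: lerD].
have ZY : enorm h <= eps * C3 * Y + 12 * eta * Y.
  rewrite EZ E EWM.
  move: WY TY MTY; rewrite !ler_norml => /andP[_ W1] /andP[_ T1] /andP[_ T2].
  rewrite /C3; move: (Itg leb2 W) (Itg leb2 M) (Itg leb2 T) W1 T1 T2 => u v w W1 T1 T2.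
  have -> : eps * (2 * (C1 + C2) + 2 * S) * Y + 12 * eta * Y =
    eps * (2 * (C1 + C2)) * Y + 2 * (eps * S * Y) + 2 * (6 * eta * Y) by ring.
  have v1 : v <= eps * S * Y + 6 * eta * Y by rewrite -[v](subrK w) addrC lerD.
  by apply: (@le_trans _ _ (u + 2 * (eps * S * Y + 6 * eta * Y))); [rewrite lerD2l ler_pM2l|rewrite mulrDr addrA lerD2r lerD2r].
apply: (le_trans ZY).
have C31 : 0 < C3 + 1 by rewrite ltr_wpDl.
have e3 : eps * C3 <= t / 2.
  move: ee; rewrite ler_pdivlMr// => ee; apply: le_trans ee.
  by apply: ler_wpM2l => //; rewrite lerDl.
have -> : t * Y = t / 2 * Y + t / 2 * Y by field.
apply: lerD; first exact: ler_wpM2r.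
apply: ler_wpM2r => //; rewrite /eta le_eqVlt; apply/orP; left; apply/eqP; by field.
Qed.

End DampedEstimate.

(** * Uniqueness *)

Section Uniqueness.
Context {R : realType}.
Local Notation mu := (@lebesgue_measure R).
Local Notation pos := (`]0, +oo[%classic : set R).

Lemma Itg_abs_eq0 (u : R -> R) : itg leb1 u -> (forall x, 0 <= u x) ->
  Itg leb1 u <= 0 -> {ae mu, forall x, u x = 0}.
Proof.
move=> iu u0 Iu; have I0 : Itg leb1 u = 0 by apply/eqP; rewrite eq_le Iu (Itg_ge0 iu u0).
move/leb1_itgE : iu => iu; rewrite leb1_ItgE in I0.
have E : (\int[mu]_(x in setT) `|(EFin \o u) x| = 0)%E.
  transitivity (\int[mu]_x (u x)%:E)%E; last by rewrite (Ir_EFin iu) I0.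
  by apply: eq_integral => x _ /=; rewrite ger0_norm.
have mu_ : measurable_fun setT (EFin \o u) by apply/measurable_EFinP; exact: integ_meas iu.
have := (ae_eq_integral_abs mu measurableT mu_).1 E.
apply: (@filterS _ _ (ae_filter_ringOfSetsType mu)) => x /(_ I) /=.
by case.
Qed.

Lemma normalised_profile_unique (al : R) : 0 <= al -> al < 1 ->
  exists2 eps0, 0 < eps0 & forall eps K f1 f2, kernel al eps K -> eps <= eps0 ->
    profile K f1 -> profile K f2 -> {ae mu, forall x, f1 x = f2 x}.
Proof.
(* a lies halfway between 0 and 1 - al, so that both a > 0 and b < 1. *)
move=> al0 al1; pose a := (1 - al) / 2; pose b := a + al.
have a0 : 0 < a by rewrite divr_gt0// subr_gt0.
have a1 : a <= 1 by rewrite /a; lra.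
have b1 : b < 1 by rewrite /b /a; lra.
have r0 : 0 <= 2 * (al / a) by rewrite mulr_ge0// divr_ge0// ltW.
(* B meets two demands at once: monomials of degree up to 4 shifted by al, and the extra power 2 al
   / a of y that [Lk_bad_weight] trades for z^(-al). *)
pose B := 4 + al + 2 * (al / a).
have hB : 4 + al <= B by rewrite /B lerDl.
have hB2 : 2 + al + 2 * (al / a) <= B by rewrite /B lerD2r lerD2r ler_nat.
have [C [eps1 e10 H1]] := coercivity al0 a0 a1 erefl b1 hB hB2.
(* This t gives C t <= 1/2, so that Y <= C Z <= Y / 2 and Y vanishes. *)
have t0 : 0 < (2 * (`|C| + 1))^-1 by rewrite invr_gt0 mulr_gt0// ltr_wpDl.
have [eps2 e20 H2] := damped_estimate al0 a0 a1 erefl b1 hB t0.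
exists (Num.min 1 (Num.min eps1 eps2)); first by rewrite !lt_min ltr01 e10 e20.
move=> eps K f1 f2 hK; rewrite !le_min => /and3P[e1 ee1 ee2] hf1 hf2.
have [tf1 tf2 C0 HY] := H1 _ _ _ _ hK e1 ee1 hf1 hf2.
have HZ := H2 _ _ _ _ hK e1 ee2 hf1 hf2 tf1 tf2.
have th := tameB tf1 tf2.
pose h x := f1 x - f2 x; rewrite -/h in HY HZ th.
have [iY _] := tame_tau al0 a0 a1 erefl b1 hB hB2 th.
have Y0 : 0 <= wnorm a h by apply: Itg_ge0 => // x; rewrite mulr_ge0 ?tau_ge0.
have Yle : wnorm a h <= 0.
  have C1 : C * (2 * (`|C| + 1))^-1 <= 1 / 2.
    have p0 : 0 < 2 * (`|C| + 1) by rewrite -invr_gt0.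
    rewrite ler_pdivrMr// (ger0_norm C0); lra.
  have h1 : wnorm a h <= C * ((2 * (`|C| + 1))^-1 * wnorm a h).
    by apply: (le_trans HY); apply: ler_wpM2l.
  have h2 : C * (2 * (`|C| + 1))^-1 * wnorm a h <= 1 / 2 * wnorm a h by exact: ler_wpM2r.
  by move: h1; rewrite mulrA => /le_trans /(_ h2); move: (wnorm a h) => v; lra.
have := Itg_abs_eq0 iY _ Yle => /(_ _) ae0.
have {}ae0 := ae0 (fun x => mulr_ge0 (tau_ge0 a x) (normr_ge0 _)).
apply: (@filterS _ _ (ae_filter_ringOfSetsType mu) _ _ _ ae0) => x /eqP.
have [x0 _|x0] := leP x 0; first by rewrite (tm_supp tf1 x0) (tm_supp tf2 x0).
rewrite mulf_eq0 normr_eq0 => /orP[|/eqP].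
  by rewrite gt_eqF// ltr_wpDr ?powR_ge0// powR_gt0.
by move=> /eqP; rewrite subr_eq0 => /eqP.
Qed.

(** Undoes the normalisation: the integral of |F - G| scales by a positive factor under dilation, so
    one integral vanishes exactly when the other does. *)
Lemma ae_scale (F G : R -> R) (c : R) : 0 < c -> measurable_fun setT F -> measurable_fun setT G ->
  {ae mu, forall x, F (c * x) = G (c * x)} -> {ae mu, forall x, F x = G x}.
Proof.
move=> c0 mF mG FG; pose D x := `|F x - G x|.
have mD : measurable_fun setT (fun x => (D x)%:E).
  apply/measurable_EFinP; apply: measurableT_comp => //; exact: measurable_funB.
have D0 x : (0 <= (D x)%:E)%E by rewrite lee_fin; exact: normr_ge0.
have S := ge0_integral_scale c0 mD D0.
have L0 : (\int[mu]_x (D (c * x))%:E = 0)%E.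
  transitivity (\int[mu]_(x in setT) (0%E : \bar R))%E; last by rewrite integral0.
  apply: ge0_ae_eq_integral => //.
  - by apply: (measurableT_comp mD); exact: mulrl_measurable.
  - apply: (@filterS _ _ (ae_filter_ringOfSetsType mu) _ _ _ FG) => x e _.
    by rewrite /D e subrr normr0.
have I0 : (\int[mu]_x (D x)%:E = 0)%E.
  move: S; rewrite L0 => /esym/eqP; rewrite mule_eq0 => /orP[|/eqP //].
  by rewrite eqe invr_eq0 gt_eqF.
have E : (\int[mu]_(x in setT) `|(EFin \o D) x| = 0)%E.
  by rewrite -[RHS]I0; apply: eq_integral => x _ /=; rewrite normr_id.
have := (ae_eq_integral_abs mu measurableT mD).1 E.
apply: (@filterS _ _ (ae_filter_ringOfSetsType mu)) => x /(_ I) /= [] /eqP.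
by rewrite normr_eq0 subr_eq0 => /eqP.
Qed.

End Uniqueness.

Theorem theorem1p1 (R : realType) (alpha C0 : R) :
  0 <= alpha -> alpha < 1 -> 0 < C0 ->
  exists eps0 : R, 0 < eps0 /\
    forall (eps : R) (K : R -> R -> R), 0 < eps -> eps <= eps0 ->
      kernel_assumptions alpha eps C0 K ->
      forall (f1 f2 : R -> R) (M : R), 0 < M ->
        self_similar_profile K f1 -> self_similar_profile K f2 ->
        mass f1 = M%:E -> mass f2 = M%:E ->
        {ae (@lebesgue_measure R), forall x, 0 < x -> f1 x = f2 x}.
Proof.
move=> al0 al1 _; have [eps0 e0 H] := normalised_profile_unique al0 al1.
exists eps0; split => // eps K _ ee hK f1 f2 M M0 hf1 hf2 M1 M2.
have [KE mk k0 kK] := kernel_of_assumptions hK.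
set k := K 1 in KE mk k0 kK.
pose pos := (`]0, +oo[%classic : set R).
(* [K] and [pos_kernel k] agree on the open quadrant, and the domain 0 < y < x, z > x - y of the
   profile equation lies inside it. *)
have hp f : self_similar_profile K f -> mass f = M%:E ->
    measurable_fun setT (f \_ pos) /\ profile (pos_kernel k) (fun x => M * (f \_ pos) (M * x)).
  move=> [[mf _] f0 _ fE] fM; split.
    by apply/(measurable_restrictT f (measurable_itv `]0, +oo[)); exact: mf.
  apply: (normalised_profile mk k0 M0 mf f0 fM).
  apply: (@filterS _ _ (ae_filter_ringOfSetsType lebesgue_measure) _ _ _ fE) => x fx x0.
  rewrite (fx x0); apply: eq_integral => y; rewrite inE/= in_itv/= => /andP[y0 yx].
  apply: eq_integral => z; rewrite inE/= in_itv/= andbT => yz.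
  have z0 : 0 < z by apply: lt_trans yz; rewrite subr_gt0.
  by rewrite /pos_kernel y0 z0/= -KE.
have [m1 p1] := hp _ hf1 M1; have [m2 p2] := hp _ hf2 M2.
have ae1 := H _ _ _ _ kK ee p1 p2.
have ae2 : {ae lebesgue_measure, forall x, (f1 \_ pos) x = (f2 \_ pos) x}.
  apply: (ae_scale M0 m1 m2).
  apply: (@filterS _ _ (ae_filter_ringOfSetsType lebesgue_measure) _ _ _ ae1) => x.
  by apply: mulfI; rewrite gt_eqF.
apply: (@filterS _ _ (ae_filter_ringOfSetsType lebesgue_measure) _ _ _ ae2) => x + x0.
have xp : x \in pos by rewrite inE /pos /= in_itv/= x0.
by rewrite !patchE xp.
Qed.
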